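(* Let $\lambda_B\approx 2.35698$ be the unique positive root of $x^8-2x^7-x^5-x^4-2x^3-2x^2-x-1$. For every real number $\gamma\geq\lambda_B$ there exists a permutation class whose growth rate is $\gamma$.
   Context: A permutation of length $n$ is a sequence containing each element of $\{1,\dots,n\}$ exactly once. A permutation $\tau$ of length $k$ is a subpermutation of $\sigma$ if $\sigma$ has a subsequence of length $k$ whose terms are in the same relative order as those of $\tau$. A permutation class is a set of permutations closed downward under the subpermutation order. For a class $\mathcal{C}$, $\mathcal{C}_n$ denotes its members of length $n$, and ''$\gamma$ is the growth rate of $\mathcal{C}$'' means that $\lim_{n\to\infty}|\mathcal{C}_n|^{1/n}$ exists and equals $\gamma$. *)

(* Defs.v *)
From mathcomp Require Import all_boot all_order all_algebra.
From mathcomp Require Import all_classical all_reals all_analysis.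
Set Implicit Arguments. Unset Strict Implicit. Unset Printing Implicit Defensive.
Import Order.TTheory GRing.Theory Num.Theory.
Import numFieldNormedType.Exports.
Local Open Scope classical_set_scope.
Local Open Scope ring_scope.

Definition is_perm (s : seq nat) : Prop := perm_eq s (iota 1 (size s)).

Definition order_iso (s t : seq nat) : Prop :=
  size s = size t /\
  forall i j, (i < size s)%N -> (j < size s)%N ->
    (nth 0 s i < nth 0 s j)%N = (nth 0 t i < nth 0 t j)%N.

Definition subperm (tau sigma : seq nat) : Prop :=
  exists m : bitseq, order_iso tau (mask m sigma).

Definition perm_class (C : pred (seq nat)) : Prop :=
  (forall s, C s -> is_perm s) /\
  (forall sigma tau, C sigma -> is_perm tau -> subperm tau sigma -> C tau).

(* |C_n| : number of members of C of length n
   ([permutations (iota 1 n)] lists every permutation of length n exactly once). *)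
Definition class_count (C : pred (seq nat)) (n : nat) : nat :=
  count C (permutations (iota 1 n)).

Definition growth_rate_is (R : realType) (C : pred (seq nat)) (gamma : R) : Prop :=
  (fun n : nat => powR ((class_count C n)%:R : R) (n%:R^-1)) @ \oo --> gamma.

(* Main.v *)
(* Idea.  A class closed under direct sums is determined by its sum-indecomposable members.
   If r_n of them have length n and sum_n r_n g^(-n) = 1, the renewal equation shows that its
   growth rate is g.  Such a set is found between two downsets D and H of indecomposables,
   the weight sum_n r_n g^(-n) being at most 1 for D and at least 1 for H: run through H by
   increasing length and accept whatever keeps the set a downset and the weight at most 1.
   This reaches weight exactly 1 as soon as every rejected q can be outweighed by longer
   elements of H all of whose short indecomposable parts lie in D, because the last rejected
   length would then lead to a contradiction.

   An interval of length one starting below lambda_B is covered in three pieces.  In each, D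
   consists of permutations whose inversion graphs are caterpillars (and of short ones), H is
   a larger set of caterpillars or the set of all indecomposables, and the elements that
   compensate a rejection are mostly caterpillars with long spines decorated at both ends.

   Finally, juxtaposing the members of a class with an increasing sequence turns c_n into
   roughly sum_j binom(n, j) c_j, which raises the growth rate by exactly 1, so every larger
   value is reached as well. *)

Require Import Defs.
From mathcomp Require Import all_boot all_order all_algebra.
From mathcomp Require Import zify ring lra.
From mathcomp Require Import all_classical all_reals all_analysis.
Set Implicit Arguments. Unset Strict Implicit. Unset Printing Implicit Defensive.
Local Open Scope nat_scope.

(** * Permutations and sum-closed classes *)

(** Two demands on D compete. Its weight at u = 1/g must not exceed 1, which asks for few
    permutations when u is large; but D must also be rich enough that longer permutations, outside D
    and with all short parts in D, weigh at least u^n for every length n of a possible rejection.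
    Relative to u^n the weight of these compensators decreases with u, and this dictates the pieces.
    The set [forkD 3] serves from u = 10/29, just above the root of 2(u + u^2 + u^3) = 1, up to u =
    262/625, where the bound on its weight is about 0.9995. For smaller u there is room for the
    larger [forkD4], with forks of two sizes as compensators. For larger u one passes to [lowD],
    whose bound is about 0.9993 at 143/337, just above 1/lambda_B. There the candidates [lowH] are
    given by degree sequences and counted by Fibonacci numbers; their total weight u/(1 - u - u^2)
    reaches 1 at u = sqrt 2 - 1, below 262/625. *)

Definition emb (tau sigma : seq nat) (f : nat -> nat) : Prop :=
  [/\ forall a, a < size tau -> f a < size sigma,
      forall a b, a < b -> b < size tau -> f a < f b &
      forall a b, a < size tau -> b < size tau ->
        (nth 0 tau a < nth 0 tau b) = (nth 0 sigma (f a) < nth 0 sigma (f b))].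

(** Masks select positions in increasing order, so they correspond to strictly increasing position
    maps. Maps compose and restrict easily, which is why later arguments use [emb]. *)
Lemma subpermP tau sigma : subperm tau sigma <-> exists f, emb tau sigma f.
Proof.
split=> [[m [sz iso]]|[f [fsz fmon fiso]]].
  pose L := mask m (iota 0 (size sigma)).
  have EL : mask m sigma = map (nth 0 sigma) L.
    by rewrite /L map_mask map_nth_iota0 // take_size.
  have szL : size L = size tau by rewrite sz EL size_map.
  have sL : sorted ltn L.
    apply: (subseq_sorted ltn_trans (mask_subseq _ _)); exact: iota_ltn_sorted.
  exists (nth 0 L); split.
  - move=> a Ha; have : nth 0 L a \in L by rewrite mem_nth // szL.
    by move/mem_mask; rewrite mem_iota.
  - move=> a b ab bs; apply: (sorted_ltn_nth ltn_trans 0 sL) => //; rewrite inE szL //.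
    exact: ltn_trans bs.
  - move=> a b Ha Hb; rewrite iso // EL !(nth_map 0) ?szL //.
pose L := map f (iota 0 (size tau)).
have sL : sorted ltn L.
  rewrite sorted_map; apply/(sortedP 0) => i; rewrite size_iota => Hi.
  by rewrite /= !nth_iota ?add0n //; [exact: fmon|exact: ltn_trans Hi].
have EL : L = mask (map (mem L) (iota 0 (size sigma))) (iota 0 (size sigma)).
  rewrite -filter_mask; apply: (irr_sorted_eq ltn_trans ltnn) => //.
    by apply: sorted_filter; [exact: ltn_trans|exact: iota_ltn_sorted].
  move=> x; rewrite mem_filter mem_iota add0n /=.
  case H: (x \in L) => //=; move: H => /mapP[a]; rewrite mem_iota /= add0n => Ha ->.
  by rewrite fsz.
have Em : mask (map (mem L) (iota 0 (size sigma))) sigma = map (nth 0 sigma) L.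
  rewrite [in RHS]EL map_mask.
  by rewrite map_nth_iota0 // take_size.
exists (map (mem L) (iota 0 (size sigma))); split.
  by rewrite Em size_map size_map size_iota.
move=> a b Ha Hb.
rewrite Em.
rewrite !(nth_map 0) ?size_map ?size_iota // !nth_iota // !add0n.
exact: fiso.
Qed.

Lemma subperm_refl s : subperm s s.
Proof. by apply/subpermP; exists id; split. Qed.

Lemma subperm_trans s t r : subperm s t -> subperm t r -> subperm s r.
Proof.
move=> /subpermP[f [f1 f2 f3]] /subpermP[g [g1 g2 g3]]; apply/subpermP.
exists (g \o f); split=> [a Ha|a b ab Hb|a b Ha Hb] /=.
- exact/g1/f1.
- by apply: g2; [exact: f2|exact: f1].
- by rewrite f3 // g3 //; exact: f1.
Qed.

Lemma subperm_size s t : subperm s t -> size s <= size t.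
Proof.
by move=> [m [-> _]]; exact: size_subseq (mask_subseq _ _).
Qed.

Lemma is_perm_uniq s : is_perm s -> uniq s.
Proof. by move=> H; rewrite (perm_uniq H) iota_uniq. Qed.

Lemma mem_is_perm s x : is_perm s -> (x \in s) = (0 < x <= size s).
Proof. by move=> H; rewrite (perm_mem H) mem_iota add1n ltnS. Qed.

(** * Ranks and standardization *)

Definition rk (s : seq nat) (x : nat) := count (fun y => y <= x) s.
Definition stdz (s : seq nat) := [seq rk s x | x <- s].

Lemma rk_perm s x : is_perm s -> x <= size s -> rk s x = x.
Proof.
move=> H Hx; rewrite /rk (permP H).
have -> : iota 1 (size s) = iota 1 x ++ iota (1 + x) (size s - x).
  by rewrite -iotaD subnKC.
rewrite count_cat [X in _ + X](_ : _ = 0) ?addn0.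
  rewrite -[RHS](size_iota 1 x) -(@count_predT _ (iota 1 x)).
  by apply: eq_in_count => y; rewrite mem_iota add1n ltnS => /andP[].
apply/eqP; rewrite -leqn0 leqNgt -has_count; apply/hasPn => y.
by rewrite mem_iota => /andP[]; rewrite add1n -ltnNge.
Qed.

Lemma order_iso_sym s t : order_iso s t -> order_iso t s.
Proof. by move=> [sz H]; split=> // i j Hi Hj; rewrite H // sz. Qed.

Lemma order_iso_trans s t r : order_iso s t -> order_iso t r -> order_iso s r.
Proof.
move=> [sz H] [sz' H']; split; first by rewrite sz.
by move=> i j Hi Hj; rewrite H // H' // -sz.
Qed.

Lemma order_iso_rk s t i : order_iso s t -> i < size s ->
  rk s (nth 0 s i) = rk t (nth 0 t i).
Proof.
move=> [sz H] Hi; rewrite /rk.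
have E r : r = map (nth 0 r) (iota 0 (size r)) by rewrite map_nth_iota0 // take_size.
rewrite {2}(E s) {2}(E t) !count_map -sz.
apply: eq_in_count => j; rewrite mem_iota add0n /= => Hj.
by rewrite [in LHS]leqNgt [in RHS]leqNgt H.
Qed.

(** In a permutation every entry equals its rank, and ranks are invariant under order
    isomorphism. *)
Lemma perm_order_iso_eq s t : is_perm s -> is_perm t -> order_iso s t -> s = t.
Proof.
move=> ps pt iso; have [sz _] := iso; apply: (@eq_from_nth _ 0) => // i Hi.
rewrite -[LHS](@rk_perm s) //; last by have := mem_nth 0 Hi; rewrite mem_is_perm // => /andP[].
rewrite (order_iso_rk iso) // rk_perm //.
have : nth 0 t i \in t by rewrite mem_nth // -sz.
by rewrite mem_is_perm // => /andP[].
Qed.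

Lemma leq_rk s x y : x <= y -> rk s x <= rk s y.
Proof. by move=> xy; apply: sub_count => z /= /leq_trans; apply. Qed.

Lemma ltn_rk s x y : y \in s -> (rk s x < rk s y) = (x < y).
Proof.
move=> Hy; apply/idP/idP; first by apply: contraTT; rewrite -!leqNgt; exact: leq_rk.
move=> xy; rewrite /rk.
have -> : count (fun z => z <= y) s = count (fun z => z <= x) s + count (fun z => x < z <= y) s.
  rewrite -count_predUI [X in _ + X](_ : _ = 0) ?addn0.
    apply: eq_count => z /=; case: (leqP z x) => //= zx.
    by rewrite (leq_trans zx (ltnW xy)).
  apply/eqP; rewrite -leqn0 leqNgt -has_count; apply/hasPn => z _ /=.
  by rewrite ltnNge; case: (z <= x).
rewrite -[X in X < _]addn0 ltn_add2l -has_count; apply/hasP; exists y => //=.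
by rewrite xy leqnn.
Qed.

Lemma order_iso_stdz s : order_iso (stdz s) s.
Proof.
split; first by rewrite size_map.
move=> i j; rewrite size_map => Hi Hj.
by rewrite !(nth_map 0) // ltn_rk // mem_nth.
Qed.

Lemma rk_inj s : {in s &, injective (rk s)}.
Proof.
move=> x y Hx Hy E; have := ltn_rk x Hy; have := ltn_rk y Hx.
by rewrite E ltnn; case: (ltngtP x y).
Qed.

Lemma is_perm_stdz s : uniq s -> is_perm (stdz s).
Proof.
move=> us.
have us' : uniq (stdz s) by rewrite map_inj_in_uniq //; exact: rk_inj.
have sub : {subset stdz s <= iota 1 (size s)}.
  move=> y /mapP[x Hx ->]; rewrite mem_iota add1n ltnS /rk count_size andbT.
  by rewrite -has_count; apply/hasP; exists x => /=.
rewrite /is_perm size_map; apply: uniq_perm; rewrite ?iota_uniq //.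
by apply: (uniq_min_size us' sub _).2; rewrite size_map size_iota.
Qed.

Lemma subperm_iso s t : is_perm s -> is_perm t -> subperm s t -> size s = size t -> s = t.
Proof.
move=> ps pt [m [sz iso]] E; apply: perm_order_iso_eq => //.
have Em : mask m t = t.
  have /size_subseq_leqif : subseq (mask m t) t by exact: mask_subseq.
  move=> [_]; rewrite -sz E eqxx; by move/esym/eqP.
by rewrite Em in iso.
Qed.

(** * Direct sums and indecomposable permutations *)

Definition splitb (k : nat) (s : seq nat) :=
  all (fun x => all (fun y => x < y) (drop k s)) (take k s).

Definition indecb (s : seq nat) :=
  (0 < size s) && all (fun k => ~~ splitb k s) (iota 1 (size s).-1).

Definition dsum (s t : seq nat) := s ++ map (addn (size s)) t.

Lemma splitbP k s :
  reflect (forall i j, i < k -> k <= j -> j < size s -> nth 0 s i < nth 0 s j) (splitb k s).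
Proof.
apply: (iffP allP) => [H i j ik kj js|H x].
  have iks : i < size (take k s).
    by rewrite size_take; case: (ltnP k) => _ //; exact: leq_ltn_trans (leq_trans (ltnW ik) kj) js.
  have /allP := H _ (mem_nth 0 iks); rewrite nth_take //; apply.
  have -> : nth 0 s j = nth 0 (drop k s) (j - k) by rewrite nth_drop subnKC.
  by rewrite mem_nth // size_drop ltn_sub2r // (leq_ltn_trans kj).
move=> /(nthP 0)[i Hi <-]; apply/allP => y /(nthP 0)[j Hj <-].
rewrite size_drop ltn_subRL in Hj.
have ik : i < k by apply: leq_trans Hi _; rewrite size_take; case: (ltnP k).
by rewrite nth_take // nth_drop; apply: H => //; exact: leq_addr.
Qed.

Lemma indec_size s : indecb s -> 0 < size s.
Proof. by case/andP. Qed.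

Lemma indec_split s k : indecb s -> splitb k s -> k = 0 \/ size s <= k.
Proof.
move=> /andP[s0 /allP H] Hk; case: (posnP k) => [->|k0]; [by left|right].
rewrite leqNgt; apply/negP => ks.
have : k \in iota 1 (size s).-1 by rewrite mem_iota k0 add1n prednK.
by move=> /H; rewrite Hk.
Qed.

Lemma size_dsum s t : size (dsum s t) = size s + size t.
Proof. by rewrite size_cat size_map. Qed.

Lemma is_perm_dsum s t : is_perm s -> is_perm t -> is_perm (dsum s t).
Proof.
move=> ps pt; rewrite /is_perm size_dsum iotaD.
apply: perm_cat => //.
by rewrite add1n -addn1 iotaDl; exact: perm_map.
Qed.

Lemma subperm_dsuml s t : subperm s (dsum s t).
Proof.
apply/subpermP; exists id; split=> // [a Ha|a b Ha Hb].
  by rewrite size_dsum ltn_addr.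
by rewrite !nth_cat Ha Hb.
Qed.

Lemma subperm_dsumr s t : subperm t (dsum s t).
Proof.
apply/subpermP; exists (addn (size s)); split=> // [a Ha|a b Hab _|a b Ha Hb].
- by rewrite size_dsum ltn_add2l.
- by rewrite ltn_add2l.
- by rewrite !nth_cat !ltnNge !leq_addr /= !addKn !(nth_map 0) // -!ltnNge ltn_add2l.
Qed.

(* The positions sent into the left summand form an initial segment that splits [tau]. *)
Lemma indec_sub_dsum tau s t : is_perm s -> is_perm t -> indecb tau ->
  subperm tau (dsum s t) -> subperm tau s \/ subperm tau t.
Proof.
move=> ps pt Htau /subpermP[f [f1 f2 f3]].
pose P a := (size tau <= a) || (size s <= f a).
have exP : exists a, P a by exists (size tau); rewrite /P leqnn.
pose k := ex_minn exP.
have lowk a : a < k -> a < size tau /\ f a < size s.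
  rewrite /k; case: ex_minnP => m _ Hm am; have /negP : ~ P a.
    by move=> /Hm; rewrite leqNgt am.
  by rewrite /P negb_or -!ltnNge => /andP[].
have kle : k <= size tau by rewrite /k; case: ex_minnP => m _; apply; rewrite /P leqnn.
have highk a : k <= a -> a < size tau -> size s <= f a.
  move=> ka Ha; have : P k by rewrite /k; case: ex_minnP.
  rewrite /P => /orP[|Hk]; first by move/leq_trans/(_ ka); rewrite leqNgt Ha.
  move: ka; rewrite leq_eqVlt => /orP[/eqP<-//|ka].
  by apply: leq_trans Hk (ltnW _); exact: f2.
have nth_l a : a < k -> nth 0 (dsum s t) (f a) = nth 0 s (f a).
  by move=> /lowk[_ Ha]; rewrite nth_cat Ha.
have nth_r a : k <= a -> a < size tau ->
    nth 0 (dsum s t) (f a) = size s + nth 0 t (f a - size s) /\ f a - size s < size t.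
  move=> ka Ha; have H := highk a ka Ha; have := f1 a Ha; rewrite size_dsum => H'.
  have lt : f a - size s < size t by rewrite ltn_subLR.
  by rewrite nth_cat ltnNge H /= (nth_map 0).
have spl : splitb k tau.
  apply/splitbP => i j ik kj jt; have [it fi] := lowk i ik.
  rewrite f3 // nth_l //; have [-> lt] := nth_r j kj jt.
  have : nth 0 s (f i) <= size s by have := mem_nth 0 fi; rewrite mem_is_perm // => /andP[].
  move/leq_ltn_trans; apply; rewrite -[X in X < _]addn0 ltn_add2l.
  by have := mem_nth 0 lt; rewrite mem_is_perm // => /andP[].
have [k0|ks] := indec_split Htau spl.
  have k_le a : k <= a by rewrite k0.
  right; apply/subpermP; exists (fun a => f a - size s); split=> [a Ha|a b ab Hb|a b Ha Hb].
  - exact: (nth_r a (k_le a) Ha).2.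
  - have Ha := ltn_trans ab Hb; rewrite ltn_sub2r ?f2 //.
    exact: leq_ltn_trans (highk a (k_le a) Ha) (f2 _ _ ab Hb).
  - by rewrite f3 // (nth_r a (k_le a) Ha).1 (nth_r b (k_le b) Hb).1 ltn_add2l.
left; apply/subpermP; exists f; split=> [a Ha|a b ab Hb|a b Ha Hb].
- by case: (lowk a (leq_trans Ha ks)).
- exact: f2.
- by rewrite f3 // !nth_l // (leq_trans _ ks).
Qed.

(** The rank of an entry is the sum of its ranks in the prefix and in the suffix. Entries of the
    prefix get nothing from the suffix, so the prefix is its own standardization; entries of the
    suffix gain exactly [k] from the prefix. *)
Lemma splitb_dsum s k : is_perm s -> k <= size s -> splitb k s ->
  exists t, [/\ s = dsum (take k s) t, is_perm (take k s) & is_perm t].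
Proof.
move=> ps ks /allP spl.
have us := is_perm_uniq ps.
have szt : size (take k s) = k by rewrite size_takel.
have rk_cat x : rk s x = rk (take k s) x + rk (drop k s) x.
  by rewrite /rk -count_cat cat_take_drop.
have rks x : x \in s -> rk s x = x.
  by move=> Hx; rewrite rk_perm //; move: Hx; rewrite mem_is_perm // => /andP[].
have Et : stdz (take k s) = take k s.
  rewrite /stdz -[RHS]map_id; apply/eq_in_map => x Hx.
  have Hxs : x \in s by exact: mem_take Hx.
  rewrite -[RHS](rks x) // rk_cat [X in _ = _ + X](_ : _ = 0) ?addn0 //.
  apply/eqP; rewrite -leqn0 leqNgt -has_count; apply/hasPn => y Hy /=.
  by rewrite -ltnNge; exact: (allP (spl _ Hx)).
have pt : is_perm (take k s) by rewrite -Et; apply: is_perm_stdz; exact: take_uniq.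
exists (stdz (drop k s)); split=> //.
  rewrite /dsum szt -[LHS](cat_take_drop k s); congr cat.
  rewrite /stdz -map_comp -[LHS]map_id; apply/eq_in_map => x Hx /=.
  have Hxs : x \in s by exact: mem_drop Hx.
  rewrite -[LHS](rks x) // rk_cat; congr addn; rewrite -[RHS]szt.
  apply/eqP; rewrite /rk -all_count; apply/allP => y Hy.
  exact: ltnW (allP (spl _ Hy) _ Hx).
by apply: is_perm_stdz; exact: drop_uniq.
Qed.

(** The first block ends at the smallest positive split position: a split inside the block would be
    a smaller split of [s]. *)
Lemma indec_decomp s : is_perm s -> s != [::] ->
  exists w t, [/\ s = dsum w t, is_perm w, indecb w & is_perm t].
Proof.
move=> ps s0; have n0 : 0 < size s by case: s s0 {ps}.
have exk : exists k, (0 < k) && splitb k s.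
  by exists (size s); rewrite n0 /=; apply/splitbP => i j _ H /(leq_ltn_trans H); rewrite ltnn.
case: (ex_minnP exk) => k /andP[k0 spl] kmin.
have ks : k <= size s.
  by apply: kmin; rewrite n0 /=; apply/splitbP => i j _ H /(leq_ltn_trans H); rewrite ltnn.
have [t [E pw pt]] := splitb_dsum ps ks spl.
exists (take k s), t; split=> //.
have szt : size (take k s) = k by rewrite size_takel.
rewrite /indecb szt k0 /=; apply/allP => j; rewrite mem_iota add1n prednK // => /andP[j0 jk].
apply/negP => /splitbP splj.
have : k <= j.
  apply: kmin; rewrite j0 /=; apply/splitbP => a b aj jb bs.
  case: (ltnP b k) => bk; last by move/splitbP: spl; apply => //; exact: ltn_trans jk.
  have := splj a b aj jb; rewrite szt => /(_ bk).
  by rewrite !nth_take // (ltn_trans aj).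
by rewrite leqNgt jk.
Qed.

(** If [w] were the shorter one, its end would be a split position inside the indecomposable
    [w']. *)
Lemma dsum_inj_size w t w' t' : is_perm w -> is_perm w' -> indecb w' ->
  is_perm t -> 0 < size w -> dsum w t = dsum w' t' -> size w' <= size w.
Proof.
move=> pw pw' iw' pt w0 E; rewrite leqNgt; apply/negP => lt.
have nthE i : i < size w' -> nth 0 w' i = nth 0 (dsum w t) i.
  by move=> Hi; rewrite E nth_cat Hi.
have : splitb (size w) w'.
  apply/splitbP => i j iw wj jw'.
  rewrite !nthE //; last exact: ltn_trans iw lt.
  rewrite !nth_cat iw [j < _]ltnNge wj /=.
  have js : j - size w < size t.
    rewrite ltn_subLR // -size_dsum E size_dsum; exact: ltn_addr.
  rewrite (nth_map 0) //.
  have : nth 0 w i <= size w by have := mem_nth 0 iw; rewrite mem_is_perm // => /andP[].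
  move/leq_ltn_trans; apply; rewrite -[X in X < _]addn0 ltn_add2l.
  by have := mem_nth 0 js; rewrite mem_is_perm // => /andP[].
case/(indec_split iw') => [w00|]; first by rewrite w00 in w0.
by rewrite leqNgt lt.
Qed.

Lemma dsum_inj w t w' t' : is_perm w -> is_perm w' -> is_perm t -> is_perm t' ->
  indecb w -> indecb w' -> dsum w t = dsum w' t' -> w = w' /\ t = t'.
Proof.
move=> pw pw' pt pt' iw iw' E.
have sz : size w = size w'.
  apply/eqP; rewrite eqn_leq.
  rewrite (dsum_inj_size pw' pw iw pt' (indec_size iw') (esym E)).
  by rewrite (dsum_inj_size pw pw' iw' pt (indec_size iw) E).
move/eqP: E; rewrite eqseq_cat // => /andP[/eqP Ew /eqP]; rewrite -sz => Et.
by split=> //; exact: (inj_map (@addnI (size w))) Et.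
Qed.

Definition downset (W : pred (seq nat)) :=
  (forall s, W s -> is_perm s /\ indecb s) /\
  (forall s t, W s -> is_perm t -> indecb t -> subperm t s -> W t).

(** The sum closure of [W], described through indecomposable parts rather than through sums: closure
    under subpermutations is then mere transitivity, and [sumclass_dsum] recovers the sums. *)
Definition sumclass (W : pred (seq nat)) : pred (seq nat) := fun s =>
  `[< is_perm s /\ forall t, is_perm t -> indecb t -> subperm t s -> W t >].

Lemma mem_permutations_iota n s :
  (s \in permutations (iota 1 n)) <-> is_perm s /\ size s = n.
Proof.
rewrite mem_permutations; split=> [H|[H <-//]].
by have /perm_size := H; rewrite size_iota => E; rewrite /is_perm E.
Qed.

Lemma class_count0 W : downset W -> class_count W 0 = 0.
Proof.
move=> [W1 _]; rewrite /class_count; apply/eqP; rewrite -leqn0 leqNgt -has_count.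
apply/hasPn => p; rewrite mem_permutations => /perm_nilP->; apply/negP => /W1[_].
by move/indec_size.
Qed.

Lemma perm_class_sumclass W : perm_class (sumclass W).
Proof.
split=> [s /asboolP[]//|s t /asboolP[ps H] pt ts]; apply/asboolP; split=> // r pr ir rt.
by apply: H => //; exact: subperm_trans rt ts.
Qed.

Lemma sumclass_dsum W w t : downset W -> is_perm w -> indecb w -> is_perm t ->
  sumclass W (dsum w t) = W w && sumclass W t.
Proof.
move=> [W1 W2] pw iw pt; apply/asboolP/andP => [[pwt H]|[Ww /asboolP[_ H]]].
  split; first by apply: H => //; exact: subperm_dsuml.
  apply/asboolP; split=> // r pr ir rt; apply: H => //.
  exact: subperm_trans rt (subperm_dsumr _ _).
split; first exact: is_perm_dsum.
move=> r pr ir /(indec_sub_dsum pw pt ir)[rw|rt]; [exact: W2 rw|exact: H].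
Qed.

(** The renewal equation: a nonempty member has a unique first indecomposable block, of length
    [k.+1], and what follows it is an arbitrary member of length [n - k]. *)
Lemma class_count_sumclass W n : downset W ->
  class_count (sumclass W) n.+1 =
  \sum_(k < n.+1) class_count W k.+1 * class_count (sumclass W) (n - k).
Proof.
move=> dW.
pose P k := permutations (iota 1 k).
pose L k := [seq dsum w t | w <- seq.filter W (P k.+1), t <- seq.filter (sumclass W) (P (n - k))].
have memL k s : s \in L k -> exists w t, [/\ s = dsum w t, is_perm w, size w = k.+1, W w &
    [/\ is_perm t, size t = n - k & sumclass W t]].
  move=> /allpairsP[[w t] /= []]; rewrite !mem_filter.
  move=> /andP[Ww /mem_permutations_iota[pw sw]] /andP[Ct /mem_permutations_iota[pt st]] ->.
  by exists w, t.
have E : perm_eq (seq.filter (sumclass W) (P n.+1)) [seq s | k <- iota 0 n.+1, s <- L k].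
  apply: uniq_perm.
  - by rewrite filter_uniq // permutations_uniq.
  - apply: allpairs_uniq_dep; first exact: iota_uniq.
      move=> k _; apply: allpairs_uniq; rewrite ?filter_uniq ?permutations_uniq //.
      move=> [w t] [w' t'] /allpairsP[[a b] /= [Ha Hb [-> ->]]].
      move=> /allpairsP[[a' b'] /= [Ha' Hb' [-> ->]]] /=.
      move: Ha Hb Ha' Hb'; rewrite !mem_filter.
      move=> /andP[Wa /mem_permutations_iota[pa _]] /andP[_ /mem_permutations_iota[pb _]].
      move=> /andP[Wa' /mem_permutations_iota[pa' _]] /andP[_ /mem_permutations_iota[pb' _]].
      by move=> /dsum_inj[] // ; [exact: (dW.1 a Wa).2|exact: (dW.1 a' Wa').2|move=> -> ->].
    move=> x y /allpairsPdep[k [s [_ Hs ->]]] /allpairsPdep[k' [s' [_ Hs' ->]]] /= Ess.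
    rewrite -{s'}Ess in Hs' *; have [w [t [E pw sw Ww [pt _ _]]]] := memL _ _ Hs.
    have [w' [t' [E' pw' sw' Ww' [pt' _ _]]]] := memL _ _ Hs'.
    have [ww' _] : w = w' /\ t = t'.
      apply: dsum_inj; rewrite -?E //; [exact: (dW.1 w Ww).2|exact: (dW.1 w' Ww').2].
    by move: sw sw'; rewrite ww' => -> [->].
  - move=> s; apply/idP/allpairsPdep => [|[k [s' [Hk Hs ->]]]].
      rewrite mem_filter => /andP[Cs /mem_permutations_iota[ps sz]].
      have [|w [t [E pw iw pt]]] := indec_decomp ps; first by case: s sz {Cs ps}.
      have sz' : size w + size t = n.+1 by rewrite -size_dsum -E.
      have w0 := indec_size iw.
      exists (size w).-1, s; rewrite mem_iota add0n /= prednK // -sz' leq_addr; split=> //.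
      move: Cs; rewrite E sumclass_dsum // => /andP[Ww Ct].
      apply/allpairsP; exists (w, t); rewrite !mem_filter /= Ww Ct /= prednK //; split=> //.
        exact/mem_permutations_iota.
      apply/mem_permutations_iota; split=> //.
      by rewrite -(addKn (size w) (size t)) sz' -subn1 subnBA // addn1.
    have [w [t [-> pw sw Ww [pt st Ct]]]] := memL _ _ Hs.
    rewrite mem_filter sumclass_dsum //; last exact: (dW.1 w Ww).2.
    rewrite Ww Ct /=; apply/mem_permutations_iota; split; first exact: is_perm_dsum.
    move: Hk; rewrite mem_iota add0n ltnS /= => kn.
    by rewrite size_dsum sw st addSn subnKC.
rewrite /class_count -size_filter (perm_size E) size_allpairs_dep.
rewrite sumnE big_map -[iota 0 n.+1]/(index_iota 0 n.+1) big_mkord; apply: eq_bigr => k _.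
by rewrite size_allpairs !size_filter.
Qed.

Lemma class_count_sumclass0 W : class_count (sumclass W) 0 = 1.
Proof.
rewrite /class_count.
have : sumclass W [::].
  apply/asboolP; split=> // t _ /indec_size t0 /subperm_size; rewrite leqn0 => /eqP E.
  by rewrite E in t0.
by rewrite /= /permutations /= => ->.
Qed.

(** * Juxtaposition with an increasing sequence *)

Definition juxt (C : pred (seq nat)) : pred (seq nat) := fun s =>
  `[< is_perm s /\ exists j, [/\ j <= size s, C (stdz (take j s)) & sorted ltn (drop j s)] >].

Lemma order_iso_subperm s t : order_iso s t -> subperm s t.
Proof.
move=> [sz H]; apply/subpermP; exists id; split=> //.
by move=> a Ha; rewrite -sz.
Qed.

(** The entries of [t] sent before position [j] form a prefix, since embeddings are increasing; its
    length [k] is the dividing point that [t] inherits. *)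
Lemma perm_class_juxt C : perm_class C -> perm_class (juxt C).
Proof.
move=> [_ C2]; split=> [s /asboolP[]//|s t /asboolP[ps [j [js Cj sj]]] pt /subpermP[f [f1 f2 f3]]].
apply/asboolP; split=> //.
pose P a := (size t <= a) || (j <= f a).
have exP : exists a, P a by exists (size t); rewrite /P leqnn.
pose k := ex_minn exP.
have lowk a : a < k -> a < size t /\ f a < j.
  rewrite /k; case: ex_minnP => m _ Hm am; have /negP : ~ P a.
    by move=> /Hm; rewrite leqNgt am.
  by rewrite /P negb_or -!ltnNge => /andP[].
have kle : k <= size t by rewrite /k; case: ex_minnP => m _; apply; rewrite /P leqnn.
have highk a : k <= a -> a < size t -> j <= f a.
  move=> ka Ha; have : P k by rewrite /k; case: ex_minnP.
  rewrite /P => /orP[|Hk]; first by move/leq_trans/(_ ka); rewrite leqNgt Ha.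
  move: ka; rewrite leq_eqVlt => /orP[/eqP<-//|ka].
  by apply: leq_trans Hk (ltnW _); exact: f2.
exists k; split=> //.
  apply: (C2 _ _ Cj); first by apply: is_perm_stdz; exact/take_uniq/is_perm_uniq.
  apply: (subperm_trans (order_iso_subperm (order_iso_stdz _))).
  apply: (@subperm_trans _ (take j s)); last first.
    by apply: order_iso_subperm; apply: order_iso_sym; exact: order_iso_stdz.
  have szs : size (take j s) = j by rewrite size_takel.
  apply/subpermP; exists f; rewrite /emb size_takel //; split=> [a /lowk[_]|a b ab bk|a b ak bk].
  - by rewrite szs.
  - by apply: f2 => //; exact: leq_trans bk kle.
  - have [[? ?] [? ?]] := (lowk a ak, lowk b bk).
    by rewrite !nth_take // f3.
apply/(sortedP 0) => i; rewrite size_drop ltn_subRL => Hi.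
have Hi' : k + i < size t by apply: ltn_trans Hi; rewrite ltn_add2l.
rewrite !nth_drop /= f3 //.
have h1 := highk (k + i) (leq_addr _ _) Hi'.
have h2 := highk (k + i.+1) (leq_addr _ _) Hi.
rewrite -(subnKC h1) -(subnKC h2) -!nth_drop.
have lt : f (k + i) < f (k + i.+1) by apply: f2 => //; rewrite ltn_add2l.
apply: (sorted_ltn_nth ltn_trans 0 sj); rewrite ?inE ?size_drop ?ltn_sub2r ?f1 //.
- exact: leq_ltn_trans h1 (f1 _ Hi').
- exact: leq_ltn_trans h1 (f1 _ Hi').
- exact: leq_ltn_trans h1 lt.
Qed.

Section Count.
Variable n : nat.

Definition vals (A : {set 'I_n}) := [seq (val i).+1 | i <- enum A].

Lemma sorted_vals A : sorted ltn (vals A).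
Proof.
have : subseq (vals A) (iota 1 n).
  rewrite /vals -[1]addn0 iotaDl -val_enum_ord -map_comp.
  by apply: map_subseq; rewrite {1}/enum_mem -enumT; exact: filter_subseq.
by move/(subseq_sorted ltn_trans); apply; exact: iota_ltn_sorted.
Qed.

Lemma mem_vals A (i : 'I_n) : (i.+1 \in vals A) = (i \in A).
Proof.
apply/mapP/idP => [[k]|iA]; first by rewrite mem_enum => kA /= [/val_inj->].
by exists i; rewrite ?mem_enum.
Qed.

Lemma vals_ord A x : x \in vals A -> exists i : 'I_n, x = i.+1 /\ i \in A.
Proof. by move=> /mapP[i]; rewrite mem_enum => iA ->; exists i. Qed.

Lemma size_vals A : size (vals A) = #|A|.
Proof. by rewrite size_map -cardE. Qed.

Lemma uniq_vals A : uniq (vals A).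
Proof. exact: (sorted_uniq ltn_trans ltnn (sorted_vals A)). Qed.

Lemma perm_vals A : perm_eq (vals A ++ vals (~: A)) (iota 1 n).
Proof.
apply: uniq_perm; rewrite ?iota_uniq // ?cat_uniq ?uniq_vals ?andbT //=.
  apply/hasPn => x /vals_ord[i [-> iA]]; rewrite mem_vals.
  by move: iA; rewrite inE.
move=> x; rewrite mem_cat mem_iota add1n ltnS; apply/orP/andP => [[]|[x0 xn]].
- by move=> /vals_ord[i [-> _]].
- by move=> /vals_ord[i [-> _]].
have x1 : x.-1 < n by rewrite prednK.
have -> : x = (Ordinal x1).+1 by rewrite /= prednK.
by rewrite !mem_vals inE; case: (_ \in A); [left|right].
Qed.

Definition enc (A : {set 'I_n}) (p : seq nat) :=
  [seq nth 0 (vals A) x.-1 | x <- p] ++ vals (~: A).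

Lemma perm_enc_l (A : {set 'I_n}) p : is_perm p -> size p = #|A| ->
  perm_eq [seq nth 0 (vals A) x.-1 | x <- p] (vals A).
Proof.
move=> pp sp; have := perm_map (fun x => nth 0 (vals A) x.-1) pp.
move/perm_trans; apply; rewrite sp -size_vals.
rewrite -[1]addn0 iotaDl -map_comp (eq_map (g := nth 0 (vals A))) //.
by rewrite map_nth_iota0 // take_size.
Qed.

Lemma is_perm_enc (A : {set 'I_n}) p : is_perm p -> size p = #|A| -> is_perm (enc A p) /\ size (enc A p) = n.
Proof.
move=> pp sp; apply/mem_permutations_iota; rewrite mem_permutations.
by apply: perm_trans (perm_vals A); rewrite perm_cat2r; exact: perm_enc_l.
Qed.

Lemma stdz_enc (A : {set 'I_n}) p : is_perm p -> size p = #|A| ->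
  stdz [seq nth 0 (vals A) x.-1 | x <- p] = p.
Proof.
move=> pp sp; apply: perm_order_iso_eq => //.
  apply: is_perm_stdz; rewrite (perm_uniq (perm_enc_l pp sp)); exact: uniq_vals.
apply: (order_iso_trans (order_iso_stdz _)); split; first by rewrite size_map.
move=> i j; rewrite size_map => Hi Hj; rewrite !(nth_map 0) //.
have := mem_nth 0 Hi; have := mem_nth 0 Hj; rewrite !mem_is_perm // sp -size_vals.
case: (nth 0 p i) => [|x]; case: (nth 0 p j) => [|y] //= Hy Hx; rewrite ltnS.
have mono := sorted_ltn_nth ltn_trans 0 (sorted_vals A).
case: (ltngtP x y) => xy.
- by rewrite mono.
- by apply/negbTE; rewrite -leqNgt ltnW // mono.
- by rewrite xy ltnn.
Qed.

Lemma enc_inj (A : {set 'I_n}) p (B : {set 'I_n}) q : is_perm p -> is_perm q -> size p = #|A| -> size q = #|B| ->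
  size p = size q -> enc A p = enc B q -> A = B /\ p = q.
Proof.
move=> pp pq sp sq spq /eqP; rewrite eqseq_cat ?size_map // => /andP[/eqP E _].
split; last by rewrite -(stdz_enc pp sp) E stdz_enc.
apply/setP => i; rewrite -!mem_vals.
by rewrite -(perm_mem (perm_enc_l pp sp)) E (perm_mem (perm_enc_l pq sq)).
Qed.

Lemma juxt_enc (C : pred (seq nat)) (A : {set 'I_n}) p : is_perm p -> size p = #|A| -> C p -> juxt C (enc A p).
Proof.
move=> pp sp Cp; have [pe se] := is_perm_enc pp sp.
apply/asboolP; split=> //; exists #|A|.
have szl : size [seq nth 0 (vals A) x.-1 | x <- p] = #|A| by rewrite size_map.
rewrite -{1 2 3}szl take_size_cat // drop_size_cat // stdz_enc //; split=> //.
  by rewrite size_cat leq_addr.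
exact: sorted_vals.
Qed.

Lemma juxt_dec (C : pred (seq nat)) s : is_perm s -> size s = n -> juxt C s ->
  exists (A : {set 'I_n}) p, [/\ is_perm p, size p = #|A|, C p & s = enc A p].
Proof.
move=> ps sn /asboolP[_ [j [js Cj sj]]].
pose A := [set i : 'I_n | i.+1 \in take j s].
have us := is_perm_uniq ps.
have EA : vals A =i take j s.
  move=> x; apply/idP/idP => [/vals_ord[i [-> ]]|Hx]; first by rewrite inE.
  have := mem_take Hx; rewrite mem_is_perm // sn => /andP[x0 xn].
  have x1 : x.-1 < n by rewrite prednK.
  have E : x = (Ordinal x1).+1 by rewrite /= prednK.
  by rewrite E mem_vals inE -E.
have EB : vals (~: A) =i drop j s.
  have : uniq (take j s ++ drop j s) by rewrite cat_take_drop.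
  rewrite cat_uniq => /and3P[_ /hasPn dis _].
  move=> x; apply/idP/idP => [/vals_ord[i [-> ]]|Hx].
    rewrite !inE => Hn; have : i.+1 \in take j s ++ drop j s.
      by rewrite cat_take_drop mem_is_perm // sn /= ltn_ord.
    by rewrite mem_cat (negbTE Hn).
  have := mem_drop Hx; rewrite mem_is_perm // sn => /andP[x0 xn].
  have x1 : x.-1 < n by rewrite prednK.
  have E : x = (Ordinal x1).+1 by rewrite /= prednK.
  by rewrite E mem_vals !inE -E; exact: dis.
have pA : perm_eq (vals A) (take j s).
  by apply: uniq_perm; rewrite ?uniq_vals ?take_uniq.
have szA : #|A| = size (take j s) by rewrite -size_vals (perm_size pA).
exists A, (stdz (take j s)); split=> //.
- by apply: is_perm_stdz; exact: take_uniq.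
- by rewrite size_map.
rewrite -{1}(cat_take_drop j s) /enc; congr cat; last first.
  apply: (irr_sorted_eq ltn_trans ltnn) => //; exact: sorted_vals.
rewrite /stdz -map_comp -[LHS]map_id; apply/eq_in_map => x Hx /=.
have xA : x \in vals A by rewrite EA.
(* In a sorted list, the entries not exceeding [x] are those up to the index of [x]. *)
suff -> : rk (take j s) x = (index x (vals A)).+1 by rewrite /= nth_index.
rewrite /rk -(permP pA).
have srt := sorted_vals A.
have [a [b Eab]] : exists a b, vals A = a ++ x :: b.
  by case/splitPr: xA => a b; exists a, b.
have := uniq_vals A; rewrite Eab in srt *.
rewrite cat_uniq => /and3P[_ /norP[xa _] _].
rewrite index_cat (negbTE xa) /= eqxx addn0 count_cat /= leqnn.
have /andP[/allP Ha Hb] : all (gtn x) a && all (ltn x) b.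
  move: srt; rewrite -cat1s catA (sorted_pairwise ltn_trans) !pairwise_cat.
  rewrite allrel_catl => /and3P[/andP[_ H2] /and3P[H1 _ _] _]; apply/andP; split.
    by move: H1; rewrite allrel1r.
  by move: H2; rewrite allrel1l.
rewrite [X in _ + (_ + X)](_ : _ = 0) ?addn0 ?addn1.
  congr S; apply/eqP; rewrite -all_count; apply/allP => y /Ha; exact: ltnW.
apply/eqP; rewrite -leqn0 leqNgt -has_count; apply/hasPn => y /(allP Hb) /=.
by rewrite -ltnNge.
Qed.

Definition enclist (C : pred (seq nat)) j :=
  [seq enc A p | A <- enum [set A : {set 'I_n} | #|A| == j],
                 p <- seq.filter C (permutations (iota 1 j))].

Lemma mem_enclist C j s : s \in enclist C j ->
  exists (A : {set 'I_n}) p, [/\ s = enc A p, #|A| = j, is_perm p, size p = j & C p].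
Proof.
move=> /allpairsP[[A p] /= []]; rewrite mem_enum inE mem_filter => /eqP Aj.
by move=> /andP[Cp /mem_permutations_iota[pp sp]] ->; exists A, p.
Qed.

Lemma size_enclist C j : size (enclist C j) = 'C(n, j) * class_count C j.
Proof.
by rewrite size_allpairs -cardE card_draws card_ord size_filter.
Qed.

(** Only one [j] at a time: a permutation may admit several dividing points, so the images for
    different [j] overlap, and their sum is only an upper bound in [juxt_count_le]. *)
Lemma juxt_count_ge C j : 'C(n, j) * class_count C j <= class_count (juxt C) n.
Proof.
rewrite -size_enclist /class_count -size_filter; apply: uniq_leq_size.
  apply: allpairs_uniq; rewrite ?enum_uniq ?filter_uniq ?permutations_uniq //.
  move=> [A p] [B q] /allpairsP[[A' p'] /= [HA Hp [-> ->]]].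
  move=> /allpairsP[[B' q'] /= [HB Hq [-> ->]]] /=.
  move: HA HB Hp Hq; rewrite !mem_enum !inE !mem_filter => /eqP HA /eqP HB.
  move=> /andP[_ /mem_permutations_iota[pp sp]] /andP[_ /mem_permutations_iota[pq sq]].
  by move=> /enc_inj[] //; rewrite ?sp ?sq ?HA ?HB // => -> ->.
move=> s /mem_enclist[A [p [-> Aj pp sp Cp]]].
rewrite mem_filter juxt_enc ?sp ?Aj //=.
by apply/mem_permutations_iota; apply: is_perm_enc; rewrite ?sp ?Aj.
Qed.

Lemma juxt_count_le C : class_count (juxt C) n <= \sum_(j < n.+1) 'C(n, j) * class_count C j.
Proof.
pose L := flatten [seq enclist C j | j <- iota 0 n.+1].
have -> : \sum_(j < n.+1) 'C(n, j) * class_count C j = size L.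
  rewrite size_flatten /shape -map_comp sumnE big_map.
  rewrite -[iota 0 n.+1]/(index_iota 0 n.+1) big_mkord.
  by apply: eq_bigr => j _; rewrite /= size_enclist.
rewrite /class_count -size_filter; apply: uniq_leq_size.
  by rewrite filter_uniq // permutations_uniq.
move=> s; rewrite mem_filter => /andP[Js /mem_permutations_iota[ps sn]].
have [A [p [pp sp Cp ->]]] := juxt_dec ps sn Js.
apply/flatten_mapP; exists #|A|.
  by rewrite mem_iota add0n ltnS; have := max_card (mem A); rewrite card_ord.
apply/allpairsP; exists (A, p); split=> //=; first by rewrite mem_enum inE.
by rewrite mem_filter Cp; apply/mem_permutations_iota.
Qed.

End Count.

(** * Caterpillars *)

(** The positions satisfying [Q] form a prefix that ends at a split position, and indecomposability
    leaves only the two trivial prefixes. *)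
Lemma indec_threshold tau (Q : pred nat) : indecb tau ->
  (forall a b, a < size tau -> b < size tau -> Q a -> ~~ Q b ->
    a < b /\ nth 0 tau a < nth 0 tau b) ->
  (forall a, a < size tau -> Q a) \/ (forall a, a < size tau -> ~~ Q a).
Proof.
move=> it H.
pose P a := (size tau <= a) || ~~ Q a.
have exP : exists a, P a by exists (size tau); rewrite /P leqnn.
case: (ex_minnP exP) => k Pk kmin.
have low a : a < k -> a < size tau /\ Q a.
  move=> ak; have /negP : ~ P a by move=> /kmin; rewrite leqNgt ak.
  by rewrite /P negb_or -ltnNge negbK => /andP[].
have high a : k <= a -> a < size tau -> ~~ Q a.
  move=> ka sa; apply/negP => Qa; have kt := leq_ltn_trans ka sa.
  move: Pk; rewrite /P leqNgt kt /= => Qk.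
  by have [] := H a k sa kt Qa Qk; rewrite ltnNge ka.
have : splitb k tau.
  apply/splitbP => i j ik kj jt; have [it' Qi] := low i ik.
  by have [] := H i j it' jt Qi (high j kj jt).
case/(indec_split it) => [k0|kt]; [right|left] => a sa; first by apply: high; rewrite ?k0.
by have [] := low a (leq_trans sa kt).
Qed.

Lemma is_permI s : uniq s -> (forall x, x \in s -> 0 < x <= size s) -> is_perm s.
Proof.
move=> us H; apply: uniq_perm => //; first exact: iota_uniq.
apply: (uniq_min_size us _ _).2; last by rewrite size_iota.
by move=> x /H; rewrite mem_iota add1n ltnS.
Qed.

Definition run (b : bool) (t : seq bool) := find (fun c => c != b) t.

(* The permutation whose inversion graph is the forest in which each letter of [t] is
   joined to the last letter of the preceding maximal run; [true] letters are the left
   ends of inversions, [false] letters the right ends. *)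
Fixpoint catp (t : seq bool) : seq nat :=
  if t is x :: t' then
    if x then (run false t').+1 :: map (bump (run false t').+1) (catp t')
    else map S (take (run true t') (catp t')) ++ 1 :: map S (drop (run true t') (catp t'))
  else [::].

(* Position and value of the entry of [catp t] contributed by the letter of index [j]. *)
Fixpoint posw (t : seq bool) (j : nat) : nat :=
  if t is x :: t' then
    if j is j'.+1 then if x then (posw t' j').+1 else bump (run true t') (posw t' j')
    else if x then 0 else run true t'
  else 0.

Fixpoint valw (t : seq bool) (j : nat) : nat :=
  if t is x :: t' then
    if j is j'.+1 then if x then bump (run false t').+1 (valw t' j') else (valw t' j').+1
    else if x then (run false t').+1 else 1
  else 0.

(** The edges of the inversion graph: [i] is the last letter of its run and [j] lies in the next
    run. *)
Definition invw (t : seq bool) (i j : nat) :=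
  (i < j) && all (fun k => nth false t k != nth false t i) (iota i.+1 (j - i)).

Lemma invwP t i j : reflect (i < j /\ forall k, i < k -> k <= j -> nth false t k != nth false t i)
  (invw t i j).
Proof.
apply: (iffP andP) => [[ij /allP H]|[ij H]]; split=> //.
  by move=> k ik kj; apply: H; rewrite mem_iota ik addSn subnKC ?ltnS // ltnW.
by apply/allP => k; rewrite mem_iota addSn subnKC ?(ltnW ij) // ltnS => /andP[]; exact: H.
Qed.

Lemma run_size b t : run b t <= size t.
Proof. exact: find_size. Qed.

Lemma run_ltP b t j : j < size t -> (j < run b t) = all (pred1 b) (take j.+1 t).
Proof.
elim: t j => //= c t IH [|j] /=; rewrite /run /= ?take0 /=; first by case: eqP.
rewrite ltnS => /IH {}IH; case: eqP => //= _; by rewrite -IH.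
Qed.

Lemma size_catp t : size (catp t) = size t.
Proof.
elim: t => //= -[] t IH /=; first by rewrite size_map IH.
by rewrite size_cat /= !size_map addnS -size_cat cat_take_drop IH.
Qed.

Lemma is_perm_catp t : is_perm (catp t).
Proof.
elim: t => //= -[] t IH; have us := is_perm_uniq IH.
  apply: is_permI => /=.
    rewrite (map_inj_uniq (can_inj (bumpK _))) us andbT.
    by apply/negP => /mapP[x _ /eqP]; rewrite (negbTE (neq_bump _ _)).
  rewrite size_map size_catp => x; rewrite inE => /predU1P[->|/mapP[y]].
    by rewrite /= ltnS run_size.
  rewrite mem_is_perm // size_catp => /andP[y0 yt] ->; rewrite /bump.
  by rewrite addn_gt0 y0 orbT /=; case: (_ < _); rewrite ?add1n ?add0n ?ltnS // leqW.
apply: is_permI.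
  rewrite -cat1s uniq_catCA cat1s /= -map_cat cat_take_drop (map_inj_uniq succn_inj) us andbT.
  by apply/negP => /mapP[x]; rewrite mem_is_perm // => /andP[x0 _] [] E; rewrite -E in x0.
move=> x; rewrite (size_catp (false :: t)) mem_cat inE orbCA -mem_cat -map_cat cat_take_drop.
case/predU1P=> [->//|/mapP[y]]; rewrite mem_is_perm // size_catp => /andP[_ yt] -> /=.
by rewrite ltnS.
Qed.

Lemma catp_gt0 t v : v \in catp t -> 0 < v.
Proof. by rewrite mem_is_perm; [case/andP|exact: is_perm_catp]. Qed.

Lemma posw_lt t j : j < size t -> posw t j < size t.
Proof.
elim: t j => //= -[] t IH [|j] //=; rewrite ?ltnS => Hj; rewrite ?IH ?run_size //.
rewrite /bump; by have lt := IH _ Hj; case: (leqP (run true t) (posw t j)) => _ //=; rewrite add0n ltnW.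
Qed.

Lemma nth_posw t j : j < size t -> nth 0 (catp t) (posw t j) = valw t j.
Proof.
elim: t j => //= -[] t IH [|j] //=; rewrite ?ltnS => Hj.
- by rewrite (nth_map 0) ?size_catp ?posw_lt // IH.
- by rewrite nth_cat size_map size_takel ?size_catp ?run_size // ltnn subnn.
rewrite /bump; case: (leqP (run true t) (posw t j)) => [le|lt] /=;
  rewrite ?add1n ?add0n nth_cat size_map size_takel ?size_catp ?run_size //.
  rewrite ltnNge leqW //= subSn //= (nth_map 0) ?size_drop ?size_catp ?ltn_sub2r ?posw_lt //.
    by rewrite nth_drop subnKC // IH.
  exact: leq_ltn_trans le (posw_lt Hj).
by rewrite lt (nth_map 0) ?size_takel ?size_catp ?run_size // nth_take // IH.
Qed.

Lemma posw_inj t i j : i < size t -> j < size t -> posw t i = posw t j -> i = j.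
Proof.
elim: t i j => //= -[] t IH [|i] [|j] //=; rewrite ?ltnS => Hi Hj.
- by move=> [] /IH->.
- by move/eqP; rewrite (negbTE (neq_bump _ _)).
- by move/esym/eqP; rewrite (negbTE (neq_bump _ _)).
- by move/(can_inj (bumpK _))/IH => ->.
Qed.

Lemma posw_surj t p : p < size t -> exists2 j, j < size t & posw t j = p.
Proof.
move=> pt; have u : uniq (map (posw t) (iota 0 (size t))).
  rewrite map_inj_in_uniq ?iota_uniq // => i j; rewrite !mem_iota !add0n /= => it jt.
  exact: posw_inj.
have sub : {subset map (posw t) (iota 0 (size t)) <= iota 0 (size t)}.
  by move=> x /mapP[j]; rewrite !mem_iota !add0n /= => jt ->; exact: posw_lt.
have [|_ /(_ p)] := uniq_min_size u sub; first by rewrite size_map size_iota.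
rewrite mem_iota add0n pt => /mapP[j]; rewrite mem_iota add0n /= => jt ->.
by exists j.
Qed.

(** A new leading [false] letter is placed at position [run true t] with the least value, so it is
    inverted exactly with the leading [true] letters. The lemma [valw_run] plays this part for a new
    [true] letter. *)
Lemma posw_run t j : j < size t -> (posw t j < run true t) = (j < run true t).
Proof.
rewrite /run; elim: t j => //= -[] t IH [|j] //=; rewrite ?ltnS => Hj; exact: IH.
Qed.

Lemma valw_pos t j : j < size t -> 0 < valw t j.
Proof. by move=> jt; rewrite -nth_posw // (@catp_gt0 t) // mem_nth // size_catp posw_lt. Qed.

Lemma valw_run t j : j < size t -> (valw t j <= run false t) = (j < run false t).
Proof.
rewrite /run; elim: t j => //= -[] t IH [|j] //=; rewrite ?ltnS => Hj; last exact: IH.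
by apply/negbTE; rewrite -ltnNge addn_gt0 valw_pos // orbT.
Qed.

Lemma invw0S x t j : j < size t -> invw (x :: t) 0 j.+1 = (j < run (~~ x) t).
Proof.
move=> jt; rewrite run_ltP // /invw subn0 ltn0Sn andTb.
apply/allP/(all_nthP false) => [H i|H k].
  rewrite size_takel // => ij; have : i.+1 \in iota 1 j.+1 by rewrite mem_iota add1n ltnS.
  by move/H; rewrite nth_take //=; case: (nth _ _ _) x {H} => -[].
rewrite mem_iota; case: k => // k; rewrite add1n !ltnS /= => kj.
have := H k; rewrite size_takel // nth_take // => /(_ kj).
by case: (nth _ _ _) x {H} => -[].
Qed.

Lemma invwS x t i j : invw (x :: t) i.+1 j.+1 = invw t i j.
Proof.
by rewrite /invw ltnS subSS -[i.+2]add1n iotaDl all_map.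
Qed.

(** With [valw_ltE] this reduces every comparison in [catp t] to the word: the inversions are the
    edges [invw], each reversed in just one of the two coordinates. *)
Lemma posw_ltE t i j : i < j -> j < size t ->
  (posw t i < posw t j) = ~~ (~~ nth false t i && invw t i j).
Proof.
elim: t i j => // x t IH [|i] [|j] //=; rewrite ?ltnS => ij jt; last first.
  rewrite invwS -IH //; case: x => //; rewrite !ltnNge leq_bump2 //.
rewrite invw0S //; case: x => //=.
rewrite -posw_run // -leqNgt /bump; case: (leqP (run true t) (posw t j)) => H /=.
  by rewrite add1n ltnS H.
by rewrite add0n ltnNge (ltnW H).
Qed.

Lemma valw_ltE t i j : i < j -> j < size t ->
  (valw t i < valw t j) = ~~ (nth false t i && invw t i j).
Proof.
elim: t i j => // x t IH [|i] [|j] //=; rewrite ?ltnS => ij jt; last first.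
  by rewrite invwS -IH //; case: x => //; rewrite !ltnNge leq_bump2.
rewrite invw0S //; case: x => //=; last by rewrite ltnS valw_pos.
rewrite -valw_run // -ltnNge /bump; case: (ltnP (run false t) (valw t j)) => H /=.
  by rewrite add1n !ltnS H.
by rewrite add0n ltnNge leqW.
Qed.

(** * Embeddings into caterpillars and deletion of letters *)

Definition wemb (tau : seq nat) (t : seq bool) (g : nat -> nat) :=
  [/\ forall a, a < size tau -> g a < size t,
      forall a b, a < b -> b < size tau -> posw t (g a) < posw t (g b) &
      forall a b, a < size tau -> b < size tau ->
        (nth 0 tau a < nth 0 tau b) = (valw t (g a) < valw t (g b))].

Lemma subperm_catpP tau t : subperm tau (catp t) <-> exists g, wemb tau t g.
Proof.
rewrite subpermP; split=> [[f [f1 f2 f3]]|[g [g1 g2 g3]]].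
  have H a : exists j, a < size tau -> j < size t /\ posw t j = f a.
    case: (ltnP a (size tau)) => [Ha|_]; last by exists 0.
    have := f1 a Ha; rewrite size_catp => /posw_surj[j jt E]; by exists j.
  have [g Hg] := choice H.
  exists g; split=> [a /Hg[]//|a b ab bt|a b Ha Hb].
    by rewrite (Hg a (ltn_trans ab bt)).2 (Hg b bt).2 f2.
  have [[a1 a2] [b1 b2]] := (Hg a Ha, Hg b Hb).
  by rewrite f3 // -a2 -b2 !nth_posw.
exists (posw t \o g); split=> [a Ha|a b ab bt|a b Ha Hb] /=.
- by rewrite size_catp posw_lt // g1.
- exact: g2.
- by rewrite g3 // !nth_posw // g1.
Qed.

Lemma wemb_inj tau t g a b : wemb tau t g -> a < size tau -> b < size tau -> g a = g b -> a = b.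
Proof.
move=> [_ g2 _] Ha Hb E; case: (ltngtP a b) => // lt.
  by have := g2 a b lt Hb; rewrite E ltnn.
by have := g2 b a lt Ha; rewrite E ltnn.
Qed.

(** Comparisons depend only on letters, index order and edges, so an index map preserving these
    three turns embeddings into embeddings. Deletions, prefixes and suffixes are instances. *)
Lemma wemb_map tau t t' g h : wemb tau t g ->
  (forall a, a < size tau -> h (g a) < size t' /\ nth false t' (h (g a)) = nth false t (g a)) ->
  (forall a b, a < size tau -> b < size tau -> g a < g b ->
     h (g a) < h (g b) /\ invw t' (h (g a)) (h (g b)) = invw t (g a) (g b)) ->
  wemb tau t' (h \o g).
Proof.
move=> E H1 H2; have [g1 g2 g3] := E.
have pE a b : a < size tau -> b < size tau -> g a < g b ->
    (posw t' (h (g a)) < posw t' (h (g b))) = (posw t (g a) < posw t (g b)) /\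
    (valw t' (h (g a)) < valw t' (h (g b))) = (valw t (g a) < valw t (g b)).
  move=> Ha Hb ab; have [hab ei] := H2 a b Ha Hb ab.
  have [[a1 a2] [b1 b2]] := (H1 a Ha, H1 b Hb).
  by rewrite !posw_ltE ?(g1 b Hb) // !valw_ltE ?(g1 b Hb) // ei a2.
have neP t0 i j : i < size t0 -> j < size t0 -> i <> j -> posw t0 i <> posw t0 j.
  by move=> it jt ne /(posw_inj it jt).
have neV t0 i j : i < size t0 -> j < size t0 -> i <> j -> valw t0 i <> valw t0 j.
  move=> it jt ne; rewrite -!nth_posw // => e; apply: ne; apply: (posw_inj it jt).
  apply/eqP; rewrite -(nth_uniq 0 _ _ (is_perm_uniq (is_perm_catp t0))) ?size_catp ?posw_lt //.
  exact/eqP.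
have flip i j : i <> j -> (j < i) = ~~ (i < j) by case: ltngtP => // -> [].
have H3 a b : a < size tau -> b < size tau -> a <> b ->
    (posw t' (h (g a)) < posw t' (h (g b))) = (posw t (g a) < posw t (g b)) /\
    (valw t' (h (g a)) < valw t' (h (g b))) = (valw t (g a) < valw t (g b)).
  move=> Ha Hb ab; have [[a1 a2] [b1 b2]] := (H1 a Ha, H1 b Hb).
  case: (ltngtP (g a) (g b)) => [lt|lt|]; first exact: pE.
    have [e1 e2] := pE b a Hb Ha lt; have [hlt _] := H2 b a Hb Ha lt.
    have n1 : h (g b) <> h (g a) by move=> e; rewrite e ltnn in hlt.
    have n2 : g b <> g a by move=> e; rewrite e ltnn in lt.
    rewrite (flip (posw t' (h (g b)))) ?(flip (posw t (g b))) ?e1; last 2 first.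
    - by apply: neP n2; exact: g1.
    - exact: neP n1.
    rewrite (flip (valw t' (h (g b)))) ?(flip (valw t (g b))) ?e2 //.
    - by apply: neV n2; exact: g1.
    - exact: neV n1.
  by move/(wemb_inj E Ha Hb).
split=> [a /H1[]//|a b ab Hb|a b Ha Hb] /=.
  have Ha := ltn_trans ab Hb; rewrite (H3 a b Ha Hb _).1 ?g2 // => e.
  by rewrite e ltnn in ab.
have [-> |/eqP ne] := eqVneq a b; first by rewrite !ltnn.
by rewrite (H3 a b Ha Hb ne).2 g3.
Qed.

Lemma ltn_bump h i j : (bump h i < bump h j) = (i < j).
Proof. by rewrite !ltnNge leq_bump2. Qed.

Lemma nth_delete (t : seq bool) j i : j < size t ->
  nth false (take j t ++ drop j.+1 t) i = nth false t (bump j i).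
Proof.
move=> jt; rewrite nth_cat size_takel /bump; last exact: ltnW.
case: (ltnP i j) => ij; first by rewrite nth_take.
by rewrite nth_drop addSn subnKC.
Qed.

(* A letter followed by an equal letter is never the last of its run. *)
Lemma invw_delete (t : seq bool) j i k : j < size t -> bump j k < size t ->
  (j.+1 < size t -> nth false t j.+1 = nth false t j) ->
  invw (take j t ++ drop j.+1 t) i k = invw t (bump j i) (bump j k).
Proof.
move=> jt kt nj; apply/invwP/invwP => -[lt H]; rewrite ltn_bump in lt *; split=> // m im mk.
  rewrite -nth_delete //; have [e|mj] := eqVneq m j.
    have jk : j < bump j k by rewrite ltn_neqAle neq_bump /= -[X in X <= _]e.
    have E : bump j j = j.+1 by rewrite /bump leqnn.
    have -> : nth false t m = nth false (take j t ++ drop j.+1 t) j.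
      by rewrite nth_delete // E nj ?e // (leq_ltn_trans jk).
    apply: H.
      apply: leq_ltn_trans _ (_ : bump j i < j); first exact: leq_addl.
      by rewrite -[X in _ < X]e.
    by rewrite -(leq_bump2 j) E.
  have mE : bump j (unbump j m) = m by rewrite unbumpK // inE.
  rewrite -mE -nth_delete //; apply: H; first by rewrite -(ltn_bump j) mE.
  by rewrite -(leq_bump2 j) mE.
by rewrite !nth_delete //; apply: H; rewrite ?ltn_bump ?leq_bump2.
Qed.

Lemma wemb_delete tau t g j : wemb tau t g -> j < size t ->
  (forall a, a < size tau -> g a <> j) ->
  (j.+1 < size t -> nth false t j.+1 = nth false t j) ->
  wemb tau (take j t ++ drop j.+1 t) (unbump j \o g).
Proof.
move=> E jt gj nj; have [g1 _ _] := E.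
have bK a : a < size tau -> bump j (unbump j (g a)) = g a.
  by move=> Ha; rewrite unbumpK // inE; apply/eqP/gj.
apply: (wemb_map E) => [a Ha|a b Ha Hb ab].
  rewrite nth_delete // bK //; split=> //.
  rewrite size_cat size_takel ?(ltnW jt) // size_drop -(ltn_bump j) bK //.
  rewrite {1}/bump leq_addr add1n -addnS -subSn // subSS subnKC; last exact: ltnW.
  exact: g1.
split; first by rewrite -(ltn_bump j) !bK.
by rewrite invw_delete // !bK // g1.
Qed.

Lemma invw_take (t : seq bool) j i k : k < j -> invw (take j t) i k = invw t i k.
Proof.
move=> kj; apply/invwP/invwP => -[lt H]; split=> // m im mk; have := H m im mk;
  by rewrite !nth_take // ?(leq_ltn_trans mk) // (ltn_trans lt).
Qed.

Lemma invw_drop (t : seq bool) j i k : invw (drop j t) i k = invw t (j + i) (j + k).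
Proof.
apply/invwP/invwP => -[lt H]; split; rewrite ?ltn_add2l // in lt *.
  move=> m im mk; have := H (m - j); rewrite !nth_drop subnKC ?(ltnW (leq_ltn_trans (leq_addr _ _) im)) //.
  by apply; rewrite ?ltn_subRL // leq_subLR.
by move=> m im mk; rewrite !nth_drop; apply: H; rewrite ?ltn_add2l ?leq_add2l.
Qed.

Lemma wemb_take tau t g j : wemb tau t g -> (forall a, a < size tau -> g a < j) ->
  wemb tau (take j t) g.
Proof.
move=> E gj; apply: (@wemb_map _ _ _ g id E) => [a Ha|a b Ha Hb ab].
  rewrite nth_take ?gj //; split=> //; rewrite size_take; case: ifP => _; first exact: gj.
  by case: E => g1 _ _; exact: g1.
by rewrite invw_take ?gj.
Qed.

Lemma wemb_drop tau t g j : wemb tau t g -> (forall a, a < size tau -> j <= g a) ->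
  wemb tau (drop j t) (subn^~ j \o g).
Proof.
move=> E gj; apply: (wemb_map E) => [a Ha|a b Ha Hb ab].
  rewrite nth_drop subnKC ?gj //; split=> //; rewrite size_drop ltn_sub2r //.
    by apply: leq_ltn_trans (gj a Ha) _; case: E => g1 _ _; exact: g1.
  by case: E => g1 _ _; exact: g1.
by rewrite invw_drop !subnKC ?gj //; split=> //; rewrite ltn_sub2r // (leq_ltn_trans (gj a Ha)).
Qed.

Lemma wemb_of_take tau t g j : wemb tau (take j t) g -> wemb tau t g.
Proof.
move=> E; have [g1 _ _] := E.
have lt a : a < size tau -> g a < j /\ g a < size t.
  by move=> /g1; rewrite size_take; case: ifP => [jt gj|/negbT]; rewrite -?leqNgt;
    [split=> //; exact: ltn_trans jt|move=> tj gt; split=> //; exact: leq_trans tj].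
apply: (@wemb_map _ _ _ g id E) => [a Ha|a b Ha Hb ab].
  by have [? ?] := lt a Ha; rewrite nth_take.
by rewrite invw_take //; case: (lt b Hb).
Qed.

Lemma wemb_of_drop tau t g j : wemb tau (drop j t) g -> wemb tau t (addn j \o g).
Proof.
move=> E; have [g1 _ _] := E.
apply: (wemb_map E) => [a Ha|a b Ha Hb ab].
  by rewrite nth_drop; split=> //; have := g1 a Ha; rewrite size_drop ltn_subRL.
by rewrite invw_drop ltn_add2l.
Qed.

Lemma subperm_take tau t j : subperm tau (catp (take j t)) -> subperm tau (catp t).
Proof. by rewrite !subperm_catpP => -[g /wemb_of_take]; exists g. Qed.

Lemma subperm_drop tau t j : subperm tau (catp (drop j t)) -> subperm tau (catp t).
Proof. by rewrite !subperm_catpP => -[g /wemb_of_drop]; exists (addn j \o g). Qed.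

(** With no edge across the cut, all that lies before it is below and to the left of all that lies
    after it, so [indec_threshold] applies. *)
Lemma wemb_split tau t g j : indecb tau -> wemb tau t g ->
  (forall a b, a < size tau -> b < size tau -> g a < j -> j <= g b -> ~~ invw t (g a) (g b)) ->
  (forall a, a < size tau -> g a < j) \/ (forall a, a < size tau -> j <= g a).
Proof.
move=> it [g1 g2 g3] H.
have [|?|H'] := @indec_threshold tau (fun a => g a < j) it; [|by left|]; last first.
  by right=> a /H'; rewrite -leqNgt.
move=> a b Ha Hb aj; rewrite -leqNgt => jb.
have ab := leq_trans aj jb; have ninv := H a b Ha Hb aj jb.
have pab : posw t (g a) < posw t (g b) by rewrite posw_ltE ?g1 // (negbTE ninv) andbF.
have vab : valw t (g a) < valw t (g b) by rewrite valw_ltE ?g1 // (negbTE ninv) andbF.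
split; last by rewrite g3.
rewrite ltnNge leq_eqVlt; apply/negP => /predU1P[e|ba]; first by rewrite e ltnn in pab.
by have := g2 b a ba Ha; rewrite ltnNge (ltnW pab).
Qed.

(** Some letter [j] is missed by the embedding. If the next letter is equal, or there is none,
    deleting [j] keeps all other edges. Otherwise the left end of an edge passing over [j] would
    have to differ from both letters [j] and [j.+1], which are opposite; so nothing crosses, and the
    pattern lies on one side. *)
Lemma subperm_catp_cases tau t : is_perm tau -> indecb tau -> subperm tau (catp t) ->
  [\/ tau = catp t,
      exists j, [/\ j < size t, j.+1 < size t -> nth false t j.+1 = nth false t j &
                   subperm tau (catp (take j t ++ drop j.+1 t))],
      subperm tau (catp (take (size t).-1 t)) |
      subperm tau (catp (drop 1 t))].
Proof.
move=> pt it st.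
have [sz|ne] := eqVneq (size tau) (size t).
  by apply: Or41; apply: subperm_iso => //; [exact: is_perm_catp|rewrite size_catp].
have lt : size tau < size t.
  by rewrite ltn_neqAle ne -(size_catp t) subperm_size.
have [g E] := (subperm_catpP tau t).1 st; have [g1 g2 g3] := E.
have [j jt gj] : exists2 j, j < size t & forall a, a < size tau -> g a <> j.
  have /allPn[j] : ~~ all (fun j => j \in map g (iota 0 (size tau))) (iota 0 (size t)).
    apply/negP => /allP sub; have := uniq_leq_size (iota_uniq 0 (size t)) sub.
    by rewrite size_map !size_iota leqNgt lt.
  rewrite mem_iota add0n /= => jt /mapP nj; exists j => // a Ha e; apply: nj.
  by exists a => //; rewrite mem_iota.
have [/andP[j1 neq]|/nandP nj] := boolP ((j.+1 < size t) && (nth false t j.+1 != nth false t j)).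
  have [|lo|hi] := @wemb_split tau t g j it E.
  - move=> a b Ha Hb aj jb; apply/negP => /invwP[ab H].
    have jb' : j < g b by rewrite ltn_neqAle jb andbT; apply/eqP => /esym/(gj b Hb).
    have := H j aj jb; have := H j.+1 (ltnW aj : g a < j.+1) jb'.
    by move: neq; case: (nth _ _ j.+1); case: (nth _ _ j); case: (nth _ _ (g a)).
  - apply: Or43; apply: (@subperm_take _ _ j); rewrite take_takel; last first.
      by rewrite -ltnS prednK // (leq_ltn_trans _ jt).
    by apply/subperm_catpP; exists g; exact: wemb_take.
  apply: Or44; apply: (@subperm_drop _ _ j); rewrite drop_drop addn1.
  apply/subperm_catpP; exists (subn^~ j.+1 \o g); apply: wemb_drop => // a Ha.
  by rewrite ltn_neqAle hi // andbT; apply/eqP => /esym/(gj a Ha).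
apply: Or42; exists j; split=> //.
  by move=> j1; case: nj; rewrite ?j1 // negbK => /eqP.
apply/subperm_catpP; exists (unbump j \o g); apply: wemb_delete => // j1.
by case: nj; rewrite ?j1 // negbK => /eqP.
Qed.

Lemma is_perm1 tau : is_perm tau -> size tau = 1 -> tau = [:: 1].
Proof.
by move=> pt s1; move: pt; rewrite /is_perm s1 => /perm_small_eq; apply.
Qed.

(** The first of two equal leading letters has no edge: it is an isolated point, which only the
    pattern of length one can use. *)
Lemma subperm_catp_same tau y t : is_perm tau -> indecb tau ->
  subperm tau (catp [:: y, y & t]) -> tau = [:: 1] \/ subperm tau (catp (y :: t)).
Proof.
move=> pt it /subperm_catpP[g E]; have [g1 g2 _] := E.
have [|lo|hi] := @wemb_split tau _ g 1 it E.
- move=> a b Ha Hb; rewrite ltnS leqn0 => /eqP-> b1; apply/negP => /invwP[_ H].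
  by have := H 1 isT b1; rewrite /= eqxx.
- left; apply: is_perm1 => //; apply/eqP; rewrite eqn_leq indec_size // andbT leqNgt.
  apply/negP => lt; have := g2 0 1 isT lt.
  have := lo 0 (indec_size it); have := lo 1 lt; rewrite !ltnS !leqn0 => /eqP-> /eqP->.
  by rewrite ltnn.
right; apply/subperm_catpP; exists (subn^~ 1 \o g); exact: (wemb_drop E hi).
Qed.

Lemma catp_flip_true t : (t == [::]) || head true t ->
  catp [:: true, false & t] = catp [:: false, true & t].
Proof.
move=> Ht.
have r0 : run false t = 0 by case: t Ht => // -[].
have -> : catp [:: true, false & t] = (run false (false :: t)).+1 ::
    map (bump (run false (false :: t)).+1) (catp (false :: t)) by [].
have -> : run false (false :: t) = 1 by rewrite /run /= -/(run false t) r0.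
have -> : catp [:: false, true & t] = map S (take (run true t).+1 (catp (true :: t))) ++
  1 :: map S (drop (run true t).+1 (catp (true :: t))) by [].
have -> : catp (true :: t) = 1 :: map S (catp t).
  rewrite /= r0; congr (_ :: _); apply/eq_in_map => v /catp_gt0 v0.
  by rewrite /bump v0.
have E : map (bump 2) (map S (catp t)) = map S (map S (catp t)).
  by rewrite -!map_comp; apply/eq_in_map => v /catp_gt0 v0 /=; rewrite /bump ltnS v0.
by rewrite /= map_cat /= !map_take !map_drop E.
Qed.

Lemma catp_flip_false t : (t == [::]) || ~~ head false t ->
  catp [:: false, true & t] = catp [:: true, false & t].
Proof.
move=> Ht; have r0 : run true t = 0 by case: t Ht => // -[].
have -> : catp [:: true, false & t] = (run false (false :: t)).+1 ::
    map (bump (run false (false :: t)).+1) (catp (false :: t)) by [].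
have -> : run false (false :: t) = (run false t).+1 by [].
have -> : catp (false :: t) = 1 :: map S (catp t) by rewrite /= r0 take0 drop0.
have -> : catp [:: false, true & t] = map S (take (run true (true :: t)) (catp (true :: t))) ++
  1 :: map S (drop (run true (true :: t)) (catp (true :: t))) by [].
have -> : run true (true :: t) = 1 by rewrite /run /= -/(run true t) r0.
by rewrite /= take0 drop0 /= -!map_comp; congr [:: _, _ & _]; apply: eq_map => v /=; rewrite bumpS.
Qed.

(** In both words the displayed [x] is a leaf hanging from [~~ x], which is also joined to the
    leading run of [t]. This is why a permutation need not determine the first letter of its
    word. *)
Lemma catp_flip x t : (t == [::]) || (head x t == x) ->
  catp [:: x, ~~ x & t] = catp [:: ~~ x, x & t].
Proof.
by case: x => H; [apply: catp_flip_true|apply: catp_flip_false]; case: t H => // b t /eqP /= ->.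
Qed.

Lemma size_catp_inj t t' : catp t = catp t' -> size t = size t'.
Proof. by move=> E; rewrite -!size_catp E. Qed.

(** The value or the position of the first letter reveals the length of the run it is joined to, and
    removing it leaves [catp] of the rest. Whether that run is empty tells the next letter, so the
    induction continues with a known first letter. *)
Lemma catp_inj x t t' : catp (x :: t) = catp (x :: t') -> t = t'.
Proof.
elim: t x t' => [|y t IH] x t' E; have := size_catp_inj E; case: t' E => [|y' t'] // E _.
have [re ce] : run (~~ x) (y :: t) = run (~~ x) (y' :: t') /\ catp (y :: t) = catp (y' :: t').
  have consE s : catp (true :: s) = (run false s).+1 :: map (bump (run false s).+1) (catp s) by [].
  case: x E => E.
    move: E; rewrite !consE => -[re]; rewrite re => ce; split=> //.
    exact: (inj_map (can_inj (bumpK _)) ce).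
  have idx s : index 1 (catp (false :: s)) = run true s.
    rewrite /= index_cat size_map size_takel ?size_catp ?run_size //=.
    rewrite ifN ?addn0 //; apply/negP => /mapP[v /mem_take/catp_gt0].
    by case: v.
  have re : run true (y :: t) = run true (y' :: t') by rewrite -!idx E.
  split=> //.
  have del s : map predn (take (run true s) (catp (false :: s)) ++ drop (run true s).+1 (catp (false :: s))) = catp s.
    have sz : size (map S (take (run true s) (catp s))) = run true s.
      by rewrite size_map size_takel // size_catp run_size.
    have gen (a b : seq nat) : take (size a) (a ++ 1 :: b) ++ drop (size a).+1 (a ++ 1 :: b) = a ++ b.
      by rewrite take_size_cat // -cat_rcons drop_size_cat ?size_rcons.
    have := gen (map S (take (run true s) (catp s))) (map S (drop (run true s) (catp s))).
    by rewrite sz => ->; rewrite -map_cat -map_comp cat_take_drop map_id.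
  by rewrite -(del (y :: t)) E re del.
have yy : y = y'.
  by move: re; rewrite /run /=; case: x y y' {E ce} => [] [] [].
by rewrite -yy in ce *; rewrite (IH y t').
Qed.

(** The neighbour is the last letter before [j] that differs from letter [j]; one exists because the
    first two letters differ. *)
Lemma left_neighbour x t j : 0 < j -> j < size [:: x, ~~ x & t] ->
  exists2 i, i < j & invw [:: x, ~~ x & t] i j.
Proof.
set w := [:: x, ~~ x & t] => j0 jt.
pose P i := (i < j) && (nth false w i != nth false w j).
have exP : exists i, P i.
  have [e|ne] := eqVneq (nth false w 0) (nth false w j); last by exists 0; rewrite /P j0.
  have neg b : (~~ b != b) by case: b.
  exists 1; rewrite /P -e neg andbT ltn_neqAle j0 andbT; apply/eqP => e1.
  by have /eqP[] := neg x; rewrite [RHS]e -e1.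
have bP i : P i -> i <= j by case/andP => /ltnW.
case: (ex_maxnP exP bP) => i /andP[ij ne] imax; exists i => //.
apply/invwP; split=> // k ik kj; apply: contraNneq ne => e; rewrite -e.
move: kj; rewrite leq_eqVlt => /predU1P[->//|kj].
apply/negPn/negP => ne'; have : P k by rewrite /P kj.
by move/imax; rewrite leqNgt ik.
Qed.

(* A split would separate the indices into two sides with no inversion across,
   but every letter lies on the side of its left neighbour, hence of the first letter. *)
Lemma indec_catp x t : indecb (catp [:: x, ~~ x & t]).
Proof.
set w := [:: x, ~~ x & t].
have szw : size (catp w) = size w by exact: size_catp.
rewrite /indecb szw; apply/andP; split=> //; apply/allP => k.
rewrite mem_iota add1n ltnS => /andP[k0 kn].
apply/negP => /splitbP spl; rewrite szw in spl.
have same i j : i < j -> j < size w -> invw w i j -> (posw w i < k) = (posw w j < k).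
  move=> ij jt inv; have it := ltn_trans ij jt.
  have := posw_ltE ij jt; have := valw_ltE ij jt; rewrite inv !andbT => vE pE.
  have [pi pj] := (posw_lt it, posw_lt jt).
  case: (ltnP (posw w i) k) (ltnP (posw w j) k) => ik [jk|jk] //.
    have := spl _ _ ik jk pj; rewrite !nth_posw // vE => nx.
    by have := leq_trans ik jk; rewrite pE nx.
  have := spl _ _ jk ik pi; rewrite !nth_posw // => vji.
  have pji := leq_trans jk ik.
  move: vE pE; rewrite (ltnNge (valw _ _)) (ltnW vji) ltnNge (ltnW pji) /=.
  by case: (nth _ _ _).
have all0 j : j < size w -> (posw w j < k) = (posw w 0 < k).
  elim/ltn_ind: j => j IH jt; case: (posnP j) => [->//|j0].
  have [i ij inv] := left_neighbour j0 jt.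
  by rewrite -(same i j) // IH // (ltn_trans ij).
have kt : k < size w by rewrite -[size w]prednK // ltnS.
have [j jt pj] := posw_surj kt; have [j' jt' pj'] := posw_surj (ltn_trans k0 kt).
have := all0 j jt; rewrite pj ltnn => /esym; rewrite -(all0 j' jt') pj'.
by rewrite k0.
Qed.

(** * The family for the lower range *)

Definition del (T : Type) j (s : seq T) := take j s ++ drop j.+1 s.

Lemma del_catl (T : Type) j (s t : seq T) : j < size s -> del j (s ++ t) = del j s ++ t.
Proof.
move=> js; rewrite /del takel_cat 1?ltnW // drop_cat.
case: (ltnP j.+1 (size s)) => [_|sj]; first by rewrite catA.
have -> : j.+1 - size s = 0 by apply/eqP; rewrite subn_eq0.
by rewrite drop0 (drop_oversize sj) cats0.
Qed.

Lemma del_catr (T : Type) j (s t : seq T) : size s <= j -> del j (s ++ t) = s ++ del (j - size s) t.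
Proof.
move=> sj; rewrite /del take_cat ltnNge sj /= drop_cat ltnNge (leqW sj) /= subSn //.
by rewrite catA.
Qed.

Lemma del_nseq (T : Type) j n (x : T) : j < n -> del j (nseq n x) = nseq n.-1 x.
Proof.
move=> jn; rewrite /del take_nseq 1?ltnW // drop_nseq -nseqD.
by rewrite subnS -subn1 addnBA ?subn_gt0 // subnKC ?subn1 // ltnW.
Qed.

(* The word [d1, ..., dk] encodes the caterpillar whose spine alternates between [false]
   letters of degrees d1, ..., dk and [true] letters of degree 2. *)
Definition dtail (d : seq nat) := flatten [seq false :: nseq a.-1 true | a <- d].
Definition dword (d : seq nat) :=
  if d is a :: l then false :: nseq a true ++ dtail l else [:: false].
Definition dperm (d : seq nat) := catp (dword d).

(** An inner entry 1 would be a [false] letter with no [true] letter after it, and the caterpillar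
    would break there; at either end an entry 1 is a leaf. *)
Fixpoint dvalid_tail (d : seq nat) :=
  if d is a :: l then (if l is [::] then 0 < a else 1 < a) && dvalid_tail l else true.
Definition dvalid (d : seq nat) := if d is a :: l then (0 < a) && dvalid_tail l else false.

Inductive dmove (d d' : seq nat) : Prop :=
| DDec l1 a l2 of d = l1 ++ a :: l2 & d' = l1 ++ a.-1 :: l2 &
    (2 < a) || (1 < a) && ((l1 == [::]) || (l2 == [::]))
| DFirst a of d = a :: d' & d' != [::]
| DLast of d = rcons d' 1 & d' != [::].

Lemma size_dtail d : dvalid_tail d -> size (dtail d) = sumn d.
Proof.
elim: d => //= a l IH /andP[Ha /IH Hl]; rewrite /dtail /= size_cat size_nseq -/(dtail l) Hl.
by rewrite -addSn prednK //; case: l Ha {IH Hl} => // b l; exact: ltnW.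
Qed.

(** The entries of [d] are the degrees on one side of a bipartite tree, so their sum is the number
    of edges. *)
Lemma size_dperm d : dvalid d -> size (dperm d) = (sumn d).+1.
Proof.
case: d => //= a l /andP[a0 Hl]; rewrite /dperm size_catp /dword /= size_cat size_nseq.
by rewrite size_dtail.
Qed.

Lemma dword_cons2 d : dvalid d -> exists t, dword d = [:: false, true & t].
Proof. by case: d => // -[|a] l //= _; exists (nseq a true ++ dtail l). Qed.

Lemma indec_dperm d : dvalid d -> indecb (dperm d).
Proof. by move=> /dword_cons2[t]; rewrite /dperm => ->; exact: (indec_catp false). Qed.

Lemma is_perm_dperm d : is_perm (dperm d).
Proof. exact: is_perm_catp. Qed.

Lemma dtail_inj l l' : all (leq 1) l -> all (leq 1) l' -> dtail l = dtail l' -> l = l'.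
Proof.
elim: l l' => [|a l IH] [|a' l'] //= /andP[a0 Hl] /andP[a0' Hl'].
rewrite /dtail /= -!/(dtail _) => -[].
have H b m : find (pred1 false) (nseq b true ++ dtail m) = b.
  by elim: b => [|b /= ->] //; case: m.
move=> E; have e : a.-1 = a'.-1 by rewrite -(H a.-1 l) E H.
move: E; rewrite e => /eqP; rewrite eqseq_cat // eqxx /= => /eqP/IH-> //.
by rewrite -(prednK a0) e prednK.
Qed.

Lemma dvalid_tail_pos l : dvalid_tail l -> all (leq 1) l.
Proof. by elim: l => //= a l IH /andP[H /IH->]; case: l H {IH} => [|b l] /= H; rewrite ?(ltnW H) ?H. Qed.

Lemma dperm_inj d d' : dvalid d -> dvalid d' -> dperm d = dperm d' -> d = d'.
Proof.
case: d d' => [//|a l] [//|a' l'] /= /andP[a0 /dvalid_tail_pos Hl] /andP[a0' /dvalid_tail_pos Hl'].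
rewrite /dperm /dword => /catp_inj E.
have : dtail (a.+1 :: l) = dtail (a'.+1 :: l') by rewrite /dtail /= -!/(dtail _) E.
by move/dtail_inj; rewrite /= Hl Hl' => /(_ isT isT) [-> ->].
Qed.

(** A deletable letter is last or is followed by an equal one. Hence it is never the last [true]
    before another block, which rules out lowering an inner 2, and a deletable [false] can only be a
    final entry 1. *)
Lemma del_dtail l j : dvalid_tail l -> j < size (dtail l) ->
  (j.+1 < size (dtail l) -> nth false (dtail l) j.+1 = nth false (dtail l) j) ->
  (exists l1 a l2, [/\ l = l1 ++ a :: l2, del j (dtail l) = dtail (l1 ++ a.-1 :: l2) &
      (2 < a) || (1 < a) && (l2 == [::])]) \/
  (exists l', l = rcons l' 1 /\ del j (dtail l) = dtail l').
Proof.
elim: l j => [|b l IH] j // Hv; have {Hv} /andP[Hb Hl] := Hv.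
have b0 : 0 < b by case: l Hb {IH Hl} => // c l; exact: ltnW.
set s := false :: nseq b.-1 true.
have ss : size s = b by rewrite /= size_nseq prednK.
have E : dtail (b :: l) = s ++ dtail l by [].
rewrite E => js nj.
case: (ltnP j b) => jb; last first.
  have js' : j - b < size (dtail l) by rewrite ltn_subLR //; move: js; rewrite size_cat ss.
  have [|[l1 [a [l2 [-> e H]]]]|[l' [-> e]]] := IH (j - b) Hl js'.
  - rewrite -subSn // => js1; have := nj; rewrite size_cat ss -ltn_subLR ?(leqW jb) // => /(_ js1).
    by rewrite !nth_cat ss ltnNge (leqW jb) /= ltnNge jb.
  - left; exists (b :: l1), a, l2; split=> //.
    by rewrite del_catr ss // e.
  - right; exists (b :: l'); split=> //.
    by rewrite del_catr ss // e.
rewrite del_catl ?ss //.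
have [j0|j0] := posnP j.
  have [b1|b1] := eqVneq b 1.
    right; case: l Hb {IH Hl E js nj} => [_|c l]; last by rewrite b1.
    by exists [::]; rewrite b1; split=> //; rewrite j0 /s b1.
  have {}b1 : 1 < b by rewrite ltn_neqAle eq_sym b1.
  have : nth false (s ++ dtail l) 1 = nth false (s ++ dtail l) 0.
    by have := nj; rewrite j0 size_cat ss ltn_addr // => ->.
  by rewrite !nth_cat ss b0 b1 /s /= nth_nseq -subn1 subn_gt0 b1.
have b1 : 1 < b by exact: leq_ltn_trans jb.
left; exists [::], b, l; split=> //.
  rewrite [dtail ([::] ++ _)]/dtail /= -/(dtail l) -cat_cons; congr cat.
  rewrite /s -cat1s del_catr //= del_nseq //.
  by rewrite subn1 -ltnS !prednK.
rewrite b1 /=; case: (ltnP 2 b) => //= b2.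
have {}b2 : b = 2 by apply/eqP; rewrite eqn_leq b2.
case: l Hb Hl {IH} E js nj => // c l Hb Hl E js.
have {}j0 : j = 1 by apply/eqP; rewrite eqn_leq j0 andbT -ltnS -b2.
rewrite size_cat /s j0 b2 /= => /(_ isT).
by [].
Qed.

Lemma subperm_single tau b : is_perm tau -> indecb tau -> subperm tau (catp [:: b]) -> tau = [:: 1].
Proof.
move=> pt it /subperm_size; rewrite size_catp => s1; apply: is_perm1 => //.
by apply/eqP; rewrite eqn_leq s1 indec_size.
Qed.

(** The delicate case is the loss of the leading [false]: all but the last of the leading [true]
    letters become isolated, and the remaining one is turned into a leaf of the next block by
    [catp_flip], which gives [dperm] of the tail. *)
Lemma subperm_dperm tau d : is_perm tau -> indecb tau -> dvalid d -> subperm tau (dperm d) ->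
  [\/ tau = dperm d, tau = [:: 1] | exists2 d', dmove d d' & subperm tau (dperm d')].
Proof.
case: d => [//|a l] pt it /= /andP[a0 Hl] /(subperm_catp_cases pt it).
have core j : j < size (dword (a :: l)) -> (j.+1 < size (dword (a :: l)) ->
    nth false (dword (a :: l)) j.+1 = nth false (dword (a :: l)) j) ->
    subperm tau (catp (del j (dword (a :: l)))) ->
    tau = [:: 1] \/ exists2 d', dmove (a :: l) d' & subperm tau (dperm d').
  have E : dword (a :: l) = (false :: nseq a true) ++ dtail l by [].
  rewrite E; set s := false :: nseq a true; have ss : size s = a.+1 by rewrite /= size_nseq.
  move=> js nj; case: (ltnP j a.+1) => ja; last first.
    have js' : j - a.+1 < size (dtail l) by rewrite ltn_subLR //; move: js; rewrite size_cat ss.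
    rewrite del_catr ss //.
    have [|[l1 [b [l2 [-> -> H]]]]|[l' [-> ->]]] := del_dtail Hl js'.
    - rewrite -subSn // => js1; have := nj; rewrite size_cat ss -ltn_subLR ?(leqW ja) // => /(_ js1).
      by rewrite !nth_cat ss ltnNge (leqW ja) [in if _ then _ else _]ltnNge ja /=.
    - move=> st; right; exists (a :: l1 ++ b.-1 :: l2) => //.
      apply: (@DDec _ _ (a :: l1) b l2) => //.
    move=> st; right; exists (a :: l') => //; exact: DLast.
  rewrite del_catl ?ss //.
  have [j0|j0] := posnP j.
    by have := nj; rewrite j0; case: a a0 {E ss nj js ja} @s => // a _ /= /(_ isT).
  have -> : del j s = false :: nseq a.-1 true.
    by rewrite /s -cat1s del_catr //= del_nseq // -ltnS subn1 prednK.
  move=> st; case: (ltnP 1 a) => a1.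
    right; exists (a.-1 :: l) => //; apply: (@DDec _ _ [::] a l) => //.
    by rewrite a1 orbT.
  have {}a1 : a = 1 by apply/eqP; rewrite eqn_leq a1.
  case: l Hl E js nj st => [|b l] Hl E js nj st.
    by left; rewrite a1 in st; exact: subperm_single st.
  have j1 : j = 1 by apply/eqP; rewrite eqn_leq j0 andbT -ltnS -a1.
  by have := nj; rewrite /s j1 a1 /= => /(_ isT).
case=> [->|[j [js nj st]]|st|].
- exact: Or31.
- by have [->|?] := core j js nj st; [apply: Or32|apply: Or33].
- set t := dword (a :: l) in core st *.
  have t0 : 0 < size t by [].
  have [|||->|?] := core (size t).-1.
  - by rewrite prednK.
  - by rewrite prednK // ltnn.
  - by rewrite /del prednK // drop_size cats0.
  - exact: Or32.
  - exact: Or33.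
rewrite [drop 1 _]/= drop0.
have core2 : subperm tau (catp (true :: dtail l)) ->
    tau = [:: 1] \/ exists2 d', dmove (a :: l) d' & subperm tau (dperm d').
  case: l Hl {core} => [_ /(subperm_single pt it)|b l Hl]; first by left.
  have -> : catp (true :: dtail (b :: l)) = dperm (b :: l).
    have -> : dtail (b :: l) = false :: (nseq b.-1 true ++ dtail l) by [].
    rewrite catp_flip_true; last first.
      by case: b Hl => [|[|b]] //=; case: l.
    suff H : dword (b :: l) = [:: false, true & nseq b.-1 true ++ dtail l] by rewrite /dperm H.
    by case: b Hl => [|b] //=; case: l.
  by move=> st; right; exists (b :: l) => //; exact: (@DFirst _ _ a).
have H : forall k, subperm tau (catp (nseq k.+1 true ++ dtail l)) ->
    tau = [:: 1] \/ subperm tau (catp (true :: dtail l)).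
  elim=> [|k IH]; first by right.
  by move=> st; have [->|/IH] := subperm_catp_same pt it st; [left|].
rewrite -[a in nseq a]prednK // => /H[->|/core2[->|?]]; [exact: Or32|exact: Or32|exact: Or33].
Qed.

Lemma subperm_dperm_closed (S : seq nat -> Prop) tau d :
  (forall d, S d -> dvalid d) -> (forall d d', S d -> dmove d d' -> S d') ->
  is_perm tau -> indecb tau -> S d -> subperm tau (dperm d) ->
  tau = [:: 1] \/ exists2 d', S d' & tau = dperm d'.
Proof.
move=> Sv Sm pt it; move: {2}(sumn d) (leqnn (sumn d)) => n.
elim: n d => [|n IH] d dn Sd st.
  by have := Sv d Sd; case: d dn {Sd st} => [//|[|a] l].
have [->|->|[d' m st']] := subperm_dperm pt it (Sv d Sd) st; [by right; exists d|by left|].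
apply: (IH d') => //; last exact: Sm Sd m.
rewrite -ltnS; apply: leq_trans dn; case: m (Sv d Sd) => [l1 a l2 -> -> H|a -> _|-> _].
- move=> _; rewrite !sumn_cat ltn_add2l /= ltn_add2r prednK //.
  by case/orP: H => [/ltnW/ltnW//|/andP[/ltnW]].
- by move=> /= /andP[a0 _]; rewrite -[X in X < _]add0n ltn_add2r.
by rewrite sumn_rcons addn1.
Qed.

Definition plain : seq (seq nat) := [:: [::]; [:: 1]].
(** Two plain ends give a path. An end [3] or [4] carries two or three leaves, and [1; 3] is a path
    end with an extra leaf attached two steps away from it. *)
Definition lspec : seq (seq nat) := [:: [:: 3]; [:: 4]; [:: 1; 3]].
Definition rspec : seq (seq nat) := [:: [:: 3]; [:: 4]; [:: 3; 1]].

(* [lspec] and [rspec] are the decorated ends; apart from [3] with [3], both ends may be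
   decorated only when the length [k] of the middle part satisfies [b].  The words of
   [fam (leq N)] outside [fam pred0] are long while all their short parts lie in [fam pred0]. *)
Definition fam (b : pred nat) (d : seq nat) := exists X k Y,
  [/\ d = X ++ nseq k 2 ++ Y, d != [::], X \in plain ++ lspec, Y \in plain ++ rspec &
      [|| X \in plain, Y \in plain, [&& X == [:: 3], Y == [:: 3] & 0 < k] | b k]].

Lemma cat_eq_cat (T : Type) (l1 l2 s t : seq T) a : s ++ t = l1 ++ a :: l2 ->
  (exists l, s = l1 ++ a :: l /\ l2 = l ++ t) \/ (exists l, l1 = s ++ l /\ t = l ++ a :: l2).
Proof.
elim: s l1 => [|x s IH] [|y l1] /=; [by right; exists [::]|by right; exists (y :: l1)| |].
  by move=> [-> <-]; left; exists s.
by move=> [-> /IH[[l [-> ->]]|[l [-> ->]]]]; [left|right]; exists l.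
Qed.

Lemma nseq_eq_cat (T : eqType) (x : T) k l1 a l : nseq k x = l1 ++ a :: l ->
  [/\ a = x, l1 = nseq (size l1) x, l = nseq (size l) x & k = (size l1 + size l).+1].
Proof.
move=> E; have : all (pred1 x) (l1 ++ a :: l) by rewrite -E all_nseq /= eqxx orbT.
rewrite all_cat /= => /and3P[/all_pred1P-> /eqP-> /all_pred1P->].
have := congr1 size E; rewrite size_nseq size_cat /= addnS => ->.
by rewrite !size_nseq.
Qed.

Lemma leftP X : X \in plain ++ lspec ->
  X = [::] \/ X = [:: 1] \/ X = [:: 3] \/ X = [:: 4] \/ X = [:: 1; 3].
Proof.
rewrite !inE => /predU1P[->|/predU1P[->|/predU1P[->|/predU1P[->|/eqP->]]]]; tauto.
Qed.

Lemma rightP Y : Y \in plain ++ rspec ->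
  Y = [::] \/ Y = [:: 1] \/ Y = [:: 3] \/ Y = [:: 4] \/ Y = [:: 3; 1].
Proof.
rewrite !inE => /predU1P[->|/predU1P[->|/predU1P[->|/predU1P[->|/eqP->]]]]; tauto.
Qed.

Lemma fam_plainl b X k Y : X \in plain -> Y \in plain ++ rspec ->
  X ++ nseq k 2 ++ Y != [::] -> fam b (X ++ nseq k 2 ++ Y).
Proof.
move=> HX HY ne; exists X, k, Y; split=> //; last by rewrite HX.
by rewrite mem_cat HX.
Qed.

Lemma fam_plainr b X k Y : X \in plain ++ lspec -> Y \in plain ->
  X ++ nseq k 2 ++ Y != [::] -> fam b (X ++ nseq k 2 ++ Y).
Proof.
move=> HX HY ne; exists X, k, Y; split=> //; last by rewrite HY orbT.
by rewrite mem_cat HY.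
Qed.

(** Lowering a decorated end either produces a 2, which joins the middle part and leaves a plain
    end, or turns 4 into 3 and changes neither [k] nor the condition [b k]. *)
Lemma fam_move_dec_left b X k Y l1 a l : X = l1 ++ a :: l ->
  X \in plain ++ lspec -> Y \in plain ++ rspec ->
  [|| X \in plain, Y \in plain, [&& X == [:: 3], Y == [:: 3] & 0 < k] | b k] ->
  1 < a -> fam b (l1 ++ a.-1 :: l ++ nseq k 2 ++ Y).
Proof.
move=> EX HX HY ok a1; have [|[|[|[|]]]] := leftP HX => E; rewrite E in EX ok.
- by case: l1 EX.
- by case: l1 EX => [[e _]|x [|]] //; rewrite -e in a1.
- case: l1 EX => [[<- <-]|x [|]] //=.
  exact: (@fam_plainl b [::] k.+1 Y).
- case: l1 EX => [[<- <-]|x [|]] //=; rewrite /= in ok.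
  by exists [:: 3], k, Y; split=> //; case/orP: ok => ->; rewrite ?orbT.
case: l1 EX => [[e _]|x [|y [|]]] //; first by rewrite -e in a1.
move=> [<- <- <-] /=; exact: (@fam_plainl b [:: 1] k.+1 Y).
Qed.

Lemma fam_move_dec_right b X k Y l a l2 : Y = l ++ a :: l2 ->
  X \in plain ++ lspec -> Y \in plain ++ rspec ->
  [|| X \in plain, Y \in plain, [&& X == [:: 3], Y == [:: 3] & 0 < k] | b k] ->
  1 < a -> fam b (X ++ nseq k 2 ++ l ++ a.-1 :: l2).
Proof.
move=> EY HX HY ok a1.
have nS c : nseq k 2 ++ 2 :: c = nseq k.+1 2 ++ c.
  by rewrite -cat_rcons -[k.+1]addn1 nseqD cats1.
have ne c m : X ++ nseq m.+1 2 ++ c != [::] by case: X {HX ok}.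
have [|[|[|[|]]]] := rightP HY => E; rewrite E in EY ok.
- by case: l EY.
- by case: l EY => [[e _]|x [|]] //; rewrite -e in a1.
- case: l EY => [[<- <-]|x [|]] //=; rewrite nS; exact: fam_plainr.
- case: l EY => [[<- <-]|x [|]] //=.
  exists X, k, [:: 3]; split=> //; first by case: X {HX ok ne} => //; case: k {nS}.
  by move: ok; rewrite andbF /=; case/orP=> [->//|->]; rewrite !orbT.
case: l EY => [[<- <-]|x [|y [|]]] //=; last by move=> [_ e _]; rewrite -e in a1.
rewrite nS; exact: fam_plainr.
Qed.

Lemma fam_move b d d' : fam b d -> dmove d d' -> fam b d'.
Proof.
move=> [X [k [Y [-> _ HX HY ok]]]] [l1 a l2 E -> H|a E d0|E d0].
- have a1 : 1 < a by case/orP: H => [/ltnW//|/andP[]].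
  case: (cat_eq_cat E) => [[l [EX El2]]|[l' [El1 EY]]].
    rewrite El2; exact: fam_move_dec_left EX HX HY ok a1.
  case: (cat_eq_cat EY) => [[l [Ek El2]]|[l [El' EY']]]; last first.
    rewrite El1 El' -!catA; exact: fam_move_dec_right EY' HX HY ok a1.
  have [ea el' el ek] := nseq_eq_cat Ek.
  rewrite El1 El2 ea /=; rewrite ea El1 El2 /= in H; case/orP: H => /eqP H.
    have [-> ->] : X = [::] /\ l' = [::] by case: (X) H => // ; case: (l').
    by rewrite el; exact: (@fam_plainl b [:: 1]).
  have [l0 Y0] : l = [::] /\ Y = [::] by case: (l) H => // ; case: (Y).
  rewrite l0 Y0 el' -catA; apply: (@fam_plainr b X (size l') [:: 1]) => //.
  by case: (X) => //; case: (size l').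
- have [|[|[|[|]]]] := leftP HX => EX; rewrite EX in E ok; last first.
  + case: E => _ <-; exists [:: 3], k, Y; split=> //.
    by move: ok; case: (Y \in plain); rewrite ?orbT //= => ->; rewrite ?orbT.
  + by case: E d0 => _ <-; exact: (@fam_plainl b [::]).
  + by case: E d0 => _ <-; exact: (@fam_plainl b [::]).
  + by case: E d0 => _ <-; exact: (@fam_plainl b [::]).
  case: k ok E => [|k] ok /= E; last by case: E d0 => _ <-; exact: (@fam_plainl b [::]).
  have [|[|[|[|]]]] := rightP HY => EY; move: E d0; rewrite EY => -[] // _ <- // _.
  by exists [::], 0, [:: 1].
have [|[|[|[|]]]] := rightP HY => EY; rewrite EY in E ok.
- case: k ok E => [|k] ok; rewrite cats0.
    have [|[|[|[|]]]] := leftP HX => ->; move: d0; case: d' => [|x [|y [|z s]]] //.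
  rewrite -[k.+1]addn1 nseqD catA cats1 => /rcons_inj[_] //.
- move: E; rewrite catA cats1 => /rcons_inj[E]; rewrite -E in d0 *.
  by rewrite -[nseq k 2]cats0 in d0 *; exact: fam_plainr.
- by move: E; rewrite catA cats1 => /rcons_inj[].
- by move: E; rewrite catA cats1 => /rcons_inj[].
move: E; rewrite -[[:: 3; 1]]/([:: 3] ++ [:: 1]) !catA cats1 => /rcons_inj[E].
rewrite -E -catA in d0 *; exists X, k, [:: 3]; split=> //.
by move: ok; rewrite andbF /=; case/orP=> [->//|->]; rewrite !orbT.
Qed.

Lemma fam_valid b d : fam b d -> dvalid d.
Proof.
have tailP k Y : Y \in plain ++ rspec -> dvalid_tail (nseq k 2 ++ Y).
  move=> /rightP HY; elim: k => [|k IH].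
    by case: HY => [->|[->|[->|[->|->]]]].
  by rewrite /= IH andbT; case: (nseq k 2 ++ Y).
move=> [X [k [Y [-> ne HX HY _]]]]; have tv := tailP k Y HY.
have [|[|[|[|]]]] := leftP HX => EX; rewrite EX in ne * => //=; last first.
  by case: (nseq k 2 ++ Y) tv.
case: k tv ne => [|k] /=; last by case/andP=> _ ->.
by have [|[|[|[|]]]] := rightP HY => ->.
Qed.

Lemma dvalid_move d d' : dvalid d -> dmove d d' -> dvalid d'.
Proof.
have decr l1 a l2 : dvalid_tail (l1 ++ a :: l2) -> (2 < a) || (1 < a) && (l2 == [::]) ->
    dvalid_tail (l1 ++ a.-1 :: l2).
  elim: l1 => [|b l1 IH] /=.
    by case: a l2 => [|[|[|a]]] [|c l2] //=.
  by move=> /andP[Hb Hl] /(IH Hl)->; rewrite andbT; case: l1 Hb {IH Hl}.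
have last1 l : dvalid_tail (rcons l 1) -> dvalid_tail l.
  elim: l => //= b l IH /andP[Hb /IH->]; rewrite andbT.
  by case: l Hb {IH} => //=; exact: ltnW.
move=> Hd [l1 a l2 E -> H|a E d0|E d0].
- rewrite E in Hd; case: l1 Hd H {E} => [|b l1] /=.
    by move=> /andP[_ ->]; case: a => [|[|a]]//.
  by move=> /andP[-> Hl] /(decr _ _ _ Hl).
- move: Hd; rewrite E /= => /andP[_]; case: d' d0 {E} => //= b l _ /andP[Hb ->].
  by rewrite andbT; case: l Hb => //= *; exact: ltnW.
move: Hd; rewrite E; case: d' d0 {E} => //= b l _ /andP[-> /last1].
by [].
Qed.

Definition dset (S : seq nat -> Prop) : pred (seq nat) :=
  fun p => `[< p = [:: 1] \/ exists2 d, S d & p = dperm d >].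

Lemma downset_dset (S : seq nat -> Prop) : (forall d, S d -> dvalid d) ->
  (forall d d', S d -> dmove d d' -> S d') -> downset (dset S).
Proof.
move=> Sv Sm; split=> [p /asboolP[->//|[d Sd ->]]|p t /asboolP[->|[d Sd ->]] pt it].
- by split; [exact: is_perm_dperm|exact/indec_dperm/Sv].
- move=> st; apply/asboolP; left; apply: is_perm1 => //.
  by apply/eqP; rewrite eqn_leq indec_size // andbT; exact: subperm_size st.
by move=> st; apply/asboolP; exact: subperm_dperm_closed st.
Qed.

Definition fam0 := fam pred0.
Definition lowD := dset fam0.
Definition lowH := dset dvalid.

Lemma downset_lowD : downset lowD.
Proof. by apply: downset_dset => [d|d d']; [exact: fam_valid|exact: fam_move]. Qed.

Lemma downset_lowH : downset lowH.
Proof. by apply: downset_dset => // d d'; exact: dvalid_move. Qed.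

Lemma dset_dperm (S : seq nat -> Prop) d : (forall d, S d -> dvalid d) -> dvalid d ->
  dset S (dperm d) <-> S d.
Proof.
move=> Sv vd; split=> [/asboolP[e|[d' Sd' e]]|Sd]; last by apply/asboolP; right; exists d.
  have := size_dperm vd; rewrite e => -[]; case: d vd {e} => [//|[|a] l] //.
by rewrite (dperm_inj vd (Sv _ Sd') e).
Qed.

Definition pairs : seq (seq nat * seq nat) :=
  [seq p <- [seq (X, Y) | X <- plain ++ lspec, Y <- plain ++ rspec] |
     [|| p.1 \in plain, p.2 \in plain | p == ([:: 3], [:: 3])]].

Definition word (p : seq nat * seq nat) k := p.1 ++ nseq k 2 ++ p.2.

Definition fits w (p : seq nat * seq nat) :=
  [&& sumn p.1 + sumn p.2 <= w, ~~ odd (w - (sumn p.1 + sumn p.2)) &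
      (p != ([:: 3], [:: 3])) || (6 < w)].

Definition famlist w := [seq word p (w - (sumn p.1 + sumn p.2))./2 | p <- pairs & fits w p].

Lemma sumn_word p k : sumn (word p k) = sumn p.1 + sumn p.2 + k.*2.
Proof. by rewrite /word !sumn_cat sumn_nseq mul2n addnA addnAC.
Qed.

Lemma fam0_famlist d : fam0 d -> d \in famlist (sumn d).
Proof.
move=> [X [k [Y [-> ne HX HY ok]]]].
have E : sumn (X ++ nseq k 2 ++ Y) = sumn X + sumn Y + k.*2 by rewrite -(sumn_word (X, Y)).
apply/mapP; exists (X, Y); last by rewrite E addKn doubleK.
rewrite mem_filter /fits E leq_addr addKn odd_double /= mem_filter; apply/andP; split.
  case: eqP => //= -[eX eY]; move: ok; rewrite eX eY /= orbF => k0.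
  by rewrite -[X in X < _](addn0 6) ltn_add2l double_gt0.
apply/andP; split; last by apply/allpairsP; exists (X, Y).
rewrite /= xpair_eqE; move: ok; case: (X \in plain); case: (Y \in plain) => //=.
by rewrite orbF andbA => /andP[].
Qed.

Lemma famlist_fam0 w d : 0 < w -> d \in famlist w -> fam0 d.
Proof.
move=> w0 /mapP[p]; rewrite mem_filter => /andP[/and3P[le ev H]].
rewrite mem_filter => /andP[pl /allpairsP[[X Y] /= [HX HY e]]] E; rewrite e /= in le ev H pl E.
have sw : sumn d = w.
  rewrite E sumn_word /= -[RHS](subnKC le); congr addn.
  by rewrite -[RHS]odd_double_half (negbTE ev).
exists X, (w - (sumn X + sumn Y))./2, Y; split=> //.
  by apply/eqP => d0; rewrite d0 /= in sw; rewrite -sw in w0.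
move: pl; case: (X \in plain); case: (Y \in plain) => //= /eqP[eX eY].
move: H; rewrite eX eY !eqxx /= orbF => H.
rewrite half_gt0; move: ev H; rewrite eX eY /= -subn_gt0.
by case: (w - 6) => [|[|m]].
Qed.

(** Seventeen pairs of ends are allowed, nine of even and eight of odd weight, each giving at most
    one word per length. At small lengths some pairs do not fit and some words coincide. *)
Definition dcount n := nth 9 [:: 0; 1; 1; 2; 3; 5; 7; 8; 8] n.

Lemma size_famlist w : size (famlist w) <= 9.
Proof.
rewrite size_map size_filter.
apply: (@leq_trans (count (fun p => odd (sumn p.1 + sumn p.2) == odd w) pairs)).
  apply: sub_count => p /and3P[le ev _]; move: ev; rewrite oddB //.
  by case: (odd w); case: (odd _).
by case: (odd w).
Qed.

Lemma lowD_count n : class_count lowD n <= dcount n.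
Proof.
rewrite /class_count -size_filter.
case: n => [|[|n]].
- by rewrite size_filter -/(class_count _ _) class_count0 //; exact: downset_lowD.
- by rewrite size_filter; apply: leq_trans (count_size _ _) _.
have H : {subset [seq p <- permutations (iota 1 n.+2) | lowD p] <= map dperm (undup (famlist n.+1))}.
  move=> p; rewrite mem_filter => /andP[/asboolP[->|[d fd ->]] /mem_permutations_iota[_ sp]] //.
  have /eqP := sp; rewrite size_dperm; last exact: fam_valid fd.
  rewrite eqSS => /eqP sd; apply: map_f; rewrite mem_undup -sd; exact: fam0_famlist.
apply: (leq_trans (uniq_leq_size _ H)); first by rewrite filter_uniq // permutations_uniq.
rewrite size_map => {H}.
do 7 (case: n => [|n]; first by vm_compute).
have -> : dcount n.+4.+4.+1 = 9 by rewrite /dcount /= nth_nil.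
exact: leq_trans (size_undup _) (size_famlist _).
Qed.

Fixpoint comps n : seq (seq nat) :=
  if n is m.+1 then
    if m is 0 then [:: [:: 1]]
    else map (cons 1) (comps m) ++ map (fun c => (head 0 c).+1 :: behead c) (comps m)
  else [:: [::]].

Lemma mem_comps n d : sumn d = n -> all (leq 1) d -> d \in comps n.
Proof.
elim: n d => [|n IH] d; first by case: d => [|[|a] l] //=; rewrite addSn.
have compsS m : comps m.+2 = map (cons 1) (comps m.+1) ++
  map (fun c => (head 0 c).+1 :: behead c) (comps m.+1) by [].
case: d => [|[|[|a]] l] // e; have {e} := e; rewrite [sumn _]/= ?addSn => -[e] /andP[_ Hl].
- case: n IH e => [|n] IH e; last by rewrite compsS mem_cat map_f // IH.
  by case: l e Hl => [|[|b] l].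
case: n IH e => [//|n] IH e.
rewrite compsS mem_cat; apply/orP; right; apply/mapP; exists (a.+1 :: l) => //.
by apply: IH => //; rewrite -e /= addSn.
Qed.

Definition vlist w := seq.filter dvalid (comps w).

Lemma lowH_count_ge n s : uniq s -> all (fun d => dvalid d && (sumn d == n)) s ->
  size s <= class_count lowH n.+1.
Proof.
move=> us /allP Hs; rewrite -(size_map dperm) /class_count -size_filter; apply: uniq_leq_size.
  by rewrite map_inj_in_uniq // => d d' /Hs/andP[v _] /Hs/andP[v' _]; exact: dperm_inj.
move=> p /mapP[d /Hs/andP[v /eqP sd] ->]; rewrite mem_filter.
have -> : lowH (dperm d) by apply/asboolP; right; exists d.
apply/mem_permutations_iota.
by rewrite size_dperm // sd; split=> //; exact: is_perm_dperm.
Qed.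

(** Compositions whose inner parts are at least 2 are counted by Fibonacci numbers. Lengths up to 9
    already bring the weight above 1 at the left end of the range. *)
Lemma lowH_fib n : n < 10 -> nth 0 [:: 0; 1; 1; 2; 3; 5; 8; 13; 21; 34] n <= class_count lowH n.
Proof.
case: n => // -[|n] Hn.
  have H : lowH [:: 1] by apply/asboolP; left.
  by rewrite /class_count /permutations /= H.
apply: leq_trans (lowH_count_ge (s := vlist n.+1) _ _).
- by do 8 (case: n Hn => [_|n Hn]; first by vm_compute).
- by do 8 (case: n Hn => [_|n Hn]; first by vm_compute).
by do 8 (case: n Hn => [_|n Hn]; first by vm_compute).
Qed.

(** Up to length 5 every candidate is in [lowD], so compensators are needed from length 6 on
    only. *)
Lemma lowH_size q : lowH q -> ~~ lowD q -> 5 < size q.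
Proof.
move=> /asboolP[->|[d vd ->]] nD.
  by case/negP: nD; apply/asboolP; left.
rewrite size_dperm // ltnS ltnNge; apply/negP => d4; case/negP: nD.
apply/asboolP; right; exists d => //; apply: (@famlist_fam0 (sumn d)).
  by case: d vd {d4} => [|[|a] l].
have pd : all (leq 1) d by case: d vd {d4} => // a l /= /andP[->/dvalid_tail_pos].
have : d \in vlist (sumn d) by rewrite mem_filter vd mem_comps.
move: (sumn d) d4 => w w4.
have : all (fun d => d \in famlist w) (vlist w).
  by do 5 (case: w w4 => [_|w w4]; first by vm_compute).
by move/allP; apply.
Qed.

Definition dmoves (d : seq nat) : seq (seq nat) :=
  [seq take i d ++ (nth 0 d i).-1 :: drop i.+1 d | i <- iota 0 (size d) &
     (2 < nth 0 d i) || (1 < nth 0 d i) && ((i == 0) || (i.+1 == size d))] ++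
  [seq c <- [:: behead d] | c != [::]] ++
  [seq c <- [:: take (size d).-1 d] | (c != [::]) && (last 0 d == 1)].

Lemma dmoves_dmove d d' : dmove d d' -> d' \in dmoves d.
Proof.
rewrite !mem_cat => -[l1 a l2 -> -> H|a -> d0|-> d0]; apply/or3P.
- apply: Or31; apply/mapP; exists (size l1).
    rewrite mem_filter mem_iota add0n size_cat /= addnS ltnS leq_addr andbT.
    rewrite nth_cat ltnn subnn /= size_eq0 eqSS -[X in X == _ + _]addn0 eqn_add2l.
    by rewrite (eq_sym 0) size_eq0.
  rewrite nth_cat ltnn subnn take_size_cat //; congr (_ ++ _ :: _).
  by rewrite -cat_rcons drop_size_cat ?size_rcons.
- by apply: Or32; rewrite mem_filter d0 mem_seq1 /=.
apply: Or33; rewrite mem_filter d0 last_rcons eqxx mem_seq1 size_rcons /= -cats1.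
by rewrite take_size_cat.
Qed.

(** A search with fuel [f]. Fuel [sumn d] suffices, since moves lower the sum and a valid sequence
    has positive sum. *)
Fixpoint subs_in_famlist f th d : bool :=
  if f is f'.+1 then ((sumn d <= th) ==> (d \in famlist (sumn d))) &&
    all (subs_in_famlist f' th) (dmoves d)
  else true.

Lemma sumn_dvalid d : dvalid d -> 0 < sumn d.
Proof. by case: d => // -[|a] l. Qed.

Lemma sumn_dmove d d' : dvalid d -> dmove d d' -> sumn d' < sumn d.
Proof.
move=> v [l1 a l2 e -> H|a e _|e _]; rewrite e in v *.
- rewrite !sumn_cat ltn_add2l /= ltn_add2r prednK //.
  by case/orP: H => [/ltnW/ltnW//|/andP[/ltnW]].
- by move: v => /= /andP[a0 _]; rewrite -[X in X < _]add0n ltn_add2r.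
by rewrite sumn_rcons addn1.
Qed.

Lemma subs_in_famlistP th d t : dvalid d -> subs_in_famlist (sumn d) th d ->
  is_perm t -> indecb t -> subperm t (dperm d) -> size t <= th.+1 -> lowD t.
Proof.
move=> vd cd pt it st szt.
pose S d' := dvalid d' /\ exists2 f, sumn d' <= f & subs_in_famlist f th d'.
have [|||->|[d' [vd' [f]]]] := @subperm_dperm_closed S t d _ _ pt it _ st.
- by move=> ? [].
- move=> e e' [ve [f ef ce]] m; have lt := sumn_dmove ve m.
  split; first exact: dvalid_move ve m.
  case: f ef ce => [|f] ef ce; first by have := sumn_dvalid ve; rewrite leqn0 in ef; rewrite (eqP ef).
  exists f; first by rewrite -ltnS (leq_trans lt).
  by move: ce => /= /andP[_ /allP]; apply; exact: dmoves_dmove.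
- by split=> //; exists (sumn d).
- by apply/asboolP; left.
move=> le c e; apply/asboolP; right; exists d' => //.
have s0 := sumn_dvalid vd'; apply: (famlist_fam0 s0).
case: f le c => [|f] le; first by rewrite leqNgt s0 in le.
by move=> /= /andP[/implyP H _]; apply: H; rewrite -ltnS -(size_dperm vd') -e.
Qed.

(** All pairs of decorated ends except [3] with [3]: four of weight 7 and four of weight 8. Middle
    parts of lengths [N] and [N.+1] then give four words of each of four consecutive lengths. *)
Definition apairs : seq (seq nat * seq nat) :=
  [:: ([:: 3], [:: 4]); ([:: 3], [:: 3; 1]); ([:: 4], [:: 3]); ([:: 1; 3], [:: 3]);
      ([:: 4], [:: 4]); ([:: 4], [:: 3; 1]); ([:: 1; 3], [:: 4]); ([:: 1; 3], [:: 3; 1])].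

Lemma apairsP p : p \in apairs ->
  [/\ p.1 \in lspec, p.2 \in rspec, p != ([:: 3], [:: 3]) & (6 < sumn p.1 + sumn p.2 <= 8)].
Proof.
have : all (fun p => [&& p.1 \in lspec, p.2 \in rspec, p != ([:: 3], [:: 3]) & (6 < sumn p.1 + sumn p.2 <= 8)]) apairs.
  by [].
by move=> /allP H /H/and4P[].
Qed.

Lemma fam_word N p k : p \in apairs -> N <= k -> fam (leq N) (word p k).
Proof.
move=> /apairsP[H1 H2 _ _] Nk; exists p.1, k, p.2; split=> //.
- by rewrite /word; case: (p.1) H1.
- by rewrite mem_cat H1 orbT.
- by rewrite mem_cat H2 orbT.
- by rewrite Nk !orbT.
Qed.

(** The word has two entries above 2, which in [fam0] forces both ends to be [3]; but it also
    contains a 1 or a 4. *)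
Lemma not_fam0_word p k : p \in apairs -> ~ fam0 (word p k).
Proof.
move=> pA [X [k' [Y [E _ HX HY ok]]]].
have c0 m : count (ltn 2) (nseq m 2) = 0 by rewrite count_nseq.
have Hc : count (ltn 2) X + count (ltn 2) Y = 2.
  have := congr1 (count (ltn 2)) E; rewrite /word !count_cat !c0 !add0n => <-.
  have /allP/(_ p pA)/eqP// : all (fun p => count (ltn 2) p.1 + count (ltn 2) p.2 == 2) apairs.
  by [].
have H14 : (1 \in word p k) || (4 \in word p k).
  rewrite /word !mem_cat !mem_nseq !andbF /=.
  by have /allP/(_ p pA) : all (fun p => (1 \in p.1) || (1 \in p.2) || ((4 \in p.1) || (4 \in p.2))) apairs.
move: H14; rewrite E !mem_cat !mem_nseq !andbF /=.
have [|[|[|[|]]]] := leftP HX => EX; have [|[|[|[|]]]] := rightP HY => EY;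
  by rewrite EX EY in Hc ok *.
Qed.

(** Outside [fam0] both ends are decorated and not both are [3], so they weigh at least 7 and the
    middle part at least [N.*2]. For [N = 0] the word [3; 3], of weight 6, would be an exception. *)
Lemma fam_leq_or N d : 0 < N -> fam (leq N) d -> fam0 d \/ 6 + N.*2 < sumn d.
Proof.
move=> N0 [X [k [Y [-> ne HX HY ok]]]].
case: (boolP [|| X \in plain, Y \in plain | [&& X == [:: 3], Y == [:: 3] & 0 < k]]) => H.
  by left; exists X, k, Y; split=> //; rewrite orbF.
move: H; rewrite negb_or => /andP[pX]; rewrite negb_or => /andP[pY nXY].
have Nk : N <= k.
  by move: ok; rewrite (negbTE pX) (negbTE pY) (negbTE nXY).
right; have -> : sumn (X ++ nseq k 2 ++ Y) = sumn X + sumn Y + k.*2.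
  by rewrite -(sumn_word (X, Y)).
rewrite -addSn; apply: leq_add; last by rewrite leq_double.
rewrite (leq_trans N0 Nk) andbT in nXY.
by have [|[|[|[|]]]] := leftP HX => EX; have [|[|[|[|]]]] := rightP HY => EY;
  rewrite EX EY in pX pY nXY *.
Qed.

Lemma word_inj p p' k k' : p \in apairs -> p' \in apairs -> word p k = word p' k' ->
  p = p' /\ k = k'.
Proof.
move=> pA pA' E.
have [_ _ _ s1] := apairsP pA; have [_ _ _ s2] := apairsP pA'.
have Es := congr1 sumn E; rewrite !sumn_word in Es.
(* The weights 7 and 8 of the ends are told apart by parity, which then fixes the middle length. *)
have kk : k = k'.
  move: s1 s2 Es; set s := _ + _; set s' := _ + _ => s1 s2 Es.
  have e : odd s = odd s' by have := congr1 odd Es; rewrite !oddD !odd_double !addbF.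
  have ss : s = s'.
    by move: s s' s1 s2 e {Es} => [|[|[|[|[|[|[|[|[|s]]]]]]]]] [|[|[|[|[|[|[|[|[|s']]]]]]]]].
  by move: Es; rewrite ss => /addnI/double_inj.
split=> //; rewrite -{k'}kk in E Es *.
have E1 : p.1 = p'.1.
  have := congr1 (head 0) E; rewrite /word.
  have H : all (fun p => all (fun p' => (head 0 p.1 == head 0 p'.1) ==> (p.1 == p'.1)) apairs) apairs by [].
  have /implyP H' := allP (allP H _ pA) _ pA'.
  have [h1 _ _ _] := apairsP pA; have [h2 _ _ _] := apairsP pA'.
  by case: p.1 p'.1 h1 h2 H' => [|x X] [|y Y] //= _ _ H' e; apply/eqP/H'/eqP.
have E2 : p.2 = p'.2.
  by move: E; rewrite /word E1 => /eqP; rewrite !eqseq_cat // !eqxx /= => /eqP.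
by case: (p) (p') E1 E2 => [a b] [c d] /= -> ->.
Qed.

Definition tail_words N := map (word^~ N) apairs ++ map (word^~ N.+1) apairs.

Lemma tail_words_uniq N : uniq (tail_words N).
Proof.
have inj k : {in apairs &, injective (word^~ k)} by move=> p p' pA pA' /(word_inj pA pA')[].
rewrite cat_uniq !map_inj_in_uniq //; apply/and3P; split=> //.
apply/hasPn => d /mapP[p pA ->]; apply/negP => /mapP[p' pA' /(word_inj pA pA')[_]].
by move/eqP; rewrite eqn_leq ltnn.
Qed.

Definition free_at n p := [/\ lowH p, ~~ lowD p, n < size p &
  forall t, is_perm t -> indecb t -> subperm t p -> size t <= n -> lowD t].

Lemma lowH_dperm d : dvalid d -> lowH (dperm d).
Proof. by move=> v; apply/asboolP; right; exists d. Qed.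

Lemma lowD_dperm d : dvalid d -> lowD (dperm d) <-> fam0 d.
Proof. by apply: dset_dperm => e; exact: fam_valid. Qed.

Lemma tail_words_free N n d : 0 < N -> n < 8 + N.*2 -> d \in tail_words N ->
  dvalid d /\ free_at n (dperm d).
Proof.
move=> N0 nN; rewrite mem_cat => dG.
have [p [k [pA Nk ->]]] : exists p k, [/\ p \in apairs, N <= k & d = word p k].
  by case/orP: dG => /mapP[p pA ->]; [exists p, N|exists p, N.+1].
have fw := fam_word pA Nk; have vd := fam_valid fw; split=> //; split.
- exact: lowH_dperm.
- by apply/negP => /(lowD_dperm vd); exact: not_fam0_word.
- rewrite size_dperm // sumn_word; have [_ _ _ /andP[s6 _]] := apairsP pA.
  apply: leq_trans nN _; rewrite -addSn leq_add // ?ltnS // leq_double //.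
move=> t pt it st szt; have [->|[d' fd' e]] := @subperm_dperm_closed (fam (leq N)) t _
  (@fam_valid _) (@fam_move _) pt it fw st; first by apply/asboolP; left.
have [f0|lt] := fam_leq_or N0 fd'; first by apply/asboolP; right; exists d'.
move: szt; rewrite e size_dperm ?(fam_valid fd') // => le.
by have := leq_ltn_trans le nN; rewrite addSn ltnS ltnNge addSn lt.
Qed.

(* Rejections at lengths 6 and 7, where [tail_words N] would need [N = 0]; found by search. *)
Definition words6 : seq (seq nat) := [:: [:: 3; 3]; [:: 1; 4; 1]; [:: 2; 3; 2]; [:: 3; 4]; [:: 4; 3]].
Definition words7 : seq (seq nat) := [:: [:: 2; 3; 2]; [:: 1; 2; 3; 2]; [:: 2; 3; 2; 1];
  [:: 1; 3; 2; 3]; [:: 3; 2; 3; 1]; [:: 3; 2; 4]; [:: 4; 2; 3]; [:: 1; 2; 3; 2; 1];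
  [:: 2; 2; 3; 2]; [:: 2; 3; 2; 2]].

Lemma free_small n (G : seq (seq nat)) d :
  all (fun d => [&& dvalid d, d \notin famlist (sumn d), n < sumn d &
    subs_in_famlist (sumn d) n d]) G -> d \in G -> dvalid d /\ free_at n.+1 (dperm d).
Proof.
move=> /allP H /H/and4P[v nf lt c]; split=> //; split.
- exact: lowH_dperm.
- by apply/negP => /(lowD_dperm v)/fam0_famlist; rewrite (negbTE nf).
- by rewrite size_dperm.
by move=> t pt it st sz; exact: subs_in_famlistP c pt it st sz.
Qed.

Lemma words6_free d : d \in words6 -> dvalid d /\ free_at 6 (dperm d).
Proof. by apply: free_small; vm_compute. Qed.

Lemma words7_free d : d \in words7 -> dvalid d /\ free_at 7 (dperm d).
Proof. by apply: free_small; vm_compute. Qed.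

(** * The families for the upper range *)

Local Arguments catp : simpl never.

Fixpoint alt (s : bool) m : seq bool := if m is k.+1 then s :: alt (~~ s) k else [::].

(* Caterpillars whose spine carries extra leaves at its two ends only; [stem] is the case
   in which the first end has none. *)
Definition star s i := s :: nseq i (~~ s).
Definition fork s i m j := star s i ++ alt s m ++ nseq j (s (+) odd m).
Definition stem s m j := s :: alt (~~ s) m ++ nseq j (~~ s (+) odd m).

Lemma size_alt s m : size (alt s m) = m.
Proof. by elim: m s => //= m IH s; rewrite IH. Qed.

Lemma size_star s i : size (star s i) = i.+1.
Proof. by rewrite /= size_nseq. Qed.

Lemma size_fork s i m j : size (fork s i m j) = (i + m + j).+1.
Proof. by rewrite !size_cat size_star size_alt size_nseq addnA. Qed.

Lemma nth_alt s m j k : k < m + j -> k <= m -> nth false (alt s m ++ nseq j (s (+) odd m)) k = s (+) odd k.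
Proof.
elim: m s k => [|m IH] s k.
  by rewrite leqn0 add0n => j0 /eqP k0; rewrite k0 in j0 *; case: j j0.
case: k => [|k]; first by rewrite /= addbF.
rewrite addSn !ltnS => kj km; have := IH (~~ s) k kj km.
by rewrite /= addNb addbN => ->; rewrite addNb -addbN.
Qed.

Lemma alt_rcons s m : alt s m.+1 = rcons (alt s m) (s (+) odd m).
Proof.
elim: m s => [|m IH] s; first by rewrite /= addbF.
rewrite -[alt s m.+2]/(s :: alt (~~ s) m.+1) IH /=.
by case: s; case: (odd m).
Qed.

Lemma fork_belast1 s i m : take (size (fork s i m.+1 1)).-1 (fork s i m.+1 1) = fork s i m 1.
Proof.
have -> : fork s i m.+1 1 = rcons (fork s i m 1) (s (+) odd m.+1).
  rewrite /fork -cats1 -!catA; congr cat; rewrite alt_rcons -cats1 -catA.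
  by congr cat; rewrite /=; case: s; case: (odd m).
by rewrite size_rcons -cats1 take_size_cat.
Qed.

(** By [catp_flip] the leading leaf moves behind its neighbour, so a path end becomes a fork end
    with [i = 2], the undecorated value, or the whole word becomes a star. *)
Lemma stem_catp s m j : 0 < j -> catp (stem s m j) =
  match m with 0 => catp (star s j) | 1 => catp (star (~~ s) j.+1)
  | m'.+2 => catp (fork (~~ s) 2 m' j) end.
Proof.
case: m => [|[|m]] j0.
- by rewrite /stem /star /= addbF.
- rewrite /stem /=; have -> : ~~ s (+) true = s by case: s.
  rewrite catp_flip; last by case: j j0 => //= j _; rewrite eqxx.
  by rewrite /star negbK.
rewrite /stem -[alt (~~ s) m.+2]/(~~ s :: ~~ ~~ s :: alt (~~ ~~ ~~ s) m) !negbK !cat_cons.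
rewrite catp_flip; last by rewrite /= eqxx.
by rewrite /fork /star /= !negbK.
Qed.

Section Family.
Variables (I J : nat) (b : pred nat).
Hypothesis I3 : 2 < I.
Hypothesis J2 : 1 < J.
Hypothesis JI : J <= I.

(* As in [fam], two decorated ends are allowed only for spine lengths satisfying [b]. *)
Inductive forkset (p : seq nat) : Prop :=
| FPoint of p = [:: 1]
| FEdge of p = [:: 2; 1]
| FStar s i of 1 < i & i <= I & p = catp (star s i)
| FFork s i m j of 1 < i & i <= J & 0 < j & j <= 2 & [|| i == 2, j == 1 | b m] & p = catp (fork s i m j).

Lemma forkset_star s i : 0 < i -> i <= I -> forkset (catp (star s i)).
Proof.
case: i => [//|[|i]] _ iI; last exact: (@FStar _ s i.+2).
by apply: FEdge; case: s.
Qed.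

Lemma forkset_stem s m j : 0 < j -> j <= 2 -> forkset (catp (stem s m j)).
Proof.
move=> j0 j2; rewrite stem_catp //; case: m => [|[|m]].
- by apply: forkset_star => //; exact: leq_trans j2 (ltnW I3).
- by apply: forkset_star => //; exact: leq_trans I3.
exact: (@FFork _ (~~ s) 2 m j).
Qed.

Lemma forkset_fork s i m j : 0 < i -> i <= J -> 0 < j -> j <= 2 ->
  [|| i <= 2, j == 1 | b m] -> forkset (catp (fork s i m j)).
Proof.
case: i => [//|[|i]] _ iJ j0 j2 H.
  2: by apply: (@FFork _ s i.+2 m j) => //; case/orP: H => [|->]; rewrite ?orbT //; case: (i).
have -> : fork s 1 m j = stem s m.+1 j; last exact: forkset_stem.
by rewrite /fork /stem /= negbK; case: s; case: (odd m).
Qed.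

Lemma forkset_size0 p : forkset p -> 0 < size p.
Proof. by case=> [->|->|s i _ _ ->|s i m j _ _ _ _ _ ->]; rewrite ?size_catp. Qed.

Lemma subperm_catp_run tau s i t : is_perm tau -> indecb tau ->
  subperm tau (catp (nseq i.+1 s ++ t)) -> tau = [:: 1] \/ subperm tau (catp (s :: t)).
Proof.
move=> pt it; elim: i => [|i IH]; first by right.
by move/(subperm_catp_same pt it) => [->|/IH]; [left|].
Qed.

(** Letters inside the alternating part are followed by different ones, so a deletion only shortens
    the first bundle of leaves or the last run, and dropping the first letter leaves a [stem]. *)
Lemma forkset_sub p t : forkset p -> is_perm t -> indecb t -> subperm t p -> forkset t.
Proof.
move: {2}(size p) (leqnn (size p)) => n; elim: n p => [|n IH] p pn Fp pt it st.
  by have := forkset_size0 Fp; rewrite leqn0 in pn; rewrite (eqP pn).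
have step q : size q < size p -> forkset q -> subperm t q -> forkset t.
  move=> qp Fq stq; apply: (IH q) => //; rewrite -ltnS; exact: leq_trans qp pn.
have one : t = [:: 1] -> forkset t by exact: FPoint.
case: Fp st step => [->|->|s i i1 iI ->|s i m j i1 iJ j0 j2 H ->].
- move=> /subperm_size s1 _; apply: one; apply: is_perm1 => //.
  by apply/eqP; rewrite eqn_leq s1 indec_size.
- move=> st _; have := subperm_size st; rewrite /= leq_eqVlt => /predU1P[s2|s1].
    by apply: FEdge; apply: subperm_iso.
  by apply: one; apply: is_perm1 => //; apply/eqP; rewrite eqn_leq -ltnS s1 indec_size.
- move=> st step; have smaller : subperm t (catp (star s i.-1)) -> forkset t.
    apply: step; last by apply: forkset_star; [rewrite -ltnS prednK // ltnW|exact: leq_trans (leq_pred i) iI].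
    by rewrite !size_catp !size_star ltnS prednK // ltnW.
  have delE k : 0 < k -> k <= i -> del k (star s i) = star s i.-1.
    by move=> k0 ki; rewrite /star -cat1s del_catr //= del_nseq // subn1 prednK.
  case: (subperm_catp_cases pt it st) => [->|[k [kt nk]]|st'|].
  + exact: (@FStar _ s i).
  + have [k0|k0] := posnP k.
      have := nk; rewrite k0 size_star => /(_ (ltnW i1)); rewrite /star /= nth_nseq ltnW //.
      by case: (s).
    by rewrite -/(del k (star s i)) delE //; rewrite size_star ltnS in kt.
  + apply: smaller; rewrite -(delE i) ?(ltnW i1) // /del drop_oversize ?size_star // cats0.
    by rewrite size_star in st'.
  rewrite /star /= drop0 -[i in nseq i _](prednK (ltnW i1)) -[nseq _ _]cats0.
  by move/(subperm_catp_run pt it) => [|/(subperm_single pt it)]; exact: one.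
move=> st step; have Efork : fork s i m j = star s i ++ (alt s m ++ nseq j (s (+) odd m)) by [].
have pre : subperm t (catp (fork s i.-1 m j)) -> forkset t.
  apply: step; first by rewrite !size_catp !size_fork !ltnS ltn_add2r ltn_add2r prednK // ltnW.
  apply: forkset_fork => //; first by rewrite -ltnS prednK // ltnW.
    exact: leq_trans (leq_pred i) iJ.
  by case/orP: H => [/eqP->//|->]; rewrite orbT.
have lastd : subperm t (catp (take (size (fork s i m j)).-1 (fork s i m j))) -> forkset t.
  have [j1|j1] : j = 2 \/ j = 1 by case: (j) j0 j2 => [|[|[|]]]; auto.
    rewrite j1; have -> : take (size (fork s i m 2)).-1 (fork s i m 2) = fork s i m 1.
      have -> : fork s i m 2 = rcons (fork s i m 1) (s (+) odd m) by rewrite /fork -!cats1 -!catA.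
      by rewrite size_rcons -cats1 take_size_cat.
    apply: step; first by rewrite j1 !size_catp !size_fork !addn1 !addn2.
    by apply: forkset_fork => //; rewrite ?orbT // ltnW.
  rewrite j1; case: (posnP m) => [m0|m0].
    have -> : fork s i m 1 = rcons (star s i) s by rewrite m0 /fork /= addbF cats1.
    rewrite size_rcons -cats1 take_size_cat //; apply: step.
      by rewrite !size_catp size_fork size_star j1 m0 addn0 addn1.
    by apply: forkset_star; [exact: ltnW|exact: leq_trans iJ JI].
  rewrite -[m in take _ (fork s i m 1)](prednK m0) -[m in size (fork s i m 1)](prednK m0) fork_belast1.
  apply: step; first by rewrite j1 !size_catp !size_fork !addn1 -[X in _ < (_ + X).+2](prednK m0) addnS.
  by apply: forkset_fork => //; rewrite ?orbT // ltnW.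
case: (subperm_catp_cases pt it st) => [->|[k [kt nk]]|//|].
- exact: (@FFork _ s i m j).
- rewrite -/(del k (fork s i m j)) Efork.
  have szs : size (star s i) = i.+1 by exact: size_star.
  case: (ltnP k i.+1) => ki.
    rewrite del_catl ?szs //; have [k0|k0] := posnP k.
      have := nk; rewrite k0 size_fork ltnS !addn_gt0 (ltnW i1) => /(_ isT); rewrite Efork !nth_cat szs /star /= ltnS (ltnW i1).
      by rewrite nth_nseq (ltnW i1); case: (s).
    by rewrite /star -cat1s del_catr //= del_nseq // ?subn1 ?prednK.
  rewrite del_catr ?szs //; case: (ltnP (k - i.+1) m) => km.
    have kj : k - i.+1 < m + j by rewrite ltn_addr.
    have kj1 : (k - i.+1).+1 < m + j.
      by apply: leq_ltn_trans km _; rewrite -[X in X < _]addn0 ltn_add2l.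
    have k1 : k.+1 < size (fork s i m j).
      rewrite size_fork -addnA -addSn -ltn_subLR ?(leqW ki) // subSn //.
    have c1 : (k.+1 < i.+1) = false by rewrite ltnNge (leqW ki).
    have c2 : (k < i.+1) = false by rewrite ltnNge ki.
    have := nk k1; rewrite Efork !(nth_cat _ (star s i)) szs c1 c2 subSn //.
    by rewrite !nth_alt // ?(ltnW km) //=; case: (s); case: (odd _).
  have kj : k - i.+1 - m < j.
    by rewrite ltn_subLR // ltn_subLR // addnA; move: kt; rewrite size_fork -!addSn.
  rewrite del_catr ?size_alt // del_nseq // => stl; apply: lastd.
  have -> : fork s i m j = rcons (star s i ++ alt s m ++ nseq j.-1 (s (+) odd m)) (s (+) odd m).
    by rewrite -cats1 -!catA -[[:: _]]/(nseq 1 _) -nseqD addn1 prednK.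
  by rewrite size_rcons -cats1 take_size_cat.
have -> : drop 1 (fork s i m j) = nseq i.-1.+1 (~~ s) ++ (alt s m ++ nseq j (s (+) odd m)).
  by rewrite prednK ?(ltnW i1) // /fork /star /= drop0.
move/(subperm_catp_run pt it) => [/one//|].
have -> : ~~ s :: alt s m ++ nseq j (s (+) odd m) = stem (~~ s) m j by rewrite /stem !negbK.
apply: step; last exact: forkset_stem.
rewrite !size_catp size_fork /stem /= size_cat size_alt size_nseq ltnS -addnA.
by rewrite -[X in X < _]add0n ltn_add2r ltnW.
Qed.

End Family.

(** The condition [1 < i] removes the ambiguity of [catp_flip]: the permutation starts with 2 if [s]
    is [false] and with at least 3 if [s] is [true]. *)
Lemma star_cat_inj s s' i i' t t' : 1 < i -> 1 < i' ->
  head s t = s -> head s' t' = s' ->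
  catp (star s i ++ t) = catp (star s' i' ++ t') -> [/\ s = s', i = i' & t = t'].
Proof.
move=> i1 i1' Ht Ht' E.
have form b k r : 1 < k -> star b k ++ r = [:: b, ~~ b, ~~ b & nseq k.-2 (~~ b) ++ r].
  by case: k => [|[|k]].
have ss : s = s'.
  by move: E; rewrite !form //; case: s s' {Ht Ht' form} => -[] //= E.
rewrite -ss in Ht' E *; rewrite /star !cat_cons in E; have {}E := catp_inj E.
have run_i k r : head s r = s -> run (~~ s) (nseq k (~~ s) ++ r) = k.
  move=> Hr; elim: k => [|k IH] /=; last by rewrite /run /= eqxx /= -/(run _ _) IH.
  by case: r Hr => //= c r ->; rewrite /run /=; case: (s).
have ii : i = i' by rewrite -(run_i i t Ht) E run_i.
split=> //; move: E; rewrite -ii => /eqP; rewrite eqseq_cat // => /andP[_ /eqP].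
by [].
Qed.

Lemma head_alt s m j : 0 < j -> head s (alt s m ++ nseq j (s (+) odd m)) = s.
Proof. by case: m => [|m] //; case: j => //= j _; rewrite addbF. Qed.

Lemma fork_catp_inj s s' i i' m m' j j' : 1 < i -> 1 < i' -> 0 < j -> 0 < j' ->
  catp (fork s i m j) = catp (fork s' i' m' j') -> [/\ s = s', i = i' & m + j = m' + j'].
Proof.
move=> i1 i1' j0 j0' E.
have [||ss ii tt] := @star_cat_inj _ _ _ _ _ _ i1 i1' _ _ E; [exact: head_alt|exact: head_alt|].
split=> //; have := congr1 size tt.
by rewrite !size_cat !size_alt !size_nseq.
Qed.

(** A second representation would have the same [s] and [i], hence last run 1 and spine [m.+1].
    After the star, the two words differ at index [m.+1], where one repeats a letter and the other
    alternates. *)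
Lemma fork2_not_forkset I J s i m : 2 < i -> ~ forkset I J pred0 (catp (fork s i m 2)).
Proof.
move=> i2; have i1 := ltnW i2; case=> [E|E|s' i' i1' _ E|s' i' m' j' i1' _ j0 j2 H E].
- by have := congr1 size E; rewrite size_catp size_fork addn2.
- by have := congr1 size E; rewrite size_catp size_fork addn2.
- rewrite -[star s' i']cats0 in E.
  have [||_ _ tt] := @star_cat_inj _ _ _ _ _ _ i1 i1' _ _ E; [exact: head_alt| |] => //.
  by have := congr1 size tt; rewrite size_cat size_nseq addn2.
have [||ss ii tt] := @star_cat_inj _ _ _ _ _ _ i1 i1' _ _ E; [exact: head_alt|exact: head_alt|].
have sz : m + 2 = m' + j' by have := congr1 size tt; rewrite !size_cat !size_alt !size_nseq.
move: H; rewrite -ii gtn_eqF //= orbF => /eqP j1.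
rewrite -ss j1 in tt; rewrite j1 addn2 addn1 in sz; case: sz => sz.
have : nth false (alt s m ++ nseq 2 (s (+) odd m)) m.+1 =
    nth false (alt s m.+1 ++ nseq 1 (s (+) odd m.+1)) m.+1 by rewrite tt sz.
rewrite (@nth_alt s m.+1 1) ?addn1 // nth_cat size_alt ltnNge leqnSn subSnn /=.
by case: (s); case: (odd m).
Qed.

Lemma indec_star s i : 0 < i -> indecb (catp (star s i)).
Proof. by case: i => // i _; exact: indec_catp. Qed.

Lemma indec_fork s i m j : 0 < i -> indecb (catp (fork s i m j)).
Proof. by case: i => // i _; exact: indec_catp. Qed.

Lemma forkset_indec I J b p : forkset I J b p -> is_perm p /\ indecb p.
Proof.
case=> [->|->|s i i1 _ ->|s i m j i1 _ _ _ _ ->] //.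
  by split; [exact: is_perm_catp|apply: indec_star; exact: ltnW].
by split; [exact: is_perm_catp|apply: indec_fork; exact: ltnW].
Qed.

Definition forkD I : pred (seq nat) := fun p => `[< forkset I I pred0 p >].

Lemma downset_forkD I : 2 < I -> downset (forkD I).
Proof.
move=> I3; split=> [p /asboolP/forkset_indec//|p t /asboolP Fp pt it st].
by apply/asboolP; apply: forkset_sub Fp pt it st => //; exact: ltnW.
Qed.

Definition forklist I n : seq (seq nat) :=
  if n < 2 then [:: [:: 1]] else if n == 2 then [:: [:: 2; 1]] else
  [seq catp w | w <- flatten [seq (if n.-1 <= I then [:: star s n.-1] else [::]) ++
    [seq fork s i (n - 2 - i) 1 | i <- iota 2 I.-1 & i + 2 <= n] ++
    (if 5 <= n then [:: fork s 2 (n - 5) 2] else [::]) | s <- [:: true; false]]].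

Lemma forkD_forklist I p : 2 < I -> forkD I p -> p \in forklist I (size p).
Proof.
move=> I3 /asboolP[->|->|s i i1 iI ->|s i m j i1 iI j0 j2 H ->] //.
  rewrite size_catp size_star /forklist ltnS ltnNge ltnW // eqSS gtn_eqF // [i.+1.-1]/= iI; apply: map_f.
  apply/flattenP; eexists; first by apply: (map_f _ (_ : s \in _)); case: (s).
  by rewrite !mem_cat mem_head.
have lt : 1 < i + m + j by rewrite (leq_trans i1) // -addnA leq_addr.
rewrite size_catp size_fork /forklist ltnS ltnNge (ltnW lt) eqSS gtn_eqF //.
apply: map_f; apply/flattenP; eexists; first by apply: (map_f _ (_ : s \in _)); case: (s).
rewrite !mem_cat; apply/orP; right; apply/orP.
have [j1|j1] : j = 2 \/ j = 1 by case: (j) j0 j2 => [|[|[|]]]; auto.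
  right; move: H; rewrite j1 /= !orbF => /eqP->.
  by rewrite -addnA addn2 !addnS /= !subSS subn0 mem_head.
left; apply/mapP; exists i.
  rewrite mem_filter mem_iota i1 j1 addn1 addn2 !ltnS leq_addr /=.
  by rewrite prednK // (ltn_trans _ I3).
by rewrite j1 addn1 !subSS subn0 addKn.
Qed.

Lemma count_forkD I n : 2 < I -> class_count (forkD I) n <= size (forklist I n).
Proof.
move=> I3; rewrite /class_count -size_filter; apply: uniq_leq_size.
  by rewrite filter_uniq // permutations_uniq.
move=> p; rewrite mem_filter => /andP[Dp /mem_permutations_iota[_ <-]].
exact: forkD_forklist.
Qed.

(** From length 5 on each first letter allows three words: [i = 2] or [i = 3] with [j = 1], and
    [i = 2] with [j = 2]. *)
Lemma count_forkD3 n : class_count (forkD 3) n <= nth 6 [:: 0; 1; 1; 2; 4] n.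
Proof.
case: n => [|n].
  by rewrite class_count0 //; exact: downset_forkD.
apply: leq_trans (count_forkD _ _) _ => //.
by do 5 (case: n => [|n] //).
Qed.

Lemma count_forkD4 n : 4 < n -> class_count (forkD 4) n <= 8.
Proof.
move=> n4; apply: leq_trans (count_forkD _ _) _ => //.
by do 6 (case: n n4 => [|n] n4 //).
Qed.

Definition allD : pred (seq nat) := fun p => `[< is_perm p >] && indecb p.

Lemma allDP p : reflect (is_perm p /\ indecb p) (allD p).
Proof. by apply: (iffP andP) => -[/asboolP]. Qed.

Lemma downset_allD : downset allD.
Proof. by split=> [p /allDP//|p t _ pt it _]; apply/allDP. Qed.

Lemma count_allD n : class_count allD n = count indecb (permutations (iota 1 n)).
Proof.
apply: eq_in_count => p /mem_permutations_iota[pp _]; rewrite /allD.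
by have /asboolP-> := pp.
Qed.

Lemma count_allD_small n : n < 7 -> class_count allD n = nth 0 [:: 0; 1; 1; 3; 13; 71; 461] n.
Proof. by rewrite count_allD; do 7 (case: n => [_|n]; first by vm_compute). Qed.

(** Including all indecomposables up to length 4 moves the first possible rejection to length 5,
    where [fork_words] applies. *)
Definition forkD4 : pred (seq nat) := fun p => forkD 4 p || (allD p && (size p <= 4)).

Lemma downset_forkD4 : downset forkD4.
Proof.
have dF : downset (forkD 4) by exact: downset_forkD.
split=> [p /orP[/dF.1//|/andP[/allDP//]]|p t /orP[Dp|/andP[_ sp]] pt it st].
  by rewrite /forkD4 (dF.2 p t Dp).
have -> : forkD4 t = true; last by [].
rewrite /forkD4 (leq_trans (subperm_size st) sp) andbT; apply/orP; right; exact/allDP.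
Qed.

Lemma count_forkD4_le n : class_count forkD4 n <= nth 8 [:: 0; 1; 1; 3; 13] n.
Proof.
case: (leqP n 4) => n4.
  apply: (@leq_trans (class_count allD n)).
    apply: sub_count => p /= H; apply/allDP; exact: downset_forkD4.1.
  by rewrite count_allD_small ?(leq_ltn_trans n4) //; case: n n4 => [|[|[|[|[|]]]]].
have -> : nth 8 [:: 0; 1; 1; 3; 13] n = 8 by rewrite nth_default.
apply: leq_trans (count_forkD4 n4); rewrite leq_eqVlt; apply/orP; left; apply/eqP.
apply: eq_in_count => p /mem_permutations_iota[_ sp].
by rewrite /forkD4 sp [n <= 4]leqNgt n4 andbF orbF.
Qed.

Definition free_over (D : pred (seq nat)) n p := [/\ allD p, ~~ D p, n < size p &
  forall t, is_perm t -> indecb t -> subperm t p -> size t <= n -> D t].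

(** A fork decorated at both ends with spine at least [N] has at least [6 + N] entries, so the
    closed family for [leq N] agrees with [forkD I] up to length [n]. *)
Lemma fork_free I N n s i m : 2 < i -> i <= I -> N <= m -> n < 6 + N ->
  free_over (forkD I) n (catp (fork s i m 2)).
Proof.
move=> i2 iI Nm nN.
have Fp : forkset I I (leq N) (catp (fork s i m 2)).
  by apply: (@FFork _ _ _ _ s i m 2) => //; [exact: ltnW|rewrite Nm !orbT].
split.
- by apply/allDP; exact: forkset_indec Fp.
- by apply/negP => /asboolP; exact: fork2_not_forkset.
- rewrite size_catp size_fork addn2; apply: leq_trans nN _.
  by rewrite -[6 + N]/(3 + N).+3 !ltnS leq_add.
move=> t pt it st sz; apply/asboolP.
have I3 : 2 < I by exact: leq_trans iI.
have [->|->|s' i' i1 i1' e|s' i' m' j i1 i1' j0 j2 H e] := forkset_sub I3 (ltnW I3) (leqnn I) Fp pt it st.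
- exact: FPoint.
- exact: FEdge.
- exact: (@FStar _ _ _ _ s' i').
apply: (@FFork _ _ _ _ s' i' m' j) => //; apply: contraTT sz.
rewrite !negb_or /= => /and3P[ni nj _]; move: H; rewrite (negbTE ni) (negbTE nj) /= => Nm'.
rewrite -ltnNge e size_catp size_fork; apply: leq_trans nN _.
have {j0 j2 nj} -> : j = 2 by case: j j0 j2 nj {e} => [|[|[|]]].
have i3 : 2 < i' by rewrite ltn_neqAle eq_sym ni.
by rewrite addn2 -[6 + N]/(3 + N).+3 !ltnS leq_add.
Qed.

Lemma fork_free4 N n s i m : 2 < i -> i <= 4 -> N <= m -> n < 6 + N -> 3 < n ->
  free_over forkD4 n (catp (fork s i m 2)).
Proof.
move=> i2 iI Nm nN n3; have [a d sz sub] := fork_free s i2 iI Nm nN; split=> //.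
  rewrite /forkD4 negb_or d negb_and -ltnNge (leq_ltn_trans n3 sz) orbT //.
by move=> t pt it st tn; rewrite /forkD4 sub.
Qed.

(** Forks stay bounded by 3 while stars may reach 4, so that only the stars with four leaves are new
    compared with [forkD 3]. *)
Lemma star_free s : free_over (forkD 3) 4 (catp (star s 4)).
Proof.
have Fp : forkset 4 3 pred0 (catp (star s 4)) by apply: (@FStar _ _ _ _ s 4).
split.
- by apply/allDP; exact: forkset_indec Fp.
- by apply/negP => /forkD_forklist => /(_ isT); case: s {Fp}; vm_compute.
- by rewrite size_catp size_star.
move=> t pt it st sz; apply/asboolP.
have [->|->|s' i' i1 i1' e|s' i' m' j i1 i1' j0 j2 H e] :=
    @forkset_sub 4 3 pred0 isT isT isT _ _ Fp pt it st.
- exact: FPoint.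
- exact: FEdge.
- by apply: (@FStar _ _ _ _ s' i') => //; move: sz; rewrite e size_catp size_star ltnS.
exact: (@FFork _ _ _ _ s' i' m' j).
Qed.

Definition has321 (p : seq nat) := has (fun i => has (fun j => has (fun k =>
  [&& i < j, j < k, nth 0 p j < nth 0 p i & nth 0 p k < nth 0 p j])
  (iota 0 (size p))) (iota 0 (size p))) (iota 0 (size p)).

Lemma has321P p : subperm [:: 3; 2; 1] p -> has321 p.
Proof.
move=> /subpermP[f [f1 f2 f3]].
apply/hasP; exists (f 0); first by rewrite mem_iota add0n f1.
apply/hasP; exists (f 1); first by rewrite mem_iota add0n f1.
apply/hasP; exists (f 2); first by rewrite mem_iota add0n f1.
by rewrite !f2 //= -!f3.
Qed.

(* Obtained by a finite search: they compensate the rejection of [3; 2; 1]. *)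
Definition perms3 : seq (seq nat) := [:: [:: 3; 4; 1; 2]; [:: 2; 3; 4; 5; 1]; [:: 2; 4; 5; 1; 3];
  [:: 3; 4; 1; 5; 2]; [:: 3; 4; 5; 1; 2]; [:: 3; 5; 1; 2; 4]; [:: 4; 1; 5; 2; 3];
  [:: 4; 5; 1; 2; 3]; [:: 5; 1; 2; 3; 4]].

Lemma forkD3_small t : is_perm t -> indecb t -> size t <= 3 -> t != [:: 3; 2; 1] -> forkD 3 t.
Proof.
move=> pt it st ne; apply/asboolP.
have H : all (fun n => all (fun t => indecb t ==>
    (t \in [:: [:: 3; 2; 1]; [:: 1]; [:: 2; 1]; catp (star true 2); catp (star false 2)]))
    (permutations (iota 1 n))) (iota 0 4) by vm_compute.
have /(allP H)/allP/(_ t) : size t \in iota 0 4 by rewrite mem_iota.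
have mt : t \in permutations (iota 1 (size t)) by apply/mem_permutations_iota.
move=> /(_ mt); rewrite it /= !inE (negbTE ne) /=.
case/or4P => /eqP->; [exact: FPoint|exact: FEdge|exact: (@FStar _ _ _ _ true 2)|].
exact: (@FStar _ _ _ _ false 2).
Qed.

Lemma perms3_free p : p \in perms3 -> free_over (forkD 3) 3 p.
Proof.
have H : all (fun p => [&& perm_eq p (iota 1 (size p)), indecb p, p \notin forklist 3 (size p),
    3 < size p & ~~ has321 p]) perms3 by vm_compute.
move=> /(allP H)/and5P[pp ip nD sz n321]; split=> //.
- exact/allDP.
- by apply/negP => /forkD_forklist => /(_ isT); exact/negP.
move=> t pt it st tn; apply: forkD3_small => //.
by apply: contra n321 => /eqP e; apply: has321P; rewrite -e.
Qed.

Definition fork_params (Is : seq nat) N : seq (bool * (nat * nat)) :=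
  [seq (s, im) | s <- [:: true; false],
     im <- [seq (i, m) | i <- Is, m <- [:: N; N.+1; N.+2]]].

Definition fork_words Is N := [seq fork x.1 x.2.1 x.2.2 2 | x <- fork_params Is N].

Lemma fork_paramsP Is N x : x \in fork_params Is N -> x.2.1 \in Is /\ N <= x.2.2.
Proof.
move=> /allpairsP[[a y] [_ yin ->]] /=.
have {yin} /allpairsP[[i m] [iI min e]] : y \in [seq (i, m) | i <- Is, m <- [:: N; N.+1; N.+2]] := yin.
rewrite e /=; split; first exact: iI.
by move: min; rewrite !inE /= => /or3P[] /eqP->; lia.
Qed.

Lemma fork_words_uniq Is N : uniq Is -> {in Is, forall i, 2 < i} ->
  uniq (map catp (fork_words Is N)).
Proof.
move=> uI I2; rewrite -map_comp map_inj_in_uniq; last first.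
  move=> [s [i m]] [s' [i' m']] /fork_paramsP[/I2 i2 _] /fork_paramsP[/I2 i2' _] /=.
  move=> E; have [-> -> /addIn->] := @fork_catp_inj s s' i i' m m' 2 2 (ltnW i2) (ltnW i2') isT isT E.
  by [].
apply: allpairs_uniq => //; last by move=> [? ?] [? ?] _ _ [-> ->].
apply: allpairs_uniq => //; last by move=> [? ?] [? ?] _ _ [-> ->].
by rewrite /= !inE; lia.
Qed.

Lemma fork_wordsP Is N w : w \in fork_words Is N -> exists s i m,
  [/\ i \in Is, N <= m & w = fork s i m 2].
Proof.
by move=> /mapP[[s [i m]] /fork_paramsP[iI Nm] ->]; exists s, i, m.
Qed.

Import Order.TTheory GRing.Theory Num.Theory.
Import numFieldNormedType.Exports.
Local Open Scope classical_set_scope.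
Local Open Scope ring_scope.

(** * Growth rates *)

(** Bounds up to a constant for every base on either side of [g]: they pass termwise through the
    binomial transform, and they force the limit of the roots to exist. *)
Definition exp_growth (R : realType) (c : nat -> nat) (g : R) :=
  (forall a : R, 0 < a < g -> exists2 k : R, 0 < k & forall n, k * a ^+ n <= (c n)%:R) /\
  (forall b : R, g < b -> exists K : R, forall n, (c n)%:R <= K * b ^+ n).

Section Renewal.
Variables (R : realType) (r c : nat -> nat) (g : R).
Hypothesis g0 : 0 < g.
Hypothesis c0 : c 0%N = 1%N.
Hypothesis cS : forall n, c n.+1 = (\sum_(k < n.+1) r k.+1 * c (n - k))%N.
Hypothesis r1 : (0 < r 1)%N.
Hypothesis sum_le1 : forall N, \sum_(k < N) (r k.+1)%:R * g^-1 ^+ k.+1 <= 1.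
Hypothesis sum_lim : forall e, 0 < e -> exists N, 1 - e < \sum_(k < N) (r k.+1)%:R * g^-1 ^+ k.+1.

Lemma renewal_upper n : (c n)%:R <= g ^+ n.
Proof.
elim/ltn_ind: n => -[|n] IH; first by rewrite c0 expr0.
rewrite cS natr_sum.
apply: (@le_trans _ _ (g ^+ n.+1 * \sum_(k < n.+1) (r k.+1)%:R * g^-1 ^+ k.+1)); last first.
  by rewrite -[leRHS]mulr1 ler_wpM2l // exprn_ge0 // ltW.
rewrite mulr_sumr; apply: ler_sum => k _; rewrite natrM mulrCA.
apply: ler_wpM2l; first exact: ler0n.
have -> : g ^+ n.+1 * g^-1 ^+ k.+1 = g ^+ (n - k).
  by rewrite -subSS exprVn -expfB_cond ?gt_eqF // ltn_ord.
by apply: IH; rewrite ltnS leq_subr.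
Qed.

Lemma renewal_pos n : (0 < c n)%N.
Proof.
elim: n => [|n IH]; first by rewrite c0.
by rewrite cS big_ord_recl subn0 addn_gt0 muln_gt0 r1 IH.
Qed.

(** For [a < g] some partial sum of r_k a^(-k) reaches 1, which makes multiples of [a ^+ n]
    subsolutions of the renewal equation; a small constant takes care of the start. *)
Lemma renewal_lower a : 0 < a < g -> exists2 k : R, 0 < k & forall n, k * a ^+ n <= (c n)%:R.
Proof.
move=> /andP[a0 ag].
have ga : g^-1 < a^-1 by rewrite ltf_pV2.
(* Passing from [g] to [a] raises the term of length 1 by at least this difference, because r_1 >=
   1; so this accuracy is enough. *)
have [|N HN] := sum_lim (_ : 0 < a^-1 - g^-1); first by rewrite subr_gt0.
have H1 : 1 <= \sum_(k < N.+1) (r k.+1)%:R * a^-1 ^+ k.+1.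
  have {}HN : 1 - (a^-1 - g^-1) < \sum_(k < N.+1) (r k.+1)%:R * g^-1 ^+ k.+1.
    apply: lt_le_trans HN _; rewrite big_ord_recr /= lerDl.
    by rewrite mulr_ge0 // exprn_ge0 // invr_ge0 ltW.
  rewrite big_ord_recl in HN; rewrite big_ord_recl.
  apply: (@le_trans _ _ ((r 1)%:R * a^-1 + \sum_(i < N) (r (lift ord0 i).+1)%:R * g^-1 ^+ (lift ord0 i).+1)).
    have r1R : 1 <= (r 1)%:R :> R by rewrite ler1n.
    have : 0 <= ((r 1)%:R - 1) * (a^-1 - g^-1) by apply: mulr_ge0; rewrite subr_ge0 // ltW.
    rewrite /= !expr1 in HN *; nra.
  rewrite expr1 lerD2l; apply: ler_sum => i _; apply: ler_wpM2l => //.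
  by apply: lerXn2r; rewrite ?nnegrE ?invr_ge0 ltW.
(* The factor M^(-N) pushes the bound below 1 for all [n <= N], where only positivity of [c n] is
   used. *)
pose M := Num.max 1 a.
have M1 : 1 <= M by rewrite le_max lexx.
have M0 : 0 < M by exact: lt_le_trans ltr01 M1.
have aM : a <= M by rewrite le_max lexx orbT.
exists (M ^- N); first by rewrite invr_gt0 exprn_gt0.
elim/ltn_ind => n IH; case: (leqP n N) => [nN|Nn].
  apply: (@le_trans _ _ 1); last by rewrite ler1n renewal_pos.
  rewrite mulrC ler_pdivrMr ?exprn_gt0 // mul1r.
  apply: (@le_trans _ _ (M ^+ n)).
    by apply: lerXn2r => //; rewrite nnegrE ltW.
  exact: ler_weXn2l.
case: n Nn IH => // m Nm IH; rewrite cS natr_sum.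
apply: (@le_trans _ _ (\sum_(k < N.+1) (r k.+1)%:R * (M ^- N * a ^+ (m - k)))).
  have -> : \sum_(k < N.+1) (r k.+1)%:R * (M ^- N * a ^+ (m - k)) =
            M ^- N * a ^+ m.+1 * \sum_(k < N.+1) (r k.+1)%:R * a^-1 ^+ k.+1.
    rewrite mulr_sumr; apply: eq_bigr => k _.
    have -> : a ^+ (m - k) = a ^+ m.+1 * a^-1 ^+ k.+1.
      by rewrite exprVn -expfB_cond ?gt_eqF ?subSS // (leq_trans (ltn_ord k)).
    by rewrite [RHS]mulrCA -!mulrA.
  by rewrite -[leLHS]mulr1 ler_wpM2l // mulr_ge0 ?invr_ge0 ?exprn_ge0 // ltW.
have Nm' : (N.+1 <= m.+1)%N by [].
rewrite (big_ord_widen m.+1 (fun k => (r k.+1)%:R * (M ^- N * a ^+ (m - k))) Nm').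
rewrite [leRHS](bigID (fun k : 'I_m.+1 => (k < N.+1)%N)) /= -[leLHS]addr0.
apply: lerD; last by apply: sumr_ge0 => k _; exact: ler0n.
apply: ler_sum => k _; rewrite natrM; apply: ler_wpM2l => //.
by apply: IH; rewrite ltnS leq_subr.
Qed.

Lemma renewal_growth : exp_growth c g.
Proof.
split; first exact: renewal_lower.
move=> b gb; exists 1 => n; rewrite mul1r.
apply: le_trans (renewal_upper n) _.
by apply: lerXn2r; rewrite ?nnegrE ltW // (lt_trans g0).
Qed.

End Renewal.

Lemma bernoulli (R : realType) (d : R) n : 0 <= d -> 1 + n%:R * d <= (1 + d) ^+ n.
Proof.
move=> d0; elim: n => [|n IH]; first by rewrite mul0r addr0 expr0.
rewrite exprS -natr1; have : 0 <= n%:R :> R by [].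
nra.
Qed.

Lemma expr_gt1_unbounded (R : realType) (x M : R) : 1 < x ->
  exists N, forall n, (N <= n)%N -> M <= x ^+ n.
Proof.
move=> x1; have d0 : 0 < x - 1 by rewrite subr_gt0.
exists (Num.bound `|M / (x - 1)|) => n Hn.
have H := bernoulli n (ltW d0); rewrite [1 + (x - 1)]addrC subrK in H.
apply: le_trans H; apply: (@le_trans _ _ (n%:R * (x - 1))); last by rewrite lerDr.
rewrite -ler_pdivrMr //; apply: le_trans (ler_norm _) _.
apply: le_trans (ltW (archi_boundP (normr_ge0 _))) _.
by rewrite ler_nat.
Qed.

Lemma exp_growth_lower (R : realType) (c : nat -> nat) (g a : R) :
  0 < a < g -> exp_growth c g -> exists N, forall n, (N <= n)%N -> a ^+ n <= (c n)%:R.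
Proof.
move=> /andP[a0 ag] [low _].
(* A base halfway to [g] leaves an exponential factor that swallows the constant. *)
have [|k k0 Hk] := low ((a + g) / 2); first by lra.
have [|N HN] := @expr_gt1_unbounded R ((a + g) / 2 / a) k^-1.
  by rewrite ltr_pdivlMr // mul1r; lra.
exists N => n /HN H; apply: le_trans (Hk n).
rewrite expr_div_n ler_pdivlMr ?exprn_gt0 // in H.
by rewrite mulrC ler_pdivrMr // mulrC in H.
Qed.

Lemma exp_growth_upper (R : realType) (c : nat -> nat) (g b : R) :
  0 < g < b -> exp_growth c g -> exists N, forall n, (N <= n)%N -> (c n)%:R <= b ^+ n.
Proof.
move=> /andP[g0 gb] [_ up].
have [|K HK] := up ((b + g) / 2); first by lra.
have h0 : 0 < (b + g) / 2 by lra.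
have [|N HN] := @expr_gt1_unbounded R (b / ((b + g) / 2)) K.
  by rewrite ltr_pdivlMr // mul1r; lra.
exists N => n /HN H; apply: le_trans (HK n) _.
by rewrite expr_div_n ler_pdivlMr ?exprn_gt0 // in H.
Qed.

Lemma growth_rate_of_exp_growth (R : realType) (C : pred (seq nat)) (g : R) :
  0 < g -> exp_growth (class_count C) g -> growth_rate_is C g.
Proof.
move=> g0 Hg; apply/cvgrPdist_le => e e0.
(* The term [g / 2] keeps the lower base positive when [e >= g]. *)
pose a := Num.max (g / 2) (g - e).
have a0 : 0 < a by rewrite lt_max divr_gt0.
have ag : a < g by rewrite gt_max; apply/andP; split; lra.
have [|N1 H1] := exp_growth_lower _ Hg (a := a); first by rewrite a0.
have [|N2 H2] := exp_growth_upper _ Hg (b := g + e); first by rewrite g0 /=; lra.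
(* Index 0 is excluded: the exponent there is the inverse of 0, which is 0. *)
exists (maxn 1 (maxn N1 N2)) => // n /=; rewrite !geq_max => /and3P[n0 n1 n2].
have nn : n%:R != 0 :> R by rewrite pnatr_eq0 -lt0n.
have rootE (x : R) : 0 <= x -> powR (x ^+ n) n%:R^-1 = x.
  by move=> x0; rewrite -powR_mulrn // -powRrM mulfV // powRr1.
have inv0 : 0 <= n%:R^-1 :> R by rewrite invr_ge0.
have mono (x y : R) : 0 <= x -> x <= y -> powR x n%:R^-1 <= powR y n%:R^-1.
  by move=> x0 xy; apply: ge0_ler_powR => //; rewrite nnegrE // (le_trans x0).
have low : a <= powR (class_count C n)%:R n%:R^-1.
  have := mono _ _ (exprn_ge0 n (ltW a0)) (H1 n n1); by rewrite rootE // ltW.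
have up : powR (class_count C n)%:R n%:R^-1 <= g + e.
  have := mono _ _ (ler0n _ _) (H2 n n2); rewrite rootE //; lra.
have : g - e <= a by rewrite le_max lexx orbT.
rewrite ler_norml; move: low up; set u := powR _ _ => low up ae.
by apply/andP; split; lra.
Qed.

(* The binomial transform of [a ^+ n] is [(a + 1) ^+ n]; its largest term carries at least
   the fraction [1 / n.+1] of the sum. *)
Lemma exp_growth_binomial (R : realType) (c c' : nat -> nat) (g : R) : 0 < g ->
  (forall n j, (j <= n)%N -> ('C(n, j) * c j <= c' n)%N) ->
  (forall n, (c' n <= \sum_(j < n.+1) 'C(n, j) * c j)%N) ->
  exp_growth c g -> exp_growth c' (g + 1).
Proof.
move=> g0 low up [cl cu]; split.
  move=> a /andP[a0 ag].
  (* Halfway between max(0, a - 1) and g, so that 0 < a1 < g and a < 1 + a1. *)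
  pose a1 := (Num.max 0 (a - 1) + g) / 2.
  have m0 : 0 <= Num.max 0 (a - 1) by rewrite le_max lexx.
  have ma : a - 1 <= Num.max 0 (a - 1) by rewrite le_max lexx orbT.
  have mg : Num.max 0 (a - 1) < g by rewrite gt_max g0 /=; lra.
  have a1g : 0 < a1 < g by rewrite /a1; apply/andP; split; lra.
  have aa1 : a < 1 + a1 by rewrite /a1; lra.
  have [k k0 Hk] := cl a1 a1g.
  pose d := (1 + a1) / a - 1.
  have d0 : 0 < d by rewrite subr_gt0 ltr_pdivlMr // mul1r.
  (* By Bernoulli the gain (1 + d)^n is at least m(n + 1), which pays for the factor [n.+1] lost by
     bounding each term separately. *)
  pose m := Num.min 1 d.
  have mm0 : 0 < m by rewrite lt_min ltr01.
  exists (k * m); first by rewrite mulr_gt0.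
  move=> n.
  have S : k * (1 + a1) ^+ n <= n.+1%:R * (c' n)%:R.
    rewrite exprDn mulr_sumr.
    apply: (@le_trans _ _ (\sum_(i < n.+1) (c' n)%:R)); last first.
      by rewrite sumr_const card_ord -[leLHS]mulr_natl.
    apply: ler_sum => j _.
    apply: (@le_trans _ _ ('C(n, j) * c j)%:R); last by rewrite ler_nat low // -ltnS.
    rewrite expr1n mul1r -mulr_natl mulrCA natrM ler_wpM2l //; exact: Hk.
  have E : (1 + a1) ^+ n = a ^+ n * (1 + d) ^+ n.
    have -> : 1 + d = (1 + a1) / a by rewrite /d [LHS]addrC subrK.
    by rewrite -exprMn mulrC divfK // gt_eqF.
  have B := bernoulli n (ltW d0).
  have B2 : m * n.+1%:R <= (1 + d) ^+ n.
    apply: le_trans B; have m1 : m <= 1 by rewrite ge_min lexx.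
    have md : m <= d by rewrite ge_min lexx orbT.
    by rewrite -natr1 mulrDr mulr1 addrC mulrC; apply: lerD => //; rewrite ler_wpM2l.
  have an : 0 < a ^+ n by rewrite exprn_gt0.
  have n1 : 0 < n.+1%:R :> R by [].
  rewrite -(ler_pM2l n1); apply: le_trans S.
  rewrite E; have -> : n.+1%:R * (k * m * a ^+ n) = k * (a ^+ n * (m * n.+1%:R)) by ring.
  by rewrite ler_pM2l // ler_pM2l.
move=> b gb; have [|K HK] := cu (b - 1); first by lra.
exists K => n; apply: (@le_trans _ _ (\sum_(j < n.+1) 'C(n, j) * c j)%:R); first by rewrite ler_nat.
have -> : b ^+ n = \sum_(i < n.+1) (b - 1) ^+ i *+ 'C(n, i).
  by rewrite -[b in LHS](subrK 1) addrC exprDn; apply: eq_bigr => i _; rewrite expr1n mul1r.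
rewrite natr_sum mulr_sumr; apply: ler_sum => j _.
by rewrite natrM -[X in K * X]mulr_natl mulrCA; apply: ler_wpM2l.
Qed.

(** * The greedy choice *)

Section WeightedSums.
Variables (R : realType) (u : R).
Hypothesis u0 : 0 < u.

Definition wt (s : seq (seq nat)) : R := \sum_(p <- s) u ^+ size p.

Definition psum (W : pred (seq nat)) N : R := \sum_(n < N) (class_count W n)%:R * u ^+ n.

Lemma wt_ge0 s : 0 <= wt s.
Proof. by apply: sumr_ge0 => p _; rewrite exprn_ge0 // ltW. Qed.

Lemma wt_cat s t : wt (s ++ t) = wt s + wt t.
Proof. by rewrite /wt big_cat. Qed.

Lemma wt_perm s t : perm_eq s t -> wt s = wt t.
Proof. by move=> st; rewrite /wt (perm_big _ st). Qed.

Lemma wt_sub s t : uniq s -> uniq t -> {subset s <= t} -> wt s <= wt t.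
Proof.
move=> us ut st.
have /wt_perm-> : perm_eq t (s ++ [seq p <- t | p \notin s]).
  apply: uniq_perm => //.
    rewrite cat_uniq us filter_uniq // andbT; apply/hasPn => x.
    by rewrite mem_filter => /andP[].
  move=> x; rewrite mem_cat mem_filter; case: (boolP (x \in s)) => //= xs.
  exact: st.
by rewrite wt_cat lerDl wt_ge0.
Qed.

Lemma wt_size s n : (forall p, p \in s -> size p = n) -> wt s = (size s)%:R * u ^+ n.
Proof.
elim: s => [|p s IH] H; rewrite /wt; first by rewrite big_nil mul0r.
rewrite big_cons -/(wt s) IH; last by move=> q qs; apply: H; rewrite inE qs orbT.
by rewrite (H p) ?inE ?eqxx //= -natr1 mulrDl mul1r addrC.
Qed.

Lemma psumS W N : psum W N.+1 = psum W N + (class_count W N)%:R * u ^+ N.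
Proof. by rewrite /psum big_ord_recr. Qed.

Lemma psum_mono W N M : (N <= M)%N -> psum W N <= psum W M.
Proof.
move=> /subnK <-; elim: (M - N)%N => // k; rewrite addSn psumS => /le_trans; apply.
by rewrite lerDl mulr_ge0 // exprn_ge0 // ltW.
Qed.

Lemma psum_sub (V W : pred (seq nat)) N : (forall p, V p -> W p) ->
  psum V N <= psum W N.
Proof.
move=> VW; apply: ler_sum => n _; apply: ler_wpM2r; first by rewrite exprn_ge0 // ltW.
by rewrite ler_nat; apply: sub_count => p; exact: VW.
Qed.

End WeightedSums.

Section Greedy.
Variables (R : realType) (u : R) (D H : pred (seq nat)).
Hypothesis u01 : 0 < u < 1.
Hypothesis dD : downset D.
Hypothesis dH : downset H.
Hypothesis sumD : forall N, psum u D N <= 1.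
Hypothesis sumH : exists N, 1 <= psum u H N.
(* Whatever is rejected at length [n] can be made up for by the longer elements of [G],
   which contain no candidate of length at most [n]. *)
Hypothesis tail : forall q, H q -> ~~ D q -> exists G : seq (seq nat),
  [/\ uniq G,
      forall p, p \in G -> [/\ H p, ~~ D p, (size q < size p)%N &
        forall t, is_perm t -> indecb t -> subperm t p -> (size t <= size q)%N -> D t] &
      u ^+ size q <= wt u G].

Let u0 : 0 < u. Proof. by case/andP: u01. Qed.

Definition admissible (acc : seq (seq nat)) p :=
  `[< forall t, is_perm t -> indecb t -> subperm t p -> t != p -> D t || (t \in acc) >].

(** Fitting under 1 is tested against every partial sum of [D], which stands in for its infinite
    weight. *)
Definition greedy_step (acc : seq (seq nat)) (p : seq nat) :=
  if [&& H p, ~~ D p, admissible acc p &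
         `[< forall N, psum u D N + wt u acc + u ^+ size p <= 1 >]]
  then p :: acc else acc.

(** Stage [n] has treated exactly the lengths below [n], so the fate of [p] is read off at stage
    [(size p).+1]. *)
Fixpoint greedy_acc n :=
  if n is m.+1 then foldl greedy_step (greedy_acc m) (permutations (iota 1 m)) else [::].

Definition greedy_set : pred (seq nat) := fun p => D p || (p \in greedy_acc (size p).+1).

Lemma greedy_foldE acc l : exists new, foldl greedy_step acc l = new ++ acc /\
  {subset new <= l}.
Proof.
elim: l acc => [|p l IH] acc /=; first by exists [::].
have [new [-> sub]] := IH (greedy_step acc p).
rewrite /greedy_step; case: ifP => _.
  exists (rcons new p); rewrite cat_rcons; split=> // x; rewrite mem_rcons !inE.
  by case/orP => [->//|/sub->]; rewrite orbT.
by exists new; split=> // x /sub xl; rewrite inE xl orbT.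
Qed.

Lemma greedy_fold_uniq acc l : uniq acc -> uniq l -> (forall p, p \in l -> p \notin acc) ->
  uniq (foldl greedy_step acc l).
Proof.
elim: l acc => [|p l IH] acc //= ua /andP[pl ul] dis; apply: IH => //.
  by rewrite /greedy_step; case: ifP => //= _; rewrite ua dis // inE eqxx.
move=> x xl; have xa : x \notin acc by apply: dis; rewrite inE xl orbT.
rewrite /greedy_step; case: ifP => // _; rewrite inE negb_or xa andbT.
by apply: contraNneq pl => <-.
Qed.

Lemma greedy_fold_inv acc l :
  (forall p, p \in acc -> [/\ H p, ~~ D p & admissible acc p]) ->
  (forall N, psum u D N + wt u acc <= 1) ->
  (forall p, p \in foldl greedy_step acc l ->
    [/\ H p, ~~ D p & admissible (foldl greedy_step acc l) p]) /\
  (forall N, psum u D N + wt u (foldl greedy_step acc l) <= 1).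
Proof.
elim: l acc => [|p l IH] acc //= I1 I2; apply: IH; rewrite /greedy_step; case: ifP => //.
  move=> /and4P[Hp Dp /asboolP adm _] q; rewrite inE => /orP[/eqP->|].
    split=> //; apply/asboolP => t pt it tp ne.
    by case/orP: (adm t pt it tp ne) => [->//|ta]; rewrite inE ta !orbT.
  move=> /I1[Hq Dq /asboolP admq]; split=> //; apply/asboolP => t pt it tq ne.
  by case/orP: (admq t pt it tq ne) => [->//|ta]; rewrite inE ta !orbT.
move=> /and4P[_ _ _ /asboolP ok] N.
by rewrite /wt big_cons -/(wt u acc) addrCA addrC; exact: ok.
Qed.

(** The accepted weight only grows, so a [p] that did not fit when examined does not fit at the end
    of the pass either. *)
Lemma greedy_fold_reject acc l p : p \in l -> H p -> ~~ D p -> admissible acc p ->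
  p \notin foldl greedy_step acc l ->
  exists N, 1 < psum u D N + wt u (foldl greedy_step acc l) + u ^+ size p.
Proof.
elim: l acc => // q l IH acc; rewrite inE => /predU1P[<-|pl] Hp Dp adm /=.
  have [new [-> _]] := greedy_foldE (greedy_step acc p) l.
  rewrite mem_cat negb_or => /andP[_]; rewrite /greedy_step Hp Dp adm /=.
  case: ifP => [_|/asboolPn]; first by rewrite inE eqxx.
  move=> /existsNP[N /negP]; rewrite -ltNge => lt1 _; exists N.
  apply: lt_le_trans lt1 _; rewrite lerD2r lerD2l wt_cat lerDr.
  exact: wt_ge0.
apply: IH => //; rewrite /greedy_step; case: ifP => // _.
move/asboolP: adm => adm; apply/asboolP => t pt it tp ne.
by case/orP: (adm t pt it tp ne) => [->//|ta]; rewrite inE ta !orbT.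
Qed.

Lemma greedy_acc_size n p : p \in greedy_acc n -> is_perm p /\ (size p < n)%N.
Proof.
elim: n => //= n IH; have [new [-> sub]] := greedy_foldE (greedy_acc n) (permutations (iota 1 n)).
rewrite mem_cat => /orP[/sub/mem_permutations_iota[pp ->]//|/IH[pp lt]].
by split=> //; exact: ltnW.
Qed.

Lemma greedy_acc_mono n m : (n <= m)%N -> {subset greedy_acc n <= greedy_acc m}.
Proof.
move=> /subnK <-; elim: (m - n)%N => // k IH p /IH; rewrite addSn /=.
have [new [-> _]] := greedy_foldE (greedy_acc (k + n)) (permutations (iota 1 (k + n))).
by rewrite mem_cat orbC => ->.
Qed.

Lemma greedy_acc_low n p : p \in greedy_acc n -> p \in greedy_acc (size p).+1.
Proof.
elim: n => //= n IH; have [new [E sub]] := greedy_foldE (greedy_acc n) (permutations (iota 1 n)).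
rewrite E mem_cat => /orP[pn|/IH//].
by have /sub/mem_permutations_iota[_ ->] := pn; rewrite /= E mem_cat pn.
Qed.

Lemma greedy_accP n :
  (forall p, p \in greedy_acc n -> [/\ H p, ~~ D p & admissible (greedy_acc n) p]) /\
  (forall N, psum u D N + wt u (greedy_acc n) <= 1).
Proof.
elim: n => /= [|n [I1 I2]]; last exact: greedy_fold_inv.
by split=> // N; rewrite /wt big_nil addr0.
Qed.

Lemma greedy_acc_uniq n : uniq (greedy_acc n).
Proof.
elim: n => //= n IH; apply: greedy_fold_uniq => //; first exact: permutations_uniq.
move=> p /mem_permutations_iota[_ sp]; apply/negP => /greedy_acc_size[_].
by rewrite sp ltnn.
Qed.

Lemma downset_greedy : downset greedy_set.
Proof.
split=> [s /orP[/dD.1//|]|s t /orP[Ds|]].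
- by move=> sa; have [/dH.1] := (greedy_accP _).1 s sa.
- by move=> pt it ts; apply/orP; left; exact: dD.2 Ds pt it ts.
move=> sa pt it ts; have [-> |ne] := eqVneq t s; first by rewrite /greedy_set sa orbT.
have [_ _ /asboolP adm] := (greedy_accP _).1 s sa.
by rewrite /greedy_set; case/orP: (adm t pt it ts ne) => [->//|/greedy_acc_low->]; rewrite orbT.
Qed.

Lemma psum_greedy N : psum u greedy_set N = psum u D N + wt u (greedy_acc N).
Proof.
elim: N => [|N IH]; first by rewrite /psum !big_ord0 /wt big_nil addr0.
rewrite !psumS IH -!addrA; congr (_ + _).
have -> : (class_count greedy_set N =
    class_count D N + size [seq p <- permutations (iota 1 N) | p \in greedy_acc N.+1])%N.
  rewrite size_filter /class_count -count_predUI [X in (_ + X)%N](_ : _ = 0)%N ?addn0.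
    apply: eq_in_count => p /mem_permutations_iota[_ sp] /=.
    by rewrite /greedy_set sp.
  apply/eqP; rewrite -leqn0 leqNgt -has_count; apply/hasPn => p _ /=.
  by apply/negP => /andP[Dp pN]; have [_] := (greedy_accP N.+1).1 p pN; rewrite Dp.
rewrite natrD mulrDl addrCA; congr (_ + _).
rewrite -(@wt_size _ u _ N); last first.
  by move=> p; rewrite mem_filter => /andP[_ /mem_permutations_iota[]].
rewrite -wt_cat; apply: wt_perm; apply: uniq_perm.
- rewrite cat_uniq greedy_acc_uniq filter_uniq ?permutations_uniq // andbT.
  apply/hasPn => p; rewrite mem_filter => /andP[_ /mem_permutations_iota[_ sp]].
  by apply/negP => /greedy_acc_size[_]; rewrite sp ltnn.
- exact: greedy_acc_uniq N.+1.
move=> p; rewrite mem_cat mem_filter; apply/idP/idP.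
  by case/orP => [/(greedy_acc_mono (leqnSn N))//|/andP[]].
move=> pN; rewrite pN /=; have [pp] := greedy_acc_size pN; rewrite ltnS leq_eqVlt.
case/orP => [/eqP sp|lt].
  by apply/orP; right; apply/mem_permutations_iota.
by rewrite (greedy_acc_mono lt) // (greedy_acc_low pN).
Qed.

Definition rejected n := exists p,
  [/\ is_perm p, size p = n, H p, ~~ D p & admissible (greedy_acc n) p /\ p \notin greedy_acc n.+1].

Lemma rejected_sum n : rejected n -> exists N, 1 < psum u D N + wt u (greedy_acc n.+1) + u ^+ n.
Proof.
move=> [p [pp sp Hp Dp [adm pN]]]; rewrite -[in u ^+ n]sp.
by apply: greedy_fold_reject => //; apply/mem_permutations_iota.
Qed.

Lemma not_rejected p : H p -> (forall t, is_perm t -> indecb t -> subperm t p -> t != p ->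
  greedy_set t) -> ~ rejected (size p) -> greedy_set p.
Proof.
move=> Hp subs nrej; rewrite /greedy_set; case: (boolP (D p)) => //= Dp.
apply: contra_notT nrej => pN; exists p; split=> //; first by have [] := dH.1 p Hp.
split=> //; apply/asboolP => t pt it tp ne.
have /orP[->//|ta] := subs t pt it tp ne.
apply/orP; right; apply: (greedy_acc_mono _ ta).
rewrite ltn_neqAle subperm_size // andbT; apply: contraNneq ne => sz.
by apply/eqP/subperm_iso => //; have [] := dH.1 p Hp.
Qed.

Lemma wt_greedy_mono n m : (n <= m)%N -> wt u (greedy_acc n) <= wt u (greedy_acc m).
Proof. by move=> nm; apply: wt_sub; rewrite ?greedy_acc_uniq //; exact: greedy_acc_mono. Qed.

Lemma greedy_sum_le1 N : psum u greedy_set N <= 1.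
Proof. by rewrite psum_greedy; exact: (greedy_accP N).2. Qed.

(** A permanent gap [e] allows rejections only at lengths with u^n > e, hence finitely many. With
    none, all of [H] is accepted, against [sumH]. Otherwise take the last rejected length [n]: all
    of [G] is accepted later and weighs at least u^n, which was already too much for the remaining
    room. *)
Lemma greedy_sum_lim e : 0 < e -> exists N, 1 - e < psum u greedy_set N.
Proof.
move=> e0; apply: contrapT => /forallNP no.
have bound N M : psum u D N + wt u (greedy_acc M) <= 1 - e.
  have := no (maxn N M); rewrite psum_greedy => /negP; rewrite -leNgt; apply: le_trans.
  by apply: lerD; [apply: psum_mono => //; exact: leq_maxl|apply: wt_greedy_mono; exact: leq_maxr].
have rej_e n : rejected n -> e < u ^+ n.
  by move=> /rejected_sum[N]; have := bound N n.+1; lra.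
have [n0 Hn0] : exists n0, forall n, (n0 <= n)%N -> u ^+ n <= e.
  have /andP[_ u1] := u01.
  have [|n0 Hn0] := @expr_gt1_unbounded R u^-1 e^-1; first by rewrite invf_gt1.
  exists n0 => n /Hn0; rewrite exprVn lef_pV2 //; rewrite posrE ?exprn_gt0 //.
have rej_bound n : rejected n -> (n <= n0)%N.
  move=> /rej_e lt; rewrite leqNgt; apply/negP => /ltnW/Hn0.
  by rewrite leNgt lt.
have [norej|/existsNP] := pselect (forall n, ~ rejected n).
  have all_in : forall p, H p -> greedy_set p.
    move=> p; move: {2}(size p) (leqnn (size p)) => k.
    elim: k p => [|k IH] p sp Hp.
      by have := indec_size (dH.1 p Hp).2; rewrite leqn0 in sp; rewrite (eqP sp).
    apply: not_rejected => // t pt it tp ne; apply: IH; last exact: dH.2 Hp pt it tp.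
    rewrite -ltnS; apply: leq_trans sp; rewrite ltn_neqAle subperm_size // andbT.
    apply: contraNneq ne => sz; apply/eqP/subperm_iso => //; by have [] := dH.1 p Hp.
  have [N HN] := sumH; have /negP := no N; rewrite -leNgt.
  have : psum u H N <= psum u greedy_set N by exact: psum_sub.
  lra.
move=> [n1 /contrapT rej1].
pose P n := `[< rejected n >].
have exP : exists n, P n by exists n1; apply/asboolP.
have bP n : P n -> (n <= n0)%N by move/asboolP; exact: rej_bound.
case: (ex_maxnP exP bP) => n /asboolP rejn maxn_.
have [q [pq sq Hq Dq _]] := rejn.
have [G [uG HG sumG]] := tail Hq Dq; rewrite sq in HG sumG.
(* Parts of length at most [n] are in [D]. A longer part is a candidate whose own proper parts are
   in by induction, and its length sees no rejection. *)
have Gin p t : p \in G -> is_perm t -> indecb t -> subperm t p -> greedy_set t.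
  move=> pG; have [Hp _ _ low] := HG p pG.
  move: {2}(size t) (leqnn (size t)) => k; elim: k t => [|k IH] t st pt it tp.
    by have := indec_size it; rewrite leqn0 in st; rewrite (eqP st).
  case: (leqP (size t) n) => [tn|nt]; first by rewrite /greedy_set low.
  apply: not_rejected; first exact: dH.2 Hp pt it tp.
    move=> r pr ir rt ne; apply: IH => //; last exact: subperm_trans rt tp.
    rewrite -ltnS; apply: leq_trans st; rewrite ltn_neqAle subperm_size // andbT.
    by apply: contraNneq ne => sz; apply/eqP/subperm_iso.
  by move=> /asboolP/maxn_; rewrite leqNgt nt.
have [N HN] := rejected_sum rejn.
pose M := maxn n.+1 (\max_(p <- G) (size p).+1).
have : wt u (G ++ greedy_acc n.+1) <= wt u (greedy_acc M).
  apply: wt_sub => //; rewrite ?greedy_acc_uniq //.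
    rewrite cat_uniq uG greedy_acc_uniq andbT; apply/hasPn => p /greedy_acc_size[_ lt].
    by apply/negP => /HG[_ _ lt' _]; rewrite ltnS leqNgt lt' in lt.
  move=> p; rewrite mem_cat => /orP[pG|pn]; last by apply: greedy_acc_mono pn; exact: leq_maxl.
  have [Hp Dp _ _] := HG p pG; have [pp ip] := dH.1 p Hp.
  have := Gin p p pG pp ip (subperm_refl p); rewrite /greedy_set (negbTE Dp) orFb.
  apply: greedy_acc_mono; apply: leq_trans (leq_maxr _ _).
  by rewrite (big_rem p) //= leq_maxl.
rewrite wt_cat; have := bound N M; lra.
Qed.

End Greedy.

(** * Numerical evaluation of weights *)

Lemma psum_le1 (R : realType) (u : R) W (l : seq nat) c : 0 < u < 1 ->
  (forall n, (class_count W n <= nth c l n)%N) ->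
  \sum_(i < size l) (nth c l i)%:R * u ^+ i + c%:R * u ^+ size l / (1 - u) <= 1 ->
  forall N, psum u W N <= 1.
Proof.
move=> /andP[u0 u1] Hl H1.
have d0 : 0 < 1 - u by rewrite subr_gt0.
(* Beyond the list, moving one term from the geometric tail into the sum leaves the total
   unchanged. *)
have H N : \sum_(i < size l + N) (nth c l i)%:R * u ^+ i + c%:R * u ^+ (size l + N) / (1 - u) <= 1.
  elim: N => [|N IH]; first by rewrite addn0.
  apply: le_trans IH; rewrite addnS big_ord_recr /= -addrA lerD2l.
  rewrite nth_default ?leq_addr // exprS.
  rewrite -subr_ge0; set x := c%:R * u ^+ (size l + N).
  have -> : x / (1 - u) - (x + c%:R * (u * u ^+ (size l + N)) / (1 - u)) = 0.
    by rewrite /x; field; rewrite gt_eqF.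
  by [].
move=> N; apply: le_trans (psum_mono u0 W (leq_addl (size l) N)) _.
apply: le_trans (H N); rewrite -[leLHS]addr0; apply: lerD.
  apply: ler_sum => i _; apply: ler_wpM2r; first by rewrite exprn_ge0 // ltW.
  by rewrite ler_nat.
by rewrite divr_ge0 ?mulr_ge0 ?exprn_ge0 // ltW.
Qed.

(* Horner evaluation with tail [t]: at rational [u] it unfolds to something [lra] decides. *)
Fixpoint hor (R : realType) (u : R) (l : seq nat) (t : R) : R :=
  if l is c :: l' then c%:R + u * hor u l' t else t.

Lemma horE (R : realType) (u : R) l d t :
  hor u l t = \sum_(i < size l) (nth d l i)%:R * u ^+ i + u ^+ size l * t.
Proof.
elim: l => [|c l IH] /=; first by rewrite big_ord0 add0r mul1r.
rewrite big_ord_recl IH mulrDr mulr_sumr expr0 mulr1 -addrA exprS mulrA.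
by congr (_ + (_ + _)); apply: eq_bigr => i _; rewrite exprS mulrCA.
Qed.

Lemma hor_ge0 (R : realType) (u : R) l t : 0 <= u -> 0 <= t -> 0 <= hor u l t.
Proof. by move=> u0 t0; elim: l => //= c l IH; rewrite addr_ge0 // mulr_ge0. Qed.

Lemma hor_le (R : realType) (u q : R) l t s : 0 <= u <= q -> 0 <= t <= s -> hor u l t <= hor q l s.
Proof.
move=> /andP[u0 uq] /andP[t0 ts]; elim: l => //= c l IH; rewrite lerD2l.
by apply: ler_pM => //; exact: hor_ge0.
Qed.

(** All coefficients are nonnegative, so the right end [q] of the range is the worst case; [s] is a
    rational bound for the geometric tail c/(1 - q). *)
Lemma hor_psum_le1 (R : realType) (u q s : R) W (l : seq nat) c : 0 < u <= q -> q < 1 ->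
  (forall n, (class_count W n <= nth c l n)%N) -> c%:R <= s * (1 - q) -> hor q l s <= 1 ->
  forall N, psum u W N <= 1.
Proof.
move=> /andP[u0 uq] q1 Hl Hs Hq; apply: (@psum_le1 _ u W l c) => //.
  by rewrite u0 (le_lt_trans uq).
have u1 : 0 < 1 - u by rewrite subr_gt0 (le_lt_trans uq).
have q1' : 0 < 1 - q by rewrite subr_gt0.
apply: le_trans Hq; rewrite mulrAC [_ * u ^+ _]mulrC -horE; apply: hor_le; first by rewrite ltW.
rewrite divr_ge0 ?(ltW u1) //=; apply: (@le_trans _ _ (c%:R / (1 - q))).
  by apply: ler_wpM2l => //; rewrite lef_pV2 ?posrE // lerD2l lerN2.
by rewrite ler_pdivrMr.
Qed.

Lemma hor_psum_ge1 (R : realType) (u q : R) W (l : seq nat) : 0 < q <= u ->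
  (forall n, (n < size l)%N -> (nth 0 l n <= class_count W n)%N) -> 1 <= hor q l 0 ->
  exists N, 1 <= psum u W N.
Proof.
move=> /andP[q0 qu] Hl Hq; exists (size l); apply: le_trans Hq _.
apply: (@le_trans _ _ (hor u l 0)).
  by apply: hor_le; rewrite ?lexx // (ltW q0).
rewrite (horE _ _ 0%N) mulr0 addr0; apply: ler_sum => i _; apply: ler_wpM2r.
  by rewrite exprn_ge0 // (le_trans (ltW q0)).
by rewrite ler_nat Hl.
Qed.

Lemma class_of_greedy (R : realType) (g : R) (D H : pred (seq nat)) : 1 < g ->
  downset D -> downset H -> D [:: 1%N] ->
  (forall N, psum g^-1 D N <= 1) -> (exists N, 1 <= psum g^-1 H N) ->
  (forall q, H q -> ~~ D q -> exists G : seq (seq nat),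
    [/\ uniq G,
        forall p, p \in G -> [/\ H p, ~~ D p, (size q < size p)%N &
          forall t, is_perm t -> indecb t -> subperm t p -> (size t <= size q)%N -> D t] &
        g^-1 ^+ size q <= wt g^-1 G]) ->
  exists C : pred (seq nat), perm_class C /\ exp_growth (class_count C) g.
Proof.
move=> g1 dD dH D1 sD sH tl.
have g0 : 0 < g by exact: lt_trans ltr01 g1.
have u01 : 0 < g^-1 < 1 by rewrite invr_gt0 g0 invf_lt1.
pose W := greedy_set g^-1 D H.
have dW : downset W by exact: downset_greedy.
have E N : \sum_(k < N) (class_count W k.+1)%:R * g^-1 ^+ k.+1 = psum g^-1 W N.+1.
  by rewrite /psum big_ord_recl class_count0 // mul0r add0r.
exists (sumclass W); split; first exact: perm_class_sumclass.
apply: (@renewal_growth R (class_count W)) => //.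
- exact: class_count_sumclass0.
- by move=> n; exact: class_count_sumclass.
- rewrite /class_count -has_count; apply/hasP; exists [:: 1%N].
    by apply/mem_permutations_iota.
  by rewrite /W /greedy_set D1.
- by move=> N; rewrite E; exact: greedy_sum_le1.
move=> e e0; have [N HN] := greedy_sum_lim u01 dH sD sH tl e0.
by exists N; rewrite E; apply: lt_le_trans HN _; apply: psum_mono => //; case/andP: u01.
Qed.

(** * Growth rates between 337/143 and 625/262 *)

Section LowerRange.
Variables (R : realType) (u : R).
Hypothesis u_low : 262 / 625 <= u.
Hypothesis u_up : u <= 143 / 337.

Let u0 : 0 < u. Proof. by move: u_low; lra. Qed.

Lemma lowD_sum N : psum u lowD N <= 1.
Proof.
(* The tail constant 3127/200 slightly exceeds 9/(1 - 143/337). *)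
apply: (@hor_psum_le1 _ u (143 / 337) (3127 / 200) lowD [:: 0; 1; 1; 2; 3; 5; 7; 8; 8]%N 9).
- by rewrite u0.
- lra.
- exact: lowD_count.
- lra.
- rewrite /hor; lra.
Qed.

Lemma lowH_sum : exists N, 1 <= psum u lowH N.
Proof.
apply: (@hor_psum_ge1 _ u (262 / 625) lowH [:: 0; 1; 1; 2; 3; 5; 8; 13; 21; 34]%N).
- by rewrite u_low andbT; lra.
- by move=> n; exact: lowH_fib.
- rewrite /hor; lra.
Qed.

Lemma wt_dperm (s : seq (seq nat)) : {in s, forall d, dvalid d} ->
  wt u (map dperm s) = \sum_(d <- s) u ^+ (sumn d).+1.
Proof.
by move=> vs; rewrite /wt big_map; apply: eq_big_seq => d /vs v; rewrite size_dperm.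
Qed.

Lemma low_tail q : lowH q -> ~~ lowD q -> exists G : seq (seq nat),
  [/\ uniq G,
      forall p, p \in G -> [/\ lowH p, ~~ lowD p, (size q < size p)%N &
        forall t, is_perm t -> indecb t -> subperm t p -> (size t <= size q)%N -> lowD t] &
      u ^+ size q <= wt u G].
Proof.
move=> Hq nD; have q5 := lowH_size Hq nD; set n := size q in q5 *.
have mk (s : seq (seq nat)) : uniq s -> (forall d, d \in s -> dvalid d /\ free_at n (dperm d)) ->
    u ^+ n <= \sum_(d <- s) u ^+ (sumn d).+1 ->
    exists G : seq (seq nat), [/\ uniq G, forall p, p \in G -> free_at n p & u ^+ n <= wt u G].
  move=> us fs le; exists (map dperm s); split.
  - rewrite map_inj_in_uniq // => d d' ds d's; apply: dperm_inj; first by case: (fs d ds).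
    by case: (fs d' d's).
  - by move=> p /mapP[d ds ->]; case: (fs d ds).
  by rewrite wt_dperm // => d /fs[].
have u2 : 7 / 40 <= u ^+ 2.
  have : 0 <= (u - 262 / 625) * (u + 262 / 625) by apply: mulr_ge0; move: u_low; lra.
  by rewrite expr2; lra.
have u1 := ltW u0.
case: (ltngtP n 6) => [lt|n7|e]; first by rewrite ltnS leqNgt q5 in lt.
- case: (ltngtP n 7) => [lt|n8|e].
  + by rewrite ltnS leqNgt n7 in lt.
  (* The [N] with 2N + 6 <= n < 2N + 8; it is positive since n >= 8. *)
  + pose N := (n./2 - 3)%N.
    have h4 : (4 <= n./2)%N by rewrite -[4%N]/(8./2)%N half_leq.
    have eN : (N.*2 = n./2.*2 - 6)%N by rewrite /N doubleB.
    have nN : n = (odd n + N.*2 + 6)%N.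
      rewrite eN -addnA subnK ?odd_double_half //.
      by rewrite -[6%N]/(3.*2)%N leq_double (leq_trans _ h4).
    have N0 : (0 < N)%N by rewrite subn_gt0.
    apply: (mk (tail_words N)); first exact: tail_words_uniq.
      move=> d; apply: tail_words_free => //.
      by rewrite [X in (X < _)%N]nN addnAC -addSn leq_add2r; case: (odd n).
    rewrite big_cat !big_map !big_cons !big_nil !sumn_word /= doubleS.
    have -> : u ^+ n = u ^+ (N.*2) * u ^+ (odd n + 6) by rewrite {1}nN -exprD addnAC addnC.
    have H6 : u ^+ (odd n + 6) <= u ^+ 6.
      by apply: ler_wiXn2l => //; [move: u_up; lra|case: (odd n)].
    have uN : 0 <= u ^+ N.*2 by rewrite exprn_ge0.
    apply: le_trans (ler_wpM2l uN H6) _.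
    (* Four words of each of four consecutive lengths. Relative to u^6 the right side increases with
       [u], so the left end of the range decides. *)
    have key : u ^+ 6 <= 4 * u ^+ 8 + 4 * u ^+ 9 + 4 * u ^+ 10 + 4 * u ^+ 11.
      have -> : 4 * u ^+ 8 + 4 * u ^+ 9 + 4 * u ^+ 10 + 4 * u ^+ 11 =
        u ^+ 6 * (4 * u ^+ 2 * (1 + u) * (1 + u ^+ 2)) by ring.
      rewrite -[leLHS]mulr1; apply: ler_wpM2l; first by rewrite exprn_ge0.
      apply: (@le_trans _ _ (4 * (7 / 40) * (1 + 262 / 625) * (1 + 7 / 40))); first lra.
      by apply: ler_pM; [lra|lra|apply: ler_pM; [lra|lra|lra|move: u_low; lra]|lra].
    apply: le_trans (ler_wpM2l uN key) _.
    by rewrite le_eqVlt; apply/orP; left; apply/eqP; rewrite !exprS; ring.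
  apply: (mk words7) => [//|d|]; first by rewrite e; exact: words7_free.
  rewrite e !big_cons big_nil /=.
  have -> : u ^+ 8 + (u ^+ 9 + (u ^+ 9 + (u ^+ 10 + (u ^+ 10 + (u ^+ 10 + (u ^+ 10 + (u ^+ 10 +
    (u ^+ 10 + (u ^+ 10 + 0))))))))) = u ^+ 7 * (u + 2 * u ^+ 2 + 7 * (u * u ^+ 2)) by ring.
  rewrite -[leLHS]mulr1; apply: ler_wpM2l; first by rewrite exprn_ge0.
  have : (262 / 625) * (7 / 40) <= u * u ^+ 2 by apply: ler_pM; move: u_low; lra.
  move: u_low; lra.
apply: (mk words6) => [//|d|]; first by rewrite e; exact: words6_free.
rewrite e !big_cons big_nil /=.
have -> : u ^+ 7 + (u ^+ 7 + (u ^+ 8 + (u ^+ 8 + (u ^+ 8 + 0)))) = u ^+ 6 * (2 * u + 3 * u ^+ 2) by ring.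
rewrite -[leLHS]mulr1; apply: ler_wpM2l; first by rewrite exprn_ge0.
by move: u_low; lra.
Qed.

Lemma lower_range : exists C : pred (seq nat), perm_class C /\ exp_growth (class_count C) u^-1.
Proof.
apply: (@class_of_greedy R u^-1 lowD lowH); rewrite ?invrK.
- by rewrite invf_gt1 //; move: u_up; lra.
- exact: downset_lowD.
- exact: downset_lowH.
- by apply/asboolP; left.
- exact: lowD_sum.
- exact: lowH_sum.
- exact: low_tail.
Qed.

End LowerRange.

(** * Growth rates between 625/262 and 84/25 *)

Section UpperRange.
Variables (R : realType) (u : R).
Hypothesis u_low : 25 / 84 <= u.
Hypothesis u_up : u <= 262 / 625.

Let u0 : 0 < u. Proof. by move: u_low; lra. Qed.
Let u1 : 0 <= u. Proof. exact: ltW. Qed.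

Lemma wt_fork_words Is N : wt u (map catp (fork_words Is N)) =
  u ^+ N.+3 * (2 * (1 + u + u ^+ 2) * \sum_(i <- Is) u ^+ i).
Proof.
have -> : wt u (map catp (fork_words Is N)) = \sum_(s <- [:: true; false]) \sum_(i <- Is)
    \sum_(m <- [:: N; N.+1; N.+2]) u ^+ size (catp (fork s i m 2)).
  rewrite /wt !big_map big_allpairs_dep; apply: eq_bigr => s _.
  by rewrite big_allpairs_dep; apply: eq_bigr.
have H s : \sum_(i <- Is) \sum_(m <- [:: N; N.+1; N.+2]) u ^+ size (catp (fork s i m 2)) =
    u ^+ N.+3 * ((1 + u + u ^+ 2) * \sum_(i <- Is) u ^+ i).
  rewrite !mulr_sumr; apply: eq_bigr => i _.
  by rewrite !big_cons big_nil !size_catp !size_fork !addn2 !addnS !exprS exprD; ring.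
by rewrite !big_cons big_nil !H; ring.
Qed.

Definition free_family (D : pred (seq nat)) n := exists G : seq (seq nat),
  [/\ uniq G, forall p, p \in G -> free_over D n p & u ^+ n <= wt u G].

Lemma free_family_forks (D : pred (seq nat)) Is n : (4 < n)%N -> uniq Is ->
  {in Is, forall i, 2 < i}%N ->
  (forall N s i m, i \in Is -> (N <= m)%N -> (n < 6 + N)%N -> free_over D n (catp (fork s i m 2))) ->
  1 <= 2 * (1 + u + u ^+ 2) * \sum_(i <- Is) u ^+ (i - 2) ->
  free_family D n.
Proof.
(* The least [N] with [n < 6 + N] is [n - 5]. *)
move=> n5 uI I2 H le; exists (map catp (fork_words Is (n - 5))); split.
- exact: fork_words_uniq.
- move=> p /mapP[w /fork_wordsP[s [i [m [iI Nm ->]]]] ->].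
  by apply: (H _ _ _ _ iI Nm); rewrite -[6%N]/(1 + 5)%N -addnA subnKC.
rewrite wt_fork_words.
have -> : \sum_(i <- Is) u ^+ i = u ^+ 2 * \sum_(i <- Is) u ^+ (i - 2).
  by rewrite mulr_sumr; apply: eq_big_seq => i /I2 i2; rewrite -exprD subnKC // ltnW.
have -> : u ^+ (n - 5).+3 * (2 * (1 + u + u ^+ 2) * (u ^+ 2 * \sum_(i <- Is) u ^+ (i - 2))) =
   u ^+ n * (2 * (1 + u + u ^+ 2) * \sum_(i <- Is) u ^+ (i - 2)).
  rewrite -{2}(subnK n5) exprD !exprS expr0; ring.
by rewrite -[leLHS]mulr1; apply: ler_wpM2l => //; rewrite exprn_ge0.
Qed.

Lemma upper2_range : u <= 10 / 29 ->
  exists C : pred (seq nat), perm_class C /\ exp_growth (class_count C) u^-1.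
Proof.
move=> u_up2; apply: (@class_of_greedy R u^-1 forkD4 allD); rewrite ?invrK.
- by rewrite invf_gt1 //; move: u_up; lra.
- exact: downset_forkD4.
- exact: downset_allD.
- by apply/orP; left; apply/asboolP; exact: FPoint.
(* The tail constant 232/19 equals 8/(1 - 10/29). *)
- apply: (@hor_psum_le1 _ u (10 / 29) (232 / 19) forkD4 [:: 0; 1; 1; 3; 13]%N 8).
  + by rewrite u0.
  + lra.
  + exact: count_forkD4_le.
  + lra.
  + rewrite /hor; lra.
- apply: (@hor_psum_ge1 _ u (25 / 84) allD [:: 0; 1; 1; 3; 13; 71; 461]%N).
  + by rewrite u_low andbT; lra.
  + by move=> n /count_allD_small->.
  + rewrite /hor; lra.
move=> q Hq; rewrite /forkD4 negb_or Hq /= -ltnNge => /andP[_ q5].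
(* Both fork sizes are needed: near u = 25/84 the forks with [i = 3] alone give only 2(u + u^2 +
   u^3) < 1 times u^n. *)
apply: (@free_family_forks forkD4 [:: 3; 4]%N) => //.
- by move=> i; rewrite !inE => /orP[] /eqP->.
- by move=> N s i m; rewrite !inE => /orP[] /eqP-> Nm nN; apply: (fork_free4 _ _ _ Nm nN) => //; exact: ltnW.
rewrite !big_cons big_nil /= addr0.
have : 25 / 84 * (25 / 84) <= u * u by apply: ler_pM; move: u_low; lra.
rewrite -expr2 => u2; have : 25 / 84 * (25 / 84 * (25 / 84)) <= u * u ^+ 2.
  by apply: ler_pM; move: u_low; lra.
have : 0 <= u ^+ 4 by rewrite exprn_ge0.
by move: u_low u2; rewrite !exprS expr0; nra.
Qed.

Lemma upper1_range : 10 / 29 <= u ->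
  exists C : pred (seq nat), perm_class C /\ exp_growth (class_count C) u^-1.
Proof.
move=> u_low1; apply: (@class_of_greedy R u^-1 (forkD 3) allD); rewrite ?invrK.
- by rewrite invf_gt1 //; move: u_up; lra.
- exact: downset_forkD.
- exact: downset_allD.
- by apply/asboolP; exact: FPoint.
(* The tail constant 3750/363 equals 6/(1 - 262/625). *)
- apply: (@hor_psum_le1 _ u (262 / 625) (3750 / 363) (forkD 3) [:: 0; 1; 1; 2; 4]%N 6).
  + by rewrite u0.
  + lra.
  + exact: count_forkD3.
  + lra.
  + rewrite /hor; lra.
- apply: (@hor_psum_ge1 _ u (25 / 84) allD [:: 0; 1; 1; 3; 13; 71; 461]%N).
  + by rewrite u_low andbT; lra.
  + by move=> n /count_allD_small->.
  + rewrite /hor; lra.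
have u2 : 59 / 500 <= u ^+ 2.
  have : 0 <= (u - 10 / 29) * (u + 10 / 29) by apply: mulr_ge0; move: u_low1; lra.
  by rewrite expr2; lra.
have u3 : 10 / 29 * (59 / 500) <= u ^+ 3 by rewrite exprS; apply: ler_pM; move: u_low1; lra.
(* The weight of the forks with [i = 3] relative to u^n, only about 1.009 at u = 10/29: this
   determines the break point. *)
have key : 1 <= 2 * (u + u ^+ 2 + u ^+ 3) by move: u_low1; lra.
move=> q Hq nD; move: (Hq) => /allDP[pq iq]; rewrite -/(free_family (forkD 3) (size q)).
have q2 : (2 < size q)%N.
  rewrite ltnNge; apply: contraNN nD => q2; apply: forkD3_small => //; first exact: leqW.
  by apply: contraTneq q2 => ->.
case: (ltngtP (size q) 3) => [|q3|e]; first by rewrite ltnS leqNgt q2.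
  case: (ltngtP (size q) 4) => [|q4|e]; first by rewrite ltnS leqNgt q3.
    apply: (@free_family_forks _ [:: 3]%N) => //.
    - by move=> i; rewrite inE => /eqP->.
    - by move=> N s i m; rewrite !inE => /eqP-> Nm nN; exact: (fork_free _ _ _ Nm nN).
    by rewrite !big_cons big_nil /= addr0; move: key; rewrite !exprS expr0; lra.
  (* At n = 4 the spine length n - 5 would be negative. Starting at 0 costs a factor [u], and the
     two stars of length 5 make up for it. *)
  rewrite e; exists (catp (star true 4) :: catp (star false 4) :: map catp (fork_words [:: 3]%N 0)).
  have ne s : catp (star s 4) \notin map catp (fork_words [:: 3]%N 0).
    apply/negP => /mapP[w /fork_wordsP[s' [i [m [+ _ ->]]]] /(congr1 size)].
    rewrite inE !size_catp size_star size_fork => /eqP-> /eqP.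
    by rewrite addn2 !addSn !eqSS.
  split.
  - have uF : uniq (map catp (fork_words [:: 3]%N 0)).
      by apply: fork_words_uniq => // i; rewrite inE => /eqP->.
    rewrite 2!cons_uniq uF inE negb_or !ne !andbT.
    by vm_compute.
  - move=> p; rewrite 2!in_cons => /or3P[/eqP->|/eqP->|]; [exact: star_free|exact: star_free|].
    move=> /mapP[w /fork_wordsP[s [i [m [+ Nm ->]]]] ->]; rewrite inE => /eqP->.
    exact: (fork_free _ _ _ Nm).
  rewrite -[_ :: _]/([:: _; _] ++ _) wt_cat wt_fork_words /wt !big_cons !big_nil !size_catp !size_star.
  have -> : u ^+ 5 + (u ^+ 5 + 0) + u ^+ 3 * (2 * (1 + u + u ^+ 2) * (u ^+ 3 + 0)) =
    u ^+ 4 * (2 * (u + u ^+ 2 + u ^+ 3 + u ^+ 4)) by ring.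
  have u4 : 0 <= u ^+ 4 by rewrite exprn_ge0.
  by rewrite -[leLHS]mulr1; apply: ler_wpM2l => //; move: key; lra.
(* At length 3 the only rejected permutation is [3; 2; 1], so the compensators just have to avoid
   it. *)
rewrite e; exists perms3; split; first by vm_compute.
  exact: perms3_free.
rewrite /wt !big_cons big_nil /=.
have -> : u ^+ 4 + (u ^+ 5 + (u ^+ 5 + (u ^+ 5 + (u ^+ 5 + (u ^+ 5 + (u ^+ 5 + (u ^+ 5 + (u ^+ 5 + 0)))))))) = u ^+ 3 * (u + 8 * u ^+ 2) by ring.
rewrite -[leLHS]mulr1; apply: ler_wpM2l; first by rewrite exprn_ge0.
by move: u_low1; lra.
Qed.

End UpperRange.

(** * All growth rates from the root on *)

Definition attained (R : realType) (g : R) :=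
  exists C : pred (seq nat), perm_class C /\ exp_growth (class_count C) g.

(* The break points are rationals at which the weights of the families involved lie on the
   required sides of 1; they satisfy [337/143 <= lambda_B] and [lambda_B + 1 <= 84/25]. *)
Lemma attained_interval (R : realType) (g : R) : 337 / 143 <= g <= 84 / 25 -> attained g.
Proof.
move=> /andP[g1 g2]; have g0 : 0 < g by lra.
have u1 : g^-1 <= 143 / 337.
  by rewrite -[143 / 337]invrK invf_div lef_pV2 ?posrE //; lra.
have u2 : 25 / 84 <= g^-1.
  by rewrite -[25 / 84]invrK invf_div lef_pV2 ?posrE //; lra.
rewrite -[g]invrK; have [a|a] := lerP (262 / 625) g^-1; first exact: (lower_range a u1).
have [b|b] := lerP (10 / 29) g^-1; first exact: (upper1_range u2 (ltW a) b).
exact: (upper2_range u2 (ltW a) (ltW b)).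
Qed.

Lemma attainedS (R : realType) (g : R) : 0 < g -> attained g -> attained (g + 1).
Proof.
move=> g0 [C [pC gC]]; exists (juxt C); split; first exact: perm_class_juxt.
apply: exp_growth_binomial gC => //; first by move=> n j jn; exact: juxt_count_ge.
by move=> n; exact: juxt_count_le.
Qed.

Lemma attained_ge (R : realType) (a : R) : 0 < a ->
  (forall g, a <= g <= a + 1 -> attained g) -> forall g, a <= g -> attained g.
Proof.
move=> a0 H g ag.
have [n] : exists n : nat, g <= a + n.+1%:R.
  exists (Num.bound g); have := archi_boundP (le_trans (ltW a0) ag).
  by rewrite (mulrS 1 (Num.bound g)); lra.
elim: n g ag => [|n IH] g ag gn; first by apply: H; rewrite ag.
have [le|gt] := lerP g (a + 1); first by apply: H; rewrite ag.
rewrite -[g](subrK 1); apply: attainedS; first lra.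
by apply: IH; [lra|move: gn; rewrite (mulrS 1 n.+1); lra].
Qed.

(** Divided by x^8, the equation says that a polynomial in 1/x with nonnegative coefficients equals
    1. It is increasing in 1/x, so its values at the two bounds locate the root. *)
Lemma root_bounds (R : realType) (x : R) : 0 < x ->
  x ^+ 8 - 2 * x ^+ 7 - x ^+ 5 - x ^+ 4 - 2 * x ^+ 3 - 2 * x ^+ 2 - x - 1 = 0 ->
  337 / 143 <= x <= 59 / 25.
Proof.
move=> x0 e; pose l : seq nat := [:: 0; 2; 0; 1; 1; 2; 2; 1; 1]%N.
have v0 : 0 < x^-1 by rewrite invr_gt0.
have hv : hor x^-1 l 0 = 1.
  have -> : hor x^-1 l 0 = 1 - (x ^+ 8 - 2 * x ^+ 7 - x ^+ 5 - x ^+ 4 - 2 * x ^+ 3 - 2 * x ^+ 2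
      - x - 1) / x ^+ 8 by rewrite /hor /=; field; lra.
  by rewrite e mul0r subr0.
apply/andP; split; rewrite leNgt; apply/negP => lt.
  have h : hor (143 / 337) l 0 <= hor x^-1 l 0.
    apply: hor_le; rewrite ?lexx //; apply/andP; split; first lra.
    by rewrite -[143 / 337]invrK invf_div lef_pV2 ?posrE; lra.
  by move: h; rewrite hv /hor /=; lra.
have h : hor x^-1 l 0 <= hor (25 / 59) l 0.
  apply: hor_le; rewrite ?lexx // ltW //=.
  by rewrite -[25 / 59]invrK invf_div lef_pV2 ?posrE; lra.
by move: h; rewrite hv /hor /=; lra.
Qed.

Theorem theorem2 (R : realType) (lambdaB : R)
  (hpos : 0 < lambdaB)
  (hroot : lambdaB ^+ 8 - 2 * lambdaB ^+ 7 - lambdaB ^+ 5 - lambdaB ^+ 4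
           - 2 * lambdaB ^+ 3 - 2 * lambdaB ^+ 2 - lambdaB - 1 = 0)
  (huniq : forall x : R, 0 < x ->
           x ^+ 8 - 2 * x ^+ 7 - x ^+ 5 - x ^+ 4
           - 2 * x ^+ 3 - 2 * x ^+ 2 - x - 1 = 0 -> x = lambdaB) :
  forall gamma : R, lambdaB <= gamma ->
    exists C : pred (seq nat), perm_class C /\ growth_rate_is C gamma.
Proof.
move=> g lg; have /andP[l1 l2] := root_bounds hpos hroot.
have [|C [pC gC]] := @attained_ge R _ hpos _ g lg.
  (* The bound 59/25 on the root is what makes 84/25 = 59/25 + 1 a sufficient right end. *)
  by move=> x /andP[x1 x2]; apply: attained_interval; apply/andP; split; lra.
by exists C; split=> //; apply: growth_rate_of_exp_growth gC; exact: lt_le_trans hpos lg.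
Qed.
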